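(* Let $\nu\in\mathcal N_G$. There exists a subset $X_\nu\subseteq\mathbb{A}(F)_\nu$ containing an open dense subset of $\mathbb{A}(F)_\nu$ such that, for any $a\in A(\overline F)$ for which the centralizer $G_a$ is a torus and $c(a)\in X_\nu$, the element $h\in W$ satisfying $\sigma(a)=h(a)$ is conjugate in $W$ to $w(\nu)$.
   Context: Let $G$ be a connected reductive group over $\mathbb{C}$ of rank $n$ whose derived group $G_{sc}$ is simply connected, of rank $l$. Fix a maximal torus $A$ and a Borel subgroup $B\supseteq A$; put $A_{sc}=A\cap G_{sc}$. Let $R\subset X^*(A)$ be the roots, $\Delta=\{\alpha_i\}_{i\in I}$, $I=\{1,\dots,l\}$, the simple roots determined by $B$, $Q(R),Q(R^\vee)$ root and coroot lattices, $P(R),P(R^\vee)$ their dual lattices, $\varpi_i$ the fundamental weights. Choose a $\mathbb{Z}$-basis $\omega_1,\dots,\omega_n$ of $X^*(A)$ with $\omega_i$ restricting to $\varpi_i$ on $A_{sc}$ for $i\le l$ and $\omega_{l+1},\dots,\omega_n$ a basis of the kernel of restriction. Let $W$ be the Weyl group, $c_i=\sum_{\lambda\in W\omega_i}e^\lambda$, $\mathbb{A}=\mathbb{G}_a^l\times\mathbb{G}_m^{n-l}$ and $c=(c_1,\dots,c_n):A\to\mathbb{A}$, identifying $A/W\cong\mathbb{A}$. $F=\mathbb{C}((\epsilon))$, $\overline F=\bigcup_n\mathbb{C}((\epsilon^{1/n}))$ with compatible roots, $\sigma$ the Galois generator with $\sigma(\epsilon^{1/n})=e^{2\pi\sqrt{-1}/n}\epsilon^{1/n}$,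 $\mathrm{val}$ the valuation with $\mathrm{val}(\epsilon^{1/n})=-1/n$. $\mathbb{A}(F)\subset F^n$ carries the topology where $F$ is a product of countably many copies of $\mathbb{C}$ and closed sets are given by polynomial equations over $\mathbb{C}$ in finitely many coordinates; subsets get the subspace topology. $\mathfrak a=X_*(A)\otimes\mathbb{R}$. For a standard parabolic $P=MN\supseteq B$ with Levi $M\supseteq A$, simple roots $\Delta_M$, roots $R_M$, Weyl group $W_M$: $A_M$ is the identity component of the center of $M$, $\mathfrak a_M=X_*(A_M)\otimes\mathbb{R}=\mathfrak a^{W_M}$, $p_M$ the $W_M$-average $\mathfrak a\to\mathfrak a_M$, $\Lambda_M=p_M(X_*(A))$ ($\cong X_*(A)/Q(R_M^\vee)$), $\Lambda_P^+=\{\nu\in\Lambda_M:\langle\alpha,\nu\rangle>0\ \forall\alpha\in\Delta\setminus\Delta_M\}$, and $\mathcal N_G=\coprod_P\Lambda_P^+$. For $\nu\in\mathcal N_G$, $\mathbb{A}(F)_\nu$ is the set of $c\in\mathbb{A}(\overline F)$ for which there is $a\in A(\overline F)$ with $c=c(a)$, $\sigma(a)=g(a)$ for some $g\in W$, and $\langle\lambda,\nu\rangle=\mathrm{val}\,\lambda(a)$ for all $\lambda\in X^*(A)$ (the Newton strata). $\psi$: for a reduced irreducible root system $R$ with basis $\{\alpha_i\}$, highest root $\tilde\alpha$, Weyl group $W$, let $W_e=P(R^\vee)\rtimes W$ act on $V^*$ ($V=Q(R)\otimes\mathbb{R}$) with $P(R^\vee)$ by translations; $C=\{v:\langle\alpha_i,v\rangle>0\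 \forall i,\ \langle\tilde\alpha,v\rangle<1\}$. Since $W_a=Q(R^\vee)\rtimes W$ acts simply transitively on alcoves, the stabilizer $\Gamma_C\subset W_e$ of $C$ maps isomorphically ($\xi$) onto $W_e/W_a\cong P(R^\vee)/Q(R^\vee)$; $\psi=\mathrm{pr}\circ\xi^{-1}$ with $\mathrm{pr}:W_e\to W$. For reducible $R$ take the product over components. $\psi_M:\Lambda_M\to W_M$ is the composite of $\Lambda_M\cong X_*(A)/Q(R_M^\vee)\to P(R_M^\vee)/Q(R_M^\vee)$ (induced by $\lambda\mapsto\langle\cdot,\lambda\rangle|_{Q(R_M)}$) with $\psi$ for $(R_M,\Delta_M)$. For $\nu\in\Lambda_P^+$, $w(\nu):=\psi_M(\nu)\in W$. *)

(* Defs.v *)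
From Stdlib Require Import Rdefinitions Rtrigo_def Rtrigo1 ClassicalEpsilon.
From HB Require Import structures.
From mathcomp Require Import all_boot all_order all_algebra.
From mathcomp Require Import Rstruct.
From mathcomp.real_closed Require Import complex.

Set Implicit Arguments.
Unset Strict Implicit.
Unset Printing Implicit Defensive.

Import Order.TTheory GRing.Theory Num.Theory.
Local Open Scope ring_scope.

Definition CC : Type := complex R.

(* Lattices.  X^*(A) = Z^n in the basis omega_1..omega_n, X_*(A) = Z^n *)
(* in the dual basis; a_ = X_*(A) (x) R = R^n.  Row vectors.            *)
Definition lat (n : nat) := 'rV[int]_n.
Definition avec (n : nat) := 'rV[R]_n.

(* pairing X^* x X_* -> Z *)
Definition ipair n (x y : lat n) : int := \sum_(k < n) x 0 k * y 0 k.
Definition rpair n (x : lat n) (v : avec n) : R := \sum_(k < n) (x 0 k)%:~R * v 0 k.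
Definition toA n (x : lat n) : avec n := map_mx (fun z : int => z%:~R) x.

Definition evec n (k : nat) : lat n := \row_(i < n) ((i : nat) == k)%:R.

(* reflection s_alpha on X^*: lambda |-> lambda *m refl p,
   i.e. lambda - <lambda, alpha^vee> alpha *)
Definition refl n (p : lat n * lat n) : 'M[int]_n := 1%:M - (p.2^T *m p.1).

(* Root data.  rts is the list of pairs (alpha, alpha^vee).             *)
Definition roots n (rts : seq (lat n * lat n)) : seq (lat n) := map fst rts.
Definition coroots n (rts : seq (lat n * lat n)) : seq (lat n) := map snd rts.

Definition zcomb n l (alpha : 'I_l -> lat n) (c : 'I_l -> int) : lat n :=
  \sum_(j < l) c j *: alpha j.

(* A reduced root datum (X^*, R, X_*, R^vee) with base Delta = {alpha j},
   such that the coroot of alpha j is e_j: this encodes simultaneously that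
   the derived group is simply connected and that the basis omega of X^*
   satisfies <omega_i, alpha_j^vee> = delta_ij (i <= l) and
   <omega_k, alpha_j^vee> = 0 (k > l). *)
Definition based_root_datum_sc n l (rts : seq (lat n * lat n))
    (alpha : 'I_l -> lat n) : Prop :=
  uniq (roots rts) /\ uniq (coroots rts) /\
  (forall p, p \in rts -> ipair p.1 p.2 = 2) /\
  (forall p q, p \in rts -> q \in rts ->
     q.1 - ipair q.1 p.2 *: p.1 \in roots rts /\
     q.2 - ipair p.1 q.2 *: p.2 \in coroots rts) /\
  (forall p, p \in rts -> 2%:~R *: p.1 \notin roots rts) /\
  (forall j : 'I_l, (alpha j, evec n j) \in rts) /\
  (forall c : 'I_l -> int, zcomb alpha c = 0 -> forall j, c j = 0) /\
  (forall p, p \in rts -> exists c : 'I_l -> int,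
      p.1 = zcomb alpha c /\ ((forall j, 0 <= c j) \/ (forall j, c j <= 0))).

(* Levi subgroups of standard parabolics: J = Delta_M, a subset of I.   *)
Definition in_RM n l (alpha : 'I_l -> lat n) (J : {set 'I_l}) (p : lat n * lat n) :=
  exists c : 'I_l -> int, (forall j, j \notin J -> c j = 0) /\ p.1 = zcomb alpha c.

Inductive inW n (S : lat n * lat n -> Prop) : 'M[int]_n -> Prop :=
  | inW1 : inW S 1%:M
  | inWr p M : S p -> inW S M -> inW S (refl p *m M).

Definition allR n (rts : seq (lat n * lat n)) (p : lat n * lat n) : Prop := p \in rts.
Definition RM n l (rts : seq (lat n * lat n)) (alpha : 'I_l -> lat n) (J : {set 'I_l})
  (p : lat n * lat n) : Prop := p \in rts /\ in_RM alpha J p.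

Definition inWG n (rts : seq (lat n * lat n)) := inW (allR rts).
Definition inWM n l rts (alpha : 'I_l -> lat n) (J : {set 'I_l}) := inW (@RM n l rts alpha J).

(* action of a Weyl group element (matrix M acting on X^* by lambda |-> lambda M)
   on a = X_* (x) R, contragredient so that <w lambda, w v> = <lambda, v>. *)
Definition actA n (M : 'M[int]_n) (v : avec n) : avec n :=
  v *m (invmx (map_mx (fun z : int => z%:~R : R) M))^T.

Definition pM n l rts (alpha : 'I_l -> lat n) (J : {set 'I_l}) (lam : lat n) (nu : avec n) :=
  exists s : seq 'M[int]_n, [/\ uniq s, (forall M, M \in s <-> inWM rts alpha J M) &
    nu = (size s)%:R^-1 *: \sum_(M <- s) actA M (toA lam)].

Definition LambdaP_plus n l rts (alpha : 'I_l -> lat n) (J : {set 'I_l}) (nu : avec n) :=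
  (exists lam : lat n, pM rts alpha J lam nu) /\
  (forall j, j \notin J -> 0 < rpair (alpha j) nu).

Definition QcorootM n l (rts : seq (lat n * lat n)) (alpha : 'I_l -> lat n)
    (J : {set 'I_l}) (x : lat n) :=
  exists c : nat -> int,
    (forall i, (i < size rts)%N -> ~ in_RM alpha J (nth (0, 0) rts i) -> c i = 0) /\
    x = \sum_(i < size rts) c i *: (nth (0, 0) rts i).2.

Definition posRM n l rts (alpha : 'I_l -> lat n) (J : {set 'I_l}) (x : lat n) :=
  (exists p, RM rts alpha J p /\ p.1 = x) /\
  exists c : 'I_l -> int, (forall j, 0 <= c j) /\ x = zcomb alpha c.
Definition root_le n l (alpha : 'I_l -> lat n) (x y : lat n) :=
  exists d : 'I_l -> int, (forall j, 0 <= d j) /\ y - x = zcomb alpha d.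
(* highest roots of (the irreducible components of) R_M:
   maximal positive roots of R_M *)
Definition highestRM n l rts (alpha : 'I_l -> lat n) (J : {set 'I_l}) (x : lat n) :=
  posRM rts alpha J x /\
  forall y, posRM rts alpha J y -> root_le alpha x y -> y = x.

(* the fundamental alcove of R_M, pulled back to a *)
Definition alcove n l rts (alpha : 'I_l -> lat n) (J : {set 'I_l}) (v : avec n) :=
  (forall j, j \in J -> 0 < rpair (alpha j) v) /\
  (forall x, highestRM rts alpha J x -> rpair x v < 1).

(* w(nu) = psi_M(nu): the Weyl part of the element of the extended affine
   Weyl group stabilising the alcove and lying in the class of nu *)
Definition w_of_nu n l rts (alpha : 'I_l -> lat n) (J : {set 'I_l}) (nu : avec n) (w : 'M[int]_n) :=
  exists lam mu : lat n, [/\ pM rts alpha J lam nu, QcorootM rts alpha J (mu - lam),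
     inWM rts alpha J w &
     forall v, alcove rts alpha J v <-> alcove rts alpha J (actA w v + toA mu)].

(* Puiseux series  Fbar = U_N C((eps^{1/N}))  as coefficient functions *)
(* rat -> C  (coefficient of eps^q).                                   *)
Definition Pui := rat -> CC.

Definition supp_in (f : Pui) (N : nat) (m : int) :=
  forall q, f q != 0 -> (denq (q *+ N) == 1) && (m%:~R <= q).
Definition is_pui (f : Pui) := exists (N : nat) (m : int), (0 < N)%N /\ supp_in f N m.

Definition pzero : Pui := fun _ => 0.
Definition pone : Pui := fun q => (q == 0)%:R.

(* h = f * g (Cauchy product, computed on a common grid) *)
Definition pprod (f g h : Pui) :=
  forall (N : nat) (m1 m2 : int), (0 < N)%N -> supp_in f N m1 -> supp_in g N m2 ->
  forall q, h q = \sum_(j < (Num.truncn ((q - m1%:~R - m2%:~R) *+ N)).+1)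
     f (m1%:~R + j%:R / N%:R) * g (q - (m1%:~R + j%:R / N%:R)).

(* the Galois generator: sigma(eps^{1/N}) = exp(2 pi i/N) eps^{1/N} *)
Definition expi (q : rat) : CC :=
  (cos (2 * PI * ratr q) +i* sin (2 * PI * ratr q))%C.
Definition psigma (f : Pui) : Pui := fun q => expi q * f q.

(* val f = v : val(eps^{q}) = -q, so v = - (lowest exponent) *)
Definition pval (f : Pui) (v : rat) :=
  f (- v) != 0 /\ forall q, f q != 0 -> - v <= q.

Definition in_F (f : Pui) := is_pui f /\ forall q, f q != 0 -> denq q == 1.

(* A(Fbar) = Hom(X^*(A), Fbar^x) ; a lambda = lambda(a).              *)
Definition isA n (a : lat n -> Pui) :=
  [/\ forall lam, is_pui (a lam), a 0 = pone &
      forall lam mu, pprod (a lam) (a mu) (a (lam + mu))].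

(* w(a):  lambda(w a) = (w^{-1} lambda)(a) *)
Definition actT n (M : 'M[int]_n) (a : lat n -> Pui) : lat n -> Pui :=
  fun lam => a (lam *m invmx M).
Definition sigmaA n (a : lat n -> Pui) : lat n -> Pui := fun lam => psigma (a lam).

(* G_a is a torus  (i.e. G_a = A: no root is trivial on a and no
   non-trivial Weyl element fixes a) *)
Definition centralizer_torus n rts (a : lat n -> Pui) :=
  (forall p, p \in rts -> a p.1 <> pone) /\
  (forall M, inWG rts M -> actT M a = a -> M = 1%:M).

Definition fin_enum n (P : lat n -> Prop) : seq (lat n) :=
  epsilon (inhabits [::]) (fun s => uniq s /\ forall x, x \in s <-> P x).

Definition orbitW n rts (x : lat n) (y : lat n) := exists M, inWG rts M /\ y = x *m M.

Definition cmap n rts (a : lat n -> Pui) : 'I_n -> Pui :=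
  fun i q => \sum_(x <- fin_enum (orbitW rts (evec n i))) a x q.

(* Abb = G_a^l x G_m^{n-l} *)
Definition in_Abar n l (c : 'I_n -> Pui) :=
  (forall i, is_pui (c i)) /\ (forall i : 'I_n, (l <= i)%N -> exists q, c i q != 0).

Definition newton n l rts (nu : avec n) (c : 'I_n -> Pui) :=
  in_Abar l c /\
  exists a : lat n -> Pui, [/\ isA a, c = cmap rts a,
     (exists g, inWG rts g /\ sigmaA a = actT g a) &
     forall lam : lat n, exists v : rat, ratr v = rpair lam nu /\ pval (a lam) v].

(* Topology on Abb(F) \subset F^n: coordinates are the coefficients    *)
(* c_i(eps^j), j in Z; closed sets are common zero loci of families of *)
(* complex polynomials each in finitely many coordinates.              *)
Inductive cpoly (n : nat) : Type :=
  | PConst of CC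
  | PVar of 'I_n & int
  | PAdd of cpoly n & cpoly n
  | PMul of cpoly n & cpoly n.

Fixpoint peval n (c : 'I_n -> Pui) (P : cpoly n) : CC :=
  match P with
  | PConst z => z
  | PVar i j => c i j%:~R
  | PAdd P1 P2 => peval c P1 + peval c P2
  | PMul P1 P2 => peval c P1 * peval c P2
  end.

Definition zeroset n (S : cpoly n -> Prop) (c : 'I_n -> Pui) :=
  forall P, S P -> peval c P = 0.

Definition rel_open n (Y U : ('I_n -> Pui) -> Prop) :=
  exists S : cpoly n -> Prop, forall c, U c <-> (Y c /\ ~ zeroset S c).

Definition rel_dense n (Y U : ('I_n -> Pui) -> Prop) :=
  forall V, rel_open Y V -> (exists c, V c) -> exists c, V c /\ U c.

(* Main.v *)
(* Let a in A(Fbar) have val a = nu dominant.  Its leading coefficient a_0 in A(C) satisfies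
   e^{-2 pi i nu} a_0 = h(a_0) with h in W_nu = W_M, and the leading coefficients of the c_i(a)
   are the W_M-orbit sums c_i^M(a_0).  Write a_0 = exp(-2 pi i x) with x complex and order
   complex numbers lexicographically: the affine Weyl group of M moves x into the closed alcove,
   and since the closed alcove is a fundamental domain, x is then fixed by the alcove
   automorphism v |-> w v + mu - nu attached to nu.  Hence h is conjugate to w as soon as no root
   of M takes the value 1 on a_0, and prod (1 - e^beta) over the roots of M is a polynomial in
   the leading coefficients of c: it defines the open set.

   For density, join x inside the closed alcove to an interior fixed point of the automorphism.
   Along the segment x_t, for t > 0, the character exp(-2 pi i x_t) has trivial stabiliser in
   W_M, so the Jacobian of the c_i^M is invertible there; solving order by order one finds
   a' = exp(-2 pi i x_t) eps^{-nu} exp(Y), with Y polynomial in eps^{1/N} and sigma(a') = w(a'),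
   such that c(a') agrees up to any given order with c(a) except for the leading coefficients,
   which are close to those of c(a) when t is small.  A polynomial condition involves only
   finitely many coefficients, so it holds at c(a') if it holds at c(a). *)
From Stdlib Require Import Rdefinitions ClassicalEpsilon.
From Stdlib Require Import Rtrigo_def Rtrigo1 Ratan Rpower Exp_prop Ranalysis1 Rtrigo_reg Ranalysis4.
From Stdlib Require Raxioms RIneq Rbasic_fun.
Require Import Defs.
From HB Require Import structures.
From mathcomp Require Import all_boot all_order all_algebra.
From mathcomp Require Import Rstruct boolp.
From mathcomp.real_closed Require Import complex.
From mathcomp Require Import ring lra zify.
Set Implicit Arguments.
Unset Strict Implicit.
Unset Printing Implicit Defensive.
Import Order.TTheory GRing.Theory Num.Theory.
Local Open Scope ring_scope.

(** * Pairings and the canonical invariant forms *)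


(** The quotient map is never inverted. Two facts about it suffice: the lowest terms of [c]
    determine the dominant valuation cocharacter, and every orbit sum under W_M is a polynomial in
    those of the basis weights and the inverses of the central ones. The second is proved once, for
    an abstract class of functions closed under ring operations, and used twice: for polynomials in
    the coefficients of [c], which gives the discriminant, and over dual numbers, which gives the
    invertible Jacobian. The lexicographic order lets one reduction treat both parts of a complex
    point; otherwise y would need a second reduction under the stabiliser of x. The discriminant
    criterion holds for every lift of [c] with valuation nu, not just the one witnessing membership
    in the stratum. This matters because the point [a] of the theorem comes with no valuation
    condition and must first be conjugated to dominant position. Weyl elements are matrices acting
    on characters from the right, and [ract M] is [actA] of the inverse; hence the matrix [M] of the
    alcove automorphism is the inverse of w(nu). *)

Section Pairing.
Variable n : nat.
Implicit Types (x y z : lat n) (u v : avec n).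

Lemma rpairDl x y v : rpair (x + y) v = rpair x v + rpair y v.
Proof. by rewrite /rpair -big_split; apply: eq_bigr => k _; rewrite mxE intrD mulrDl. Qed.
Lemma rpairNl x v : rpair (- x) v = - rpair x v.
Proof. by rewrite /rpair -sumrN; apply: eq_bigr => k _; rewrite mxE mulrNz mulNr. Qed.
Lemma rpairBl x y v : rpair (x - y) v = rpair x v - rpair y v.
Proof. by rewrite rpairDl rpairNl. Qed.
Lemma rpair0l v : rpair 0 v = 0.
Proof. by rewrite /rpair big1 // => k _; rewrite mxE mul0r. Qed.
Lemma rpairZl (c : int) x v : rpair (c *: x) v = c%:~R * rpair x v.
Proof. by rewrite /rpair mulr_sumr; apply: eq_bigr => k _; rewrite mxE intrM mulrA. Qed.
Lemma rpair_suml (I : Type) (r : seq I) (P : pred I) (F : I -> lat n) v :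
  rpair (\sum_(i <- r | P i) F i) v = \sum_(i <- r | P i) rpair (F i) v.
Proof. by apply: (big_morph (fun x => rpair x v)) => [x y|]; rewrite ?rpairDl ?rpair0l. Qed.

Lemma rpairDr x u v : rpair x (u + v) = rpair x u + rpair x v.
Proof. by rewrite /rpair -big_split; apply: eq_bigr => k _; rewrite mxE mulrDr. Qed.
Lemma rpairNr x v : rpair x (- v) = - rpair x v.
Proof. by rewrite /rpair -sumrN; apply: eq_bigr => k _; rewrite mxE mulrN. Qed.
Lemma rpairBr x u v : rpair x (u - v) = rpair x u - rpair x v.
Proof. by rewrite rpairDr rpairNr. Qed.
Lemma rpair0r x : rpair x 0 = 0.
Proof. by rewrite /rpair big1 // => k _; rewrite mxE mulr0. Qed.
Lemma rpairZr (c : R) x v : rpair x (c *: v) = c * rpair x v.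
Proof. by rewrite /rpair mulr_sumr; apply: eq_bigr => k _; rewrite mxE mulrCA. Qed.
Lemma rpair_sumr (I : Type) (r : seq I) (P : pred I) x (F : I -> avec n) :
  rpair x (\sum_(i <- r | P i) F i) = \sum_(i <- r | P i) rpair x (F i).
Proof. by apply: (big_morph (rpair x)) => [u v|]; rewrite ?rpairDr ?rpair0r. Qed.

Lemma rpair_toA x y : rpair x (toA y) = (ipair x y)%:~R.
Proof. rewrite /rpair /ipair rmorph_sum; apply: eq_bigr => k _; rewrite mxE. by rewrite rmorphM. Qed.

Lemma toAD x y : toA (x + y) = toA x + toA y.
Proof. by apply/rowP => k; rewrite !mxE intrD. Qed.
Lemma toAN x : toA (- x) = - toA x.
Proof. by apply/rowP => k; rewrite !mxE mulrNz. Qed.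
Lemma toAB x y : toA (x - y) = toA x - toA y.
Proof. by rewrite toAD toAN. Qed.
Lemma toA0 : toA (0 : lat n) = 0.
Proof. by apply/rowP => k; rewrite !mxE. Qed.
Lemma toAZ (c : int) x : toA (c *: x) = c%:~R *: toA x.
Proof. by apply/rowP => k; rewrite !mxE intrM. Qed.
Lemma toA_sum (I : Type) (r : seq I) (P : pred I) (F : I -> lat n) :
  toA (\sum_(i <- r | P i) F i) = \sum_(i <- r | P i) toA (F i).
Proof. by apply: (big_morph (@toA n)) => [x y|]; rewrite ?toAD ?toA0. Qed.
Lemma toA_inj : injective (@toA n).
Proof. by move=> x y /rowP h; apply/rowP => k; have := h k; rewrite !mxE => /intr_inj. Qed.

Lemma ipairC x y : ipair x y = ipair y x.
Proof. by apply: eq_bigr => k _; rewrite mulrC. Qed.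
Lemma rpair_toAC x y : rpair x (toA y) = rpair y (toA x).
Proof. by rewrite !rpair_toA ipairC. Qed.
Lemma ipairDl x y z : ipair (x + y) z = ipair x z + ipair y z.
Proof. by rewrite /ipair -big_split; apply: eq_bigr => k _; rewrite mxE mulrDl. Qed.
Lemma ipairNl x z : ipair (- x) z = - ipair x z.
Proof. by rewrite /ipair -sumrN; apply: eq_bigr => k _; rewrite mxE mulNr. Qed.
Lemma ipairZl (c : int) x z : ipair (c *: x) z = c * ipair x z.
Proof. by rewrite /ipair mulr_sumr; apply: eq_bigr => k _; rewrite mxE mulrA. Qed.
Lemma ipairDr x y z : ipair x (y + z) = ipair x y + ipair x z.
Proof. by rewrite ipairC ipairDl !(ipairC x). Qed.
Lemma ipairNr x y : ipair x (- y) = - ipair x y.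
Proof. by rewrite ipairC ipairNl ipairC. Qed.

Lemma rpair_evec (k : 'I_n) v : rpair (evec n k) v = v 0 k.
Proof.
rewrite /rpair (bigD1 k) //= mxE eqxx mul1r big1 ?addr0 // => i hi.
by rewrite mxE -val_eqE in hi *; rewrite (negbTE hi) mul0r.
Qed.
Lemma ipair_evec (k : 'I_n) x : ipair x (evec n k) = x 0 k.
Proof.
rewrite /ipair (bigD1 k) //= mxE eqxx mulr1 big1 ?addr0 // => i hi.
by rewrite mxE -val_eqE in hi *; rewrite (negbTE hi) mulr0.
Qed.
Lemma lat_expand x : x = \sum_k x 0 k *: evec n k.
Proof.
apply/rowP => i; rewrite summxE (bigD1 i) //= !mxE eqxx mulr1 big1 ?addr0 // => k ki.
by rewrite !mxE eq_sym val_eqE (negbTE ki) mulr0.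
Qed.
Lemma rpair_inj u v : (forall x, rpair x u = rpair x v) -> u = v.
Proof. by move=> h; apply/rowP => k; rewrite -!rpair_evec h. Qed.

End Pairing.

Section Form.
Variables (n : nat) (rts : seq (lat n * lat n)).
Hypothesis Hu : uniq (map fst rts).
Hypothesis H2 : forall p, p \in rts -> ipair p.1 p.2 = 2.
Hypothesis Hc : forall p q, p \in rts -> q \in rts ->
  q.1 - ipair q.1 p.2 *: p.1 \in map fst rts.
Implicit Types (u v : avec n) (p q : lat n * lat n).

(** Summing over all roots makes the form Weyl invariant without any choice. It is positive
    semidefinite, with radical the common kernel of the roots. *)
Definition rform u v : R := \sum_(b <- map fst rts) rpair b u * rpair b v.
Definition srefl p v : avec n := v - rpair p.1 v *: toA p.2.

Lemma rformC u v : rform u v = rform v u.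
Proof. by apply: eq_bigr => b _; rewrite mulrC. Qed.
Lemma rformDl u u' v : rform (u + u') v = rform u v + rform u' v.
Proof. by rewrite /rform -big_split; apply: eq_bigr => b _; rewrite rpairDr mulrDl. Qed.
Lemma rformZl c u v : rform (c *: u) v = c * rform u v.
Proof. by rewrite /rform mulr_sumr; apply: eq_bigr => b _; rewrite rpairZr mulrA. Qed.
Lemma rformNl u v : rform (- u) v = - rform u v.
Proof. by rewrite -scaleN1r rformZl mulN1r. Qed.
Lemma rformDr u u' v : rform v (u + u') = rform v u + rform v u'.
Proof. by rewrite rformC rformDl !(rformC v). Qed.
Lemma rformZr c u v : rform v (c *: u) = c * rform v u.
Proof. by rewrite rformC rformZl rformC. Qed.
Lemma rformNr u v : rform v (- u) = - rform v u.
Proof. by rewrite rformC rformNl rformC. Qed.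
Lemma rform_suml (I : Type) (r : seq I) (P : pred I) (F : I -> avec n) v :
  rform (\sum_(i <- r | P i) F i) v = \sum_(i <- r | P i) rform (F i) v.
Proof.
apply: (big_morph (fun x => rform x v)) => [x y|]; rewrite ?rformDl //.
by rewrite -(scale0r 0) rformZl mul0r.
Qed.

Lemma rpair_srefl p q v :
  rpair q.1 (srefl p v) = rpair (q.1 - ipair q.1 p.2 *: p.1) v.
Proof. by rewrite rpairBr rpairZr rpairBl rpairZl rpair_toA mulrC. Qed.

Lemma rform_refl p u v : p \in rts -> rform (srefl p u) (srefl p v) = rform u v.
Proof.
move=> hp; rewrite /rform.
pose f (b : lat n) := b - ipair b p.2 *: p.1.
have fK : involutive f.
  move=> b; rewrite /f ipairDl ipairNl ipairZl (H2 hp).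
  have -> : ipair b p.2 - ipair b p.2 * 2 = - ipair b p.2 by ring.
  by rewrite scaleNr opprK subrK.
have pe : perm_eq (map f (map fst rts)) (map fst rts).
  have hu : uniq (map f (map fst rts)) by rewrite map_inj_uniq //; exact: inv_inj.
  apply: uniq_perm => //.
  have hs : {subset map f (map fst rts) <= map fst rts}.
    by move=> _ /mapP[_ /mapP[q hq ->] ->]; exact: Hc.
  move=> b; apply/idP/idP => [|hb]; first exact: hs.
  by rewrite -(fK b); apply: map_f; apply: hs; apply: map_f.
rewrite -[RHS](perm_big _ pe) /= [RHS]big_map; apply: eq_bigr => b _.
by rewrite !(rpair_srefl p (b, 0)).
Qed.

(** The reflection negates its own coroot; invariance of the form then makes pairing with the coroot
    proportional to the root. *)
Lemma rform_coroot p v : p \in rts ->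
  2 * rform (toA p.2) v = rform (toA p.2) (toA p.2) * rpair p.1 v.
Proof.
move=> hp.
have e : srefl p (toA p.2) = - toA p.2.
  rewrite /srefl rpair_toA (H2 hp).
  by apply/rowP => k; rewrite !mxE; ring.
have := rform_refl (toA p.2) v hp.
rewrite e rformNl /srefl rformDr rformNr rformZr => h.
have -> : 2 * rform (toA p.2) v = rform (toA p.2) v + rform (toA p.2) v by ring.
rewrite -{1}h; ring.
Qed.

Lemma rform_ge0 v : 0 <= rform v v.
Proof. by apply: sumr_ge0 => b _; rewrite -expr2 sqr_ge0. Qed.

Lemma rform_eq0 v : rform v v = 0 -> forall p, p \in rts -> rpair p.1 v = 0.
Proof.
move=> h p hp; have /eqP := h.
rewrite /rform big_seq psumr_eq0 => [|b _]; last by rewrite -expr2 sqr_ge0.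
move/allP => /(_ p.1 (map_f fst hp)); rewrite map_f //= => /eqP/eqP.
by rewrite mulf_eq0 orbb => /eqP.
Qed.

Lemma rform_coroot_gt0 p : p \in rts -> 0 < rform (toA p.2) (toA p.2).
Proof.
move=> hp; rewrite lt_neqAle rform_ge0 andbT eq_sym; apply/eqP => /rform_eq0/(_ p hp).
by rewrite rpair_toA (H2 hp) => /eqP; rewrite (eqr_int _ 2 0).
Qed.

End Form.

Section Nondeg.
Variables (n : nat) (rts : seq (lat n * lat n)).
Hypothesis Hu : uniq (map snd rts).
Hypothesis H2 : forall p, p \in rts -> ipair p.1 p.2 = 2.
Hypothesis Hc : forall p q, p \in rts -> q \in rts ->
  q.2 - ipair p.1 q.2 *: p.2 \in map snd rts.

Let swp (p : lat n * lat n) := (p.2, p.1).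
Let rts' := map swp rts.
Let Hu' : uniq (map fst rts').
Proof. by rewrite -map_comp. Qed.
Let H2' p : p \in rts' -> ipair p.1 p.2 = 2.
Proof. by move=> /mapP[q hq ->] /=; rewrite ipairC H2. Qed.
Let Hc' p q : p \in rts' -> q \in rts' -> q.1 - ipair q.1 p.2 *: p.1 \in map fst rts'.
Proof. by move=> /mapP[p' hp ->] /mapP[q' hq ->] /=; rewrite -map_comp ipairC; exact: Hc. Qed.
(** The form of the dual datum, with roots and coroots exchanged; it measures characters, embedded
    by [toA]. *)
Definition dform := rform (map (fun p : lat n * lat n => (p.2, p.1)) rts).

Lemma dform_root p w : p \in rts ->
  2 * dform (toA p.1) w = dform (toA p.1) (toA p.1) * rpair p.2 w.
Proof. by move=> hp; have := rform_coroot Hu' H2' Hc' w (map_f swp hp). Qed.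
Lemma dform_root_gt0 p : p \in rts -> 0 < dform (toA p.1) (toA p.1).
Proof. by move=> hp; have := rform_coroot_gt0 H2' (map_f swp hp). Qed.

(** Under [dform] the coroot of p corresponds to 2p/[d p], so [v] corresponds to some [y] in the
    span of the roots. If all roots kill [v], then [dform y y] vanishes, hence all coroots kill [y],
    and [v] pairs to zero with everything. *)
Lemma coroot_span_nondeg (c : lat n * lat n -> R) :
  let v := \sum_(p <- rts) c p *: toA p.2 in
  (forall p, p \in rts -> rpair p.1 v = 0) -> v = 0.
Proof.
move=> v hv.
pose d (p : lat n * lat n) := dform (toA p.1) (toA p.1).
pose y : avec n := \sum_(p <- rts) (c p * (2 / d p)) *: toA p.1.
have dc p w : p \in rts -> 2 * dform (toA p.1) w = d p * rpair p.2 w.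
  exact: dform_root.
have d0 p : p \in rts -> 0 < d p.
  exact: dform_root_gt0.
have vy x : rpair x v = dform y (toA x).
  rewrite rpair_sumr /dform rform_suml big_seq [RHS]big_seq; apply: eq_bigr => p hp.
  rewrite rpairZr rformZl -mulrA; congr (_ * _).
  rewrite rpair_toAC; apply: (mulfI (lt0r_neq0 (d0 _ hp))).
  rewrite -dc // -/dform; field; exact: lt0r_neq0 (d0 _ hp).
have yy : dform y y = 0.
  rewrite {1}/y /dform rform_suml big_seq big1 // => p hp.
  by rewrite rformZl rformC -/dform -vy hv ?mulr0.
apply: rpair_inj => x; rewrite vy rpair0r /dform /rform big_seq big1 // => g.
case/mapP => p hp ->.
by have := rform_eq0 yy hp => /= ->; rewrite mul0r.
Qed.

End Nondeg.


(** * Contragredient action of matrices on real coweights *)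

Section Act.
Variable n : nat.
Implicit Types (x y : lat n) (v : avec n) (p q : lat n * lat n) (M N : 'M[int]_n).

(* ract M is the transpose of lambda |-> lambda *m M, so that actA M = ract M^-1. *)
Definition ract M v : avec n := v *m (map_mx (fun z : int => z%:~R) M)^T.

Lemma rpair_ract x M v : rpair x (ract M v) = rpair (x *m M) v.
Proof.
rewrite /rpair /ract.
under eq_bigr do rewrite mxE mulr_sumr.
rewrite exchange_big; apply: eq_bigr => i _ /=.
rewrite mxE rmorph_sum mulr_suml; apply: eq_bigr => j _.
rewrite !mxE rmorphM /=. ring.
Qed.
Lemma ipair_mulmx x M y : ipair (x *m M) y = ipair x (y *m M^T).
Proof.
rewrite /ipair.
under eq_bigr do rewrite mxE mulr_suml.
rewrite exchange_big; apply: eq_bigr => i _ /=.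
rewrite mxE mulr_sumr; apply: eq_bigr => j _.
by rewrite !mxE mulrAC mulrA.
Qed.
Lemma ractM M N v : ract M (ract N v) = ract (M *m N) v.
Proof. by apply: rpair_inj => x; rewrite !rpair_ract mulmxA. Qed.
Lemma ract1 v : ract 1%:M v = v.
Proof. by apply: rpair_inj => x; rewrite rpair_ract mulmx1. Qed.
Lemma ractD M u v : ract M (u + v) = ract M u + ract M v.
Proof. exact: mulmxDl. Qed.
Lemma ractN M v : ract M (- v) = - ract M v.
Proof. exact: mulNmx. Qed.
Lemma ractB M u v : ract M (u - v) = ract M u - ract M v.
Proof. exact: mulmxBl. Qed.
Lemma ractZ M (c : R) v : ract M (c *: v) = c *: ract M v.
Proof. by rewrite /ract scalemxAl. Qed.
Lemma ract0 M : ract M 0 = 0.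
Proof. exact: mul0mx. Qed.
Lemma ract_sum (I : Type) (r : seq I) (P : pred I) M (F : I -> avec n) :
  ract M (\sum_(i <- r | P i) F i) = \sum_(i <- r | P i) ract M (F i).
Proof. by apply: (big_morph (ract M)) => [u v|]; rewrite ?ractD ?ract0. Qed.
Lemma ract_toA M x : ract M (toA x) = toA (x *m M^T).
Proof.
by apply: rpair_inj => y; rewrite rpair_ract !rpair_toA ipair_mulmx.
Qed.
Lemma actA_ract M N v : M *m N = 1%:M -> actA M v = ract N v.
Proof.
move=> h; rewrite /actA /ract; congr (_ *m _^T).
have e : map_mx (intr : int -> R) M *m map_mx intr N = 1%:M.
  by rewrite -map_mxM h map_mx1.
have [uM _] := mulmx1_unit e.
by apply: (can_inj (mulKmx uM)); rewrite mulmxV // e.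
Qed.

Lemma mul_refl x p : x *m refl p = x - ipair x p.2 *: p.1.
Proof.
rewrite /refl mulmxBr mulmx1 mulmxA; congr (_ - _).
apply/rowP => k; rewrite !mxE big_ord1 !mxE; congr (_ * _).
by apply: eq_bigr => i _; rewrite mxE.
Qed.
Lemma mul_reflT x p : x *m (refl p)^T = x - ipair p.1 x *: p.2.
Proof.
rewrite /refl linearB /= trmx1 mulmxBr mulmx1; congr (_ - _).
rewrite trmx_mul trmxK mulmxA.
apply/rowP => k; rewrite !mxE big_ord1 !mxE; congr (_ * _).
by apply: eq_bigr => i _; rewrite mxE mulrC.
Qed.
Lemma refl_invol p : ipair p.1 p.2 = 2 -> refl p *m refl p = 1%:M.
Proof.
move=> h; rewrite /refl mulmxBr mulmx1 mulmxBl mul1mx -mulmxA (mulmxA p.1).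
have -> : p.1 *m p.2^T = 2%:M.
  apply/matrixP => i j; rewrite !ord1 !mxE eqxx -h.
  by apply: eq_bigr => k _; rewrite mxE.
rewrite mul_scalar_mx -scalemxAr.
by apply/matrixP => i j; rewrite !mxE; ring.
Qed.

Lemma invmx_refl p : ipair p.1 p.2 = 2 -> invmx (refl p) = refl p.
Proof.
move=> h; have e := refl_invol h; have [u _] := mulmx1_unit e.
by rewrite -[RHS](mulKmx u) e mulmx1.
Qed.

End Act.

(** * Root combinatorics and Weyl groups *)


Section RootDatum.
Variables (n l : nat) (rts : seq (lat n * lat n)) (alpha : 'I_l -> lat n).
Hypothesis Hrd : based_root_datum_sc rts alpha.
Implicit Types (x y : lat n) (v : avec n) (p q : lat n * lat n) (M N : 'M[int]_n).
Implicit Types (J : {set 'I_l}) (ws : seq 'I_l).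

Lemma root_uniq : uniq (map fst rts). Proof. by case: Hrd. Qed.
Lemma coroot_uniq : uniq (map snd rts). Proof. by case: Hrd => _ []. Qed.
Lemma root_pair2 p : p \in rts -> ipair p.1 p.2 = 2.
Proof. by case: Hrd => _ [_ [h _]]; exact: h. Qed.
Lemma root_closed p q : p \in rts -> q \in rts ->
  q.1 - ipair q.1 p.2 *: p.1 \in map fst rts.
Proof. by case: Hrd => _ [_ [_ [h _]]] hp hq; case: (h p q hp hq). Qed.
Lemma coroot_closed p q : p \in rts -> q \in rts ->
  q.2 - ipair p.1 q.2 *: p.2 \in map snd rts.
Proof. by case: Hrd => _ [_ [_ [h _]]] hp hq; case: (h p q hp hq). Qed.
Lemma double_notin p : p \in rts -> 2%:~R *: p.1 \notin map fst rts.
Proof. by case: Hrd => _ [_ [_ [_ [h _]]]]; exact: h. Qed.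
Lemma simple_in (j : 'I_l) : (alpha j, evec n j) \in rts.
Proof. by case: Hrd => _ [_ [_ [_ [_ [h _]]]]]; exact: h. Qed.
Lemma zcomb_free (c : 'I_l -> int) : zcomb alpha c = 0 -> forall j, c j = 0.
Proof. by case: Hrd => _ [_ [_ [_ [_ [_ [h _]]]]]]; exact: h. Qed.
Lemma root_sign p : p \in rts -> exists c : 'I_l -> int,
  p.1 = zcomb alpha c /\ ((forall j, 0 <= c j) \/ (forall j, c j <= 0)).
Proof. by case: Hrd => _ [_ [_ [_ [_ [_ [_ h]]]]]]; exact: h. Qed.

Lemma uniq_rts : uniq rts. Proof. exact: map_uniq root_uniq. Qed.
Lemma root_inj p q : p \in rts -> q \in rts -> p.1 = q.1 -> p = q.
Proof.
move=> hp hq e; have := root_uniq.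
move/(uniqP 0) => /(_ (index p rts) (index q rts)).
rewrite !inE size_map !index_mem => /(_ hp hq).
rewrite !(nth_map 0) ?index_mem // !nth_index // => /(_ e) h.
by rewrite -(nth_index 0 hp) h nth_index.
Qed.

Lemma zcomb_inj (c d : 'I_l -> int) : zcomb alpha c = zcomb alpha d -> c =1 d.
Proof.
move=> e j; apply/eqP; rewrite -subr_eq0; apply/eqP.
apply: (zcomb_free (c := fun j => c j - d j)).
by rewrite /zcomb; under eq_bigr do rewrite scalerBl; rewrite sumrB -/(zcomb alpha c) e subrr.
Qed.
Lemma zcombD (c d : 'I_l -> int) :
  zcomb alpha (fun j => c j + d j) = zcomb alpha c + zcomb alpha d.
Proof. by rewrite /zcomb -big_split; apply: eq_bigr => j _; rewrite scalerDl. Qed.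
Lemma zcombZ m (c : 'I_l -> int) : zcomb alpha (fun j => m * c j) = m *: zcomb alpha c.
Proof. by rewrite /zcomb scaler_sumr; apply: eq_bigr => j _; rewrite scalerA. Qed.
Lemma zcomb_delta j : zcomb alpha (fun k => (k == j)%:R) = alpha j.
Proof.
rewrite /zcomb (bigD1 j) //= eqxx scale1r big1 ?addr0 // => k /negbTE ->.
by rewrite scale0r.
Qed.

Lemma root_neq0 p : p \in rts -> p.1 != 0.
Proof.
move=> hp; apply/eqP => e; have := root_pair2 hp; rewrite e.
by rewrite /ipair big1 // => k _; rewrite mxE mul0r.
Qed.

Definition spanJ J x := exists c : 'I_l -> int, (forall j, j \notin J -> c j = 0) /\ x = zcomb alpha c.
Definition posr x := exists c : 'I_l -> int, (forall j, 0 <= c j) /\ x = zcomb alpha c.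

Lemma spanJD J x y : spanJ J x -> spanJ J y -> spanJ J (x + y).
Proof.
move=> [c [hc ->]] [d [hd ->]]; exists (fun j => c j + d j); split; last by rewrite zcombD.
by move=> j hj; rewrite hc // hd.
Qed.
Lemma spanJZ J m x : spanJ J x -> spanJ J (m *: x).
Proof.
move=> [c [hc ->]]; exists (fun j => m * c j); split; last by rewrite zcombZ.
by move=> j hj; rewrite hc // mulr0.
Qed.
Lemma spanJ_simple J j : j \in J -> spanJ J (alpha j).
Proof.
move=> hj; exists (fun k => (k == j)%:R); rewrite zcomb_delta; split => // k.
by by case: eqP => // ->; rewrite hj.
Qed.
Lemma spanJ_setT x p : p \in rts -> spanJ setT p.1.
Proof. by move=> /root_sign [c [-> _]]; exists c; split => // j; rewrite inE. Qed.
Lemma posrD x y : posr x -> posr y -> posr (x + y).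
Proof.
move=> [c [hc ->]] [d [hd ->]]; exists (fun j => c j + d j); split; last by rewrite zcombD.
by move=> j; rewrite addr_ge0.
Qed.
Lemma posr_simple j : posr (alpha j).
Proof. by exists (fun k => (k == j)%:R); rewrite zcomb_delta; split => // k; case: eqP. Qed.
Lemma posr0 : posr 0.
Proof. by exists (fun=> 0); split => //; rewrite /zcomb big1 // => j _; rewrite scale0r. Qed.
Lemma posrZ (m : int) x : 0 <= m -> posr x -> posr (m *: x).
Proof.
move=> hm [c [hc ->]]; exists (fun j => m * c j); split; last by rewrite zcombZ.
by move=> j; rewrite mulr_ge0.
Qed.
Lemma posr_antisym x : posr x -> posr (- x) -> x = 0.
Proof.
move=> [c [hc ->]] [d [hd e]].
have h j : c j + d j = 0.
  apply: (zcomb_free (c := fun j => c j + d j)); by rewrite zcombD -e subrr.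
rewrite /zcomb big1 // => j _; have -> : c j = 0 by have := h j; have := hc j; have := hd j; lia.
by rewrite scale0r.
Qed.
Lemma root_posr p : p \in rts -> posr p.1 \/ posr (- p.1).
Proof.
move=> /root_sign [c [-> [h|h]]]; [left; by exists c | right].
exists (fun j => -1 * c j); rewrite zcombZ scaleN1r; split => // j.
by rewrite mulN1r oppr_ge0.
Qed.
Lemma root_not_both p : p \in rts -> posr p.1 -> posr (- p.1) -> False.
Proof. by move=> hp h1 h2; have := root_neq0 hp; rewrite (posr_antisym h1 h2) eqxx. Qed.

Definition corspan v := exists c : lat n * lat n -> R, v = \sum_(p <- rts) c p *: toA p.2.
Lemma corspanD u v : corspan u -> corspan v -> corspan (u + v).
Proof.
move=> [c ->] [d ->]; exists (fun p => c p + d p).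
by rewrite -big_split; apply: eq_bigr => p _; rewrite scalerDl.
Qed.
Lemma corspanZ a v : corspan v -> corspan (a *: v).
Proof.
move=> [c ->]; exists (fun p => a * c p).
by rewrite scaler_sumr; apply: eq_bigr => p _; rewrite scalerA.
Qed.
Lemma corspan_coroot p : p \in rts -> corspan (toA p.2).
Proof.
move=> hp; exists (fun q => (q == p)%:R).
rewrite (bigD1_seq p) ?uniq_rts //= eqxx scale1r big1 ?addr0 // => q /negbTE ->.
by rewrite scale0r.
Qed.
Lemma corspan_eq0 v : corspan v -> (forall p, p \in rts -> rpair p.1 v = 0) -> v = 0.
Proof.
move=> [c ->]; apply: coroot_span_nondeg.
- exact: coroot_uniq.
- exact: root_pair2.
- exact: coroot_closed.
Qed.

Lemma scale_lat_eq0 (m : int) x : x != 0 -> (m *: x == 0) = (m == 0).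
Proof.
move=> /rV0Pn[k hk]; apply/eqP/eqP => [/rowP/(_ k)/eqP|->]; last by rewrite scale0r.
by rewrite !mxE mulf_eq0 (negbTE hk) orbF => /eqP.
Qed.

Lemma roots_refl p x : p \in rts -> x \in map fst rts -> x *m refl p \in map fst rts.
Proof. by move=> hp /mapP[q hq ->]; rewrite mul_refl; exact: root_closed. Qed.

(** The axioms close roots and coroots under reflections separately; the point is that the two
    images are still paired with each other. If the image root belongs to [r] and the image coroot
    to [t], then [r.2] and [t.2] both define reflections in [r.1] that preserve the roots. Their
    composite is unipotent, so finiteness of the root set makes [t.2 - r.2] vanish on all roots, and
    nondegeneracy makes it zero. *)
Lemma pair_closed p q : p \in rts -> q \in rts ->
  (q.1 *m refl p, q.2 *m (refl p)^T) \in rts.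
Proof.
move=> hp hq.
have : q.1 *m refl p \in map fst rts by rewrite mul_refl; exact: root_closed.
have : q.2 *m (refl p)^T \in map snd rts by rewrite mul_reflT; exact: coroot_closed.
move=> /mapP[t ht e2] /mapP[r hr e1].
suff e : r.2 = t.2 by rewrite e1 e2 -e; case: r hr {e1 e}.
pose t2 := q.2 *m (refl p)^T.
have r12 : ipair r.1 t.2 = 2.
  by rewrite -e1 -e2 ipair_mulmx -mulmxA -trmx_mul refl_invol ?root_pair2 // trmx1 mulmx1 root_pair2.
have st b : b \in map fst rts -> b - ipair b t.2 *: r.1 \in map fst rts.
  move=> /(roots_refl hp)/(roots_refl hq)/(roots_refl hp).
  suff -> : b *m refl p *m refl q *m refl p = b - ipair b t.2 *: r.1 by [].
  rewrite [b *m refl p *m refl q]mul_refl mulmxBl -scalemxAl e1.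
  by rewrite -mulmxA refl_invol ?root_pair2 // mulmx1 ipair_mulmx e2.
pose d : lat n := t.2 - r.2.
have rd : ipair r.1 d = 0 by rewrite ipairDr ipairNr r12 root_pair2.
(* Composing the two reflections translates every root b by multiples of <b, d> r. *)
have sd b k : b \in map fst rts -> b - (k%:R * ipair b d) *: r.1 \in map fst rts.
  move=> hb; elim: k => [|k IH]; first by rewrite mul0r scale0r subr0.
  have := st _ (roots_refl hr IH); rewrite mul_refl.
  set x := b - _ *: r.1; set y := x - _; suff -> : y - ipair y t.2 *: r.1 = b - (k.+1%:R * ipair b d) *: r.1 by [].
  have xd : ipair x d = ipair b d by rewrite ipairDl ipairNl ipairZl rd mulr0 subr0.
  rewrite {1 2}/y ipairDl ipairNl ipairZl r12 -addrA -opprD -scalerDl.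
  have -> : ipair x r.2 + (ipair x t.2 - ipair x r.2 * 2) = ipair x d.
    by rewrite /d ipairDr ipairNr; ring.
  by rewrite xd /x -addrA -opprD -scalerDl -[k.+1%:R]natr1 mulrDl mul1r.
have bd b : b \in map fst rts -> ipair b d = 0.
  move=> hb; apply/eqP; apply: contraT => nz.
  pose s := [seq b - (k%:R * ipair b d) *: r.1 | k <- iota 0 (size rts).+1].
  have us : uniq s.
    rewrite map_inj_uniq ?iota_uniq // => k1 k2 /addrI /oppr_inj /eqP.
    rewrite -subr_eq0 -scalerBl (scale_lat_eq0 _ (root_neq0 hr)) -mulrBl.
    by rewrite mulf_eq0 (negbTE nz) orbF subr_eq0 eqr_nat => /eqP.
  have ss : {subset s <= map fst rts} by move=> _ /mapP[k _ ->]; exact: sd.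
  by have := uniq_leq_size us ss; rewrite !size_map size_iota ltnn.
have /toA_inj/eqP : toA d = toA 0; last by rewrite subr_eq0 => /eqP.
rewrite toA0; apply: corspan_eq0.
  by rewrite toAB -scaleN1r; apply: corspanD; [|apply: corspanZ]; apply: corspan_coroot.
by move=> b hb; rewrite rpair_toA bd // map_f.
Qed.

Lemma inW_gen (S : lat n * lat n -> Prop) p : S p -> inW S (refl p).
Proof. by move=> h; rewrite -[refl p]mulmx1; apply: inWr => //; exact: inW1. Qed.
Lemma inW_mul (S : lat n * lat n -> Prop) M N : inW S M -> inW S N -> inW S (M *m N).
Proof.
elim=> [|p M' hp _ IH] hN; first by rewrite mul1mx.
by rewrite -mulmxA; apply: inWr => //; exact: IH.
Qed.
Lemma inW_mono (S S' : lat n * lat n -> Prop) M :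
  (forall p, S p -> S' p) -> inW S M -> inW S' M.
Proof. by move=> h; elim=> [|p M' hp _ IH]; [exact: inW1|apply: inWr => //; exact: h]. Qed.

Notation WG := (inWG rts).
Notation WJ := (inWM rts alpha).
Notation RJ := (RM rts alpha).

Lemma inW_inv (S : lat n * lat n -> Prop) M : (forall p, S p -> p \in rts) -> inW S M ->
  [/\ M \in unitmx & inW S (invmx M)].
Proof.
move=> hS hM.
have [N [hN MN]] : exists N, inW S N /\ M *m N = 1%:M.
  elim: hM => [|p M' hp _ [N [hN e]]]; first by exists 1%:M; rewrite mulmx1; split=> //; exact: inW1.
  exists (N *m refl p); split; first by apply: inW_mul => //; exact: inW_gen.
  by rewrite mulmxA -(mulmxA (refl p)) e mulmx1 refl_invol // root_pair2 //; exact: hS.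
have [uM _] := mulmx1_unit MN; split=> //.
by rewrite -[invmx M]mulmx1 -MN mulKmx.
Qed.
Lemma RJ_rts J p : RJ J p -> p \in rts. Proof. by case. Qed.
Lemma WG_unit M : WG M -> M \in unitmx. Proof. by move=> /(inW_inv (fun p hp => hp))[]. Qed.
Lemma WG_inv M : WG M -> WG (invmx M). Proof. by move=> /(inW_inv (fun p hp => hp))[]. Qed.
Lemma WG_mul M N : WG M -> WG N -> WG (M *m N). Proof. exact: inW_mul. Qed.
Lemma WJ_inv J M : WJ J M -> WJ J (invmx M).
Proof. by move=> /(inW_inv (@RJ_rts J))[]. Qed.
Lemma WJ1 J : WJ J 1%:M. Proof. exact: inW1. Qed.
Lemma WJ_mul J M N : WJ J M -> WJ J N -> WJ J (M *m N). Proof. exact: inW_mul. Qed.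
Lemma WJ_WG J M : WJ J M -> WG M.
Proof. by apply: inW_mono; exact: RJ_rts. Qed.
Lemma WJ_unit J M : WJ J M -> M \in unitmx. Proof. by move/WJ_WG/WG_unit. Qed.
Lemma WG_WJ M : WG M -> WJ setT M.
Proof. by apply: inW_mono => p hp; split=> //; exact: (spanJ_setT 0 hp). Qed.

Definition pact M p : lat n * lat n := (p.1 *m M, p.2 *m (invmx M)^T).
Lemma pact_in M p : WG M -> p \in rts -> pact M p \in rts.
Proof.
rewrite /pact => hM; elim: hM p => [|q M' hq hM' IH] p hp.
  by rewrite invmx1 trmx1 !mulmx1; case: p hp.
have := IH _ (pair_closed hq hp); rewrite /= !mulmxA.
suff -> : (invmx (refl q *m M'))^T = (refl q)^T *m (invmx M')^T by rewrite mulmxA.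
rewrite -trmx_mul; congr (_^T).
have uM := WG_unit hM'.
have e : (invmx M' *m refl q) *m (refl q *m M') = 1%:M.
  by rewrite -mulmxA (mulmxA (refl q)) refl_invol ?root_pair2 // mul1mx mulVmx.
have [_ u] := mulmx1_unit e.
by rewrite -[LHS]mul1mx -e mulmxK.
Qed.
Lemma refl_pact M p : M \in unitmx -> refl (pact M p) = invmx M *m refl p *m M.
Proof.
move=> uM; rewrite /refl /pact /= trmx_mul trmxK mulmxBr mulmx1 mulmxBl mulVmx //.
by rewrite !mulmxA.
Qed.
Lemma refl_opp p : refl (- p.1, - p.2) = refl p.
Proof.
rewrite /refl /=; congr (_ - _); apply/matrixP => i j.
by rewrite !mxE; apply: eq_bigr => k _; rewrite !mxE mulrNN.
Qed.
Lemma root_opp p : p \in rts -> (- p.1, - p.2) \in rts.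
Proof.
move=> hp; have := pair_closed hp hp; rewrite mul_refl mul_reflT root_pair2 //.
suff h x : x - 2 *: x = - x by rewrite !h.
by apply/rowP => k; rewrite !mxE; ring.
Qed.
Lemma RJ_opp J p : RJ J p -> RJ J (- p.1, - p.2).
Proof.
move=> [hp hs]; split; first exact: root_opp.
by rewrite /in_RM /= -scaleN1r; exact: (spanJZ (-1) hs).
Qed.
Lemma spanJ_WJ J M x : WJ J M -> spanJ J x -> spanJ J (x *m M).
Proof.
move=> hM; elim: hM x => [|p M' [_ hp] _ IH] x hx; first by rewrite mulmx1.
rewrite mulmxA; apply: IH; rewrite mul_refl -scaleNr; apply: spanJD => //.
exact: spanJZ.
Qed.
Lemma RJ_pact J M p : WJ J M -> RJ J p -> RJ J (pact M p).
Proof.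
move=> hM [hp hs]; split; first by apply: pact_in => //; exact: WJ_WG hM.
exact: spanJ_WJ.
Qed.

Definition sr (j : 'I_l) := refl (alpha j, evec n j).
Lemma RJ_simple J j : j \in J -> RJ J (alpha j, evec n j).
Proof. by move=> hj; split; [exact: simple_in|exact: spanJ_simple]. Qed.
Lemma srK j : sr j *m sr j = 1%:M. Proof. by rewrite refl_invol // (root_pair2 (simple_in j)). Qed.
Lemma WJ_sr J j : j \in J -> WJ J (sr j).
Proof. by move=> hj; apply: inW_gen; exact: RJ_simple. Qed.
Lemma simple_sr j : alpha j *m sr j = - alpha j.
Proof.
rewrite mul_refl (root_pair2 (simple_in j)).
by apply/rowP => k; rewrite !mxE; ring.
Qed.

(** Only the coefficient of [alpha j] changes. If the image were negative, the other coefficients of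
    the root would vanish, leaving a multiple of [alpha j]; pairing 2 with its own coroot bounds the
    multiple by 2, and the value 2 is excluded because the system is reduced. *)
Lemma simple_pos j p : p \in rts -> posr p.1 -> p.1 != alpha j -> posr (p.1 *m sr j).
Proof.
move=> hp [c [hc ec]] ne.
have hq := pair_closed (simple_in j) hp.
case: (root_posr hq) => //= -[d [hd ed]]; exfalso.
have e : zcomb alpha (fun k => -1 * d k) =
         zcomb alpha (fun k => c k + - ipair p.1 (evec n j) * (k == j)%:R).
  by rewrite zcombZ scaleN1r -ed opprK mul_refl zcombD -ec zcombZ zcomb_delta scaleNr.
have c0 k : k != j -> c k = 0.
  move=> /negbTE kj; have := zcomb_inj e k; rewrite /= kj mulr0 addr0.
  have := hc k; have := hd k; lia.
have ep : p.1 = c j *: alpha j.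
  rewrite ec /zcomb (bigD1 j) //= big1 ?addr0 // => k /c0 ->; exact: scale0r.
have h2 := root_pair2 hp; rewrite ep ipairZl in h2.
have [c1|c2] : c j = 1 \/ c j = 2.
  move: (hc j) h2; move: (c j) (ipair _ _) => m x m0 mx.
  have x0 : 0 < x by nia.
  have m1 : 0 < m by nia.
  have m2 : m <= 2 by nia.
  lia.
- by move: ne; rewrite ep c1 scale1r eqxx.
- have := double_notin (simple_in j); rewrite /= -[2%:~R]/(2 : int) -c2 -ep.
  by rewrite map_f.
Qed.
End RootDatum.


(** * Reduced words and the exchange condition *)

Section Coxeter.
Variables (n l : nat) (rts : seq (lat n * lat n)) (alpha : 'I_l -> lat n).
Hypothesis Hrd : based_root_datum_sc rts alpha.
Implicit Types (x y : lat n) (v : avec n) (p q : lat n * lat n) (M N : 'M[int]_n).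
Implicit Types (J : {set 'I_l}) (ws : seq 'I_l) (j k : 'I_l).
Notation WG := (inWG rts).
Notation WJ := (inWM rts alpha).
Notation RJ := (RM rts alpha).
Notation sr := (sr alpha).
Notation posr := (posr alpha).

Definition wprod ws : 'M[int]_n := foldr (fun j M => sr j *m M) 1%:M ws.
Lemma wprod_cat ws ws' : wprod (ws ++ ws') = wprod ws *m wprod ws'.
Proof. by elim: ws => [|j ws IH] /=; rewrite ?mul1mx // IH mulmxA. Qed.
Lemma wprod_rcons ws j : wprod (rcons ws j) = wprod ws *m sr j.
Proof. by rewrite -cats1 wprod_cat /= mulmx1. Qed.
Lemma wprod_rev ws : wprod ws *m wprod (rev ws) = 1%:M.
Proof.
elim: ws => [|j ws IH] /=; first by rewrite mulmx1.
by rewrite rev_cons wprod_rcons mulmxA -(mulmxA (sr j)) IH mulmx1 (srK Hrd).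
Qed.
Lemma wprod_WJ J ws : all (mem J) ws -> WJ J (wprod ws).
Proof.
elim: ws => [_|j ws IH /= /andP[hj /IH h]]; first exact: inW1.
by apply: WJ_mul => //; apply: (WJ_sr Hrd).
Qed.

(** Otherwise every term of dform(p, p) = sum of c_k dform(alpha_k, p) would be nonpositive, while
    roots have positive length. *)
Lemma pos_pairing_exists p (c : 'I_l -> int) : p \in rts -> (forall k, 0 <= c k) ->
  p.1 = zcomb alpha c -> exists k, 0 < c k /\ 0 < ipair p.1 (evec n k).
Proof.
move=> hp hc ec.
have hd := dform_root (coroot_uniq Hrd) (root_pair2 Hrd) (coroot_closed Hrd).
have h0 := dform_root_gt0 (root_pair2 Hrd).
have := h0 _ hp; set D := dform rts.
case: (pselect (exists k, 0 < c k /\ 0 < ipair p.1 (evec n k))) => // hn.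
rewrite -/D {1}ec /zcomb toA_sum {1}/D /dform rform_suml => hlt; exfalso; move: hlt.
apply/negP; rewrite -leNgt; apply: sumr_le0 => k _.
rewrite toAZ /D /dform rformZl -/(dform rts) -/D.
case: (ltP 0 (c k)) => [ck|ck]; last first.
  have -> : c k = 0 by have := hc k; lia.
  by rewrite mul0r.
rewrite pmulr_rle0 ?ltr0z // -(pmulr_rle0 _ (ltr0Sn R 1)).
have := hd _ (toA p.1) (simple_in Hrd k) => /= ->.
rewrite pmulr_rle0; last exact: (h0 _ (simple_in Hrd k)).
rewrite rpair_toAC rpair_toA lerz0 leNgt; apply/negP => h; apply: hn; by exists k.
Qed.

(** Induction on the height: reflecting in a simple root with positive coefficient and positive
    pairing keeps the root positive and in the span of J, and lowers its height. *)
Lemma root_conj_simple J p : RJ J p -> posr p.1 ->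
  exists ws i, [/\ all (mem J) ws, i \in J & p.1 = alpha i *m wprod ws].
Proof.
move=> hp [c [hc ec]].
have [h] : exists h : nat, \sum_k c k <= h%:Z.
  exists (absz (\sum_k c k)); lia.
elim: h p c hp hc ec => [|h IH] p c hp hc ec hh.
  have [k [ck _]] := pos_pairing_exists (RJ_rts hp) hc ec.
  have : 0 <= \sum_(i | i != k) c i by apply: sumr_ge0.
  move: hh ck; rewrite (bigD1 k) //=; move: (\sum_(i | i != k) c i) (c k); lia.
have [k [ck pk]] := pos_pairing_exists (RJ_rts hp) hc ec.
have kJ : k \in J.
  have [d [hd ed]] := hp.2; apply: contraT => /hd d0.
  by move: ck; rewrite (zcomb_inj Hrd (etrans (esym ec) ed) k) d0.
have [e|ne] := eqVneq p.1 (alpha k); first by exists [::], k; split=> //=; rewrite mulmx1.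
have hq := RJ_pact Hrd (WJ_sr Hrd kJ) hp.
have [d [hd ed]] := simple_pos Hrd (RJ_rts hp) (ex_intro _ c (conj hc ec)) ne.
have eqd : d =1 (fun i => c i + - ipair p.1 (evec n k) * (i == k)%:R).
  by apply: (zcomb_inj Hrd); rewrite -ed zcombD -ec zcombZ zcomb_delta scaleNr mul_refl.
have [|ws [i [hws hi e]]] := IH _ d hq hd ed.
  rewrite (eq_bigr _ (fun i _ => eqd i)) big_split /= -mulr_sumr.
  rewrite (bigD1 k) //= [X in _ * X](_ : _ = 1); last first.
    rewrite (bigD1 k) //= eqxx big1 ?addr0 // => i /negbTE ->; done.
  move: hh; rewrite (bigD1 k) //=; move: (\sum_(i | i != k) c i) (c k) (ipair _ _) pk; lia.
exists (rcons ws k), i; split=> //; first by rewrite all_rcons hws andbT.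
by rewrite wprod_rcons mulmxA -e /pact /= -mulmxA (srK Hrd) mulmx1.
Qed.

Lemma refl_conj M p q : WG M -> p \in rts -> q \in rts -> p.1 *m M = q.1 ->
  M *m refl q = refl p *m M.
Proof.
move=> hM hp hq e.
have -> : q = pact M p by apply: (root_inj Hrd) => //; exact: (pact_in Hrd).
by rewrite refl_pact ?(WG_unit Hrd) // !mulmxA mulmxV ?(WG_unit Hrd) // mul1mx.
Qed.

Lemma WJ_word J M : WJ J M -> exists2 ws, all (mem J) ws & M = wprod ws.
Proof.
elim=> [|p M' hp _ [ws hws ->]]; first by exists [::].
suff [ws' h' ->] : exists2 ws', all (mem J) ws' & refl p = wprod ws'.
  by exists (ws' ++ ws); rewrite ?wprod_cat // all_cat h'.
have pos q : RJ J q -> posr q.1 -> exists2 ws', all (mem J) ws' & refl q = wprod ws'.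
  move=> hq /(root_conj_simple hq)[vs [i [hvs hi e]]].
  exists (rev vs ++ i :: vs); first by rewrite all_cat all_rev /= hvs hi.
  have h := refl_conj (WJ_WG (wprod_WJ hvs)) (simple_in Hrd i) (RJ_rts hq) (esym e).
  rewrite wprod_cat /= -h mulmxA -{2}(revK vs) wprod_rev mul1mx //.
case: (root_posr Hrd (RJ_rts hp)) => h; first exact: pos.
by rewrite -refl_opp; apply: pos => //; exact: RJ_opp.
Qed.

(** Carried along the word from left to right, [alpha j] turns negative at some letter k; just
    before, it must equal [alpha k]. The reflection in j then moves through the prefix, becomes that
    of k and cancels the letter. *)
Lemma exchange J ws j : all (mem J) ws -> j \in J -> posr (- (alpha j *m wprod ws)) ->
  exists ws', [/\ all (mem J) ws', (size ws').+1 = size ws & sr j *m wprod ws = wprod ws'].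
Proof.
elim/last_ind: ws j => [|ws k IH] j hws hj hneg.
  rewrite /= mulmx1 in hneg.
  by case: (root_not_both Hrd (simple_in Hrd j) (posr_simple alpha j) hneg).
rewrite all_rcons in hws; case/andP: hws => hk hws.
have hM := wprod_WJ hws.
have hr := pact_in Hrd (WJ_WG hM) (simple_in Hrd j).
case: (root_posr Hrd hr) => /= hpos; last first.
  have [ws' [h1 h2 h3]] := IH j hws hj hpos; exists (rcons ws' k); split.
  - by rewrite all_rcons h1 andbT.
  - by rewrite !size_rcons h2.
  - by rewrite !wprod_rcons mulmxA h3.
exists ws; split; rewrite ?size_rcons // wprod_rcons.
have [e|ne] := eqVneq (alpha j *m wprod ws) (alpha k); last first.
  rewrite wprod_rcons mulmxA in hneg.
  have hp := simple_pos Hrd hr hpos ne.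
  by case: (root_not_both Hrd (pair_closed Hrd (simple_in Hrd k) hr) hp hneg).
have h := refl_conj (WJ_WG hM) (simple_in Hrd j) (simple_in Hrd k) e.
by rewrite mulmxA -h -mulmxA (srK Hrd) mulmx1.
Qed.

(** Induction along reduced words: positivity of [alpha j *m M] says that prepending the reflection
    in j lengthens [M]. This takes the place of a length function. *)
Lemma WJ_ind J (P : 'M[int]_n -> Prop) : P 1%:M ->
  (forall M j, j \in J -> WJ J M -> posr (alpha j *m M) -> P M -> P (sr j *m M)) ->
  forall M, WJ J M -> P M.
Proof.
move=> h1 hs M /WJ_word[ws hws ->{M}].
have [m] := ubnP (size ws); elim: m ws hws => // m IH [|j ws] //= /andP[hj hws] hm.
have hM := wprod_WJ hws.
case: (root_posr Hrd (pact_in Hrd (WJ_WG hM) (simple_in Hrd j))) => /= h.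
  by apply: hs => //; apply: IH.
have [ws' [hws' e ->]] := exchange hws hj h.
by apply: IH => //; move: hm; rewrite -e ltnS; exact: ltnW.
Qed.

End Coxeter.


(** * Finiteness, stabilisers, orbits of dominant weights, spans of coroots *)

Section Consequences.
Variables (n l : nat) (rts : seq (lat n * lat n)) (alpha : 'I_l -> lat n).
Hypothesis Hrd : based_root_datum_sc rts alpha.
Implicit Types (x y : lat n) (v : avec n) (p q : lat n * lat n) (M N : 'M[int]_n).
Implicit Types (J : {set 'I_l}) (ws : seq 'I_l) (j k : 'I_l).
Notation WG := (inWG rts).
Notation WJ := (inWM rts alpha).
Notation RJ := (RM rts alpha).
Notation sr := (sr alpha).
Notation posr := (posr alpha).

Lemma WJ_case J M : WJ J M -> M = 1%:M \/
  exists j M', [/\ j \in J, WJ J M', posr (alpha j *m M') & M = sr j *m M'].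
Proof.
elim/(WJ_ind Hrd): M / => [|M j hj hM hp _]; first by left.
by right; exists j, M.
Qed.

Lemma WJ_pos_id J M : WJ J M -> (forall j, j \in J -> posr (alpha j *m M)) -> M = 1%:M.
Proof.
move=> /WJ_case[//|[j [M' [hj hM hp ->]]]] h; exfalso.
apply: (root_not_both Hrd (pact_in Hrd (WJ_WG hM) (simple_in Hrd j)) hp).
by have := h j hj; rewrite mulmxA (simple_sr Hrd) mulNmx.
Qed.

Lemma WJ_eq J M N : WJ J M -> WJ J N ->
  (forall j, j \in J -> alpha j *m M = alpha j *m N) -> M = N.
Proof.
move=> hM hN h; have uN := WJ_unit Hrd hN.
rewrite -[M](mulmxKV uN) (_ : M *m invmx N = 1%:M) ?mul1mx //.
apply: (WJ_pos_id (J := J)) => [|j hj]; first by apply: WJ_mul => //; exact: (WJ_inv Hrd).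
by rewrite mulmxA h // mulmxK //; exact: posr_simple.
Qed.

(** An element is determined by the images of the simple roots, which are again roots; the code [f]
    records their positions in the list. *)
Lemma WJ_enum J : exists2 s : seq 'M[int]_n, uniq s & forall M, M \in s <-> WJ J M.
Proof.
pose F := {ffun 'I_l -> 'I_(size rts).+1}.
pose f M : F := [ffun j => inord (index (alpha j *m M) (map fst rts))].
have fi M N : WJ J M -> WJ J N -> f M = f N -> M = N.
  move=> hM hN e; apply: (WJ_eq (J := J)) => // j hj.
  have hin K : WJ J K -> alpha j *m K \in map fst rts.
    by move=> hK; have := map_f fst (pact_in Hrd (WJ_WG hK) (simple_in Hrd j)).
  have := congr1 (fun g : F => val (g j)) e; rewrite !ffunE /= !inordK.
  - move=> ei; rewrite -(nth_index 0 (hin M hM)) ei nth_index //; exact: hin.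
  - by rewrite -(size_map fst) ltnS index_size.
  - by rewrite -(size_map fst) ltnS index_size.
pose g (y : F) : 'M[int]_n :=
  match pselect (exists2 M, WJ J M & f M = y) with
  | left h => projT1 (cid2 h) | right _ => 1%:M end.
exists (undup (map g (enum {: F}))); first exact: undup_uniq.
move=> M; rewrite mem_undup; split=> [/mapP[y _ ->]|hM].
  by rewrite /g; case: pselect => [h|_]; [case: cid2|exact: WJ1].
apply/mapP; exists (f M); first by rewrite mem_enum.
rewrite /g; case: pselect => [h|[]]; last by exists M.
by case: cid2 => N hN e /=; apply: fi.
Qed.

Lemma ract_sr j v : ract (sr j) v = v - rpair (alpha j) v *: toA (evec n j).
Proof.
apply: rpair_inj => x; rewrite rpair_ract mul_refl rpairBl rpairZl rpairBr rpairZr.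
by rewrite rpair_toA mulrC.
Qed.
Lemma ract_refl p v : ract (refl p) v = v - rpair p.1 v *: toA p.2.
Proof.
apply: rpair_inj => x; rewrite rpair_ract mul_refl rpairBl rpairZl rpairBr rpairZr.
by rewrite rpair_toA mulrC.
Qed.

Lemma posr_dom x v : (forall j, 0 <= rpair (alpha j) v) -> posr x -> 0 <= rpair x v.
Proof.
move=> h [c [hc ->]]; rewrite rpair_suml; apply: sumr_ge0 => j _.
by rewrite rpairZl mulr_ge0 // ler0z.
Qed.

(** Strip a reduced word from the left. The pairings of v with [alpha j] and with the positive root
    [alpha j *m N] are both nonnegative and, as v is fixed, opposite; so both vanish, j lies in J
    and the letter can be removed. *)
Lemma stab_dominant J v M :
  (forall j, j \in J -> rpair (alpha j) v = 0) ->
  (forall j, j \notin J -> 0 < rpair (alpha j) v) ->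
  WG M -> ract M v = v -> WJ J M.
Proof.
move=> h0 h1 /(WG_WJ Hrd) hM.
have hd j : 0 <= rpair (alpha j) v.
  by case: (boolP (j \in J)) => [/h0 ->|/h1/ltW].
elim/(WJ_ind Hrd): hM => [_|N j _ hN hp IH e]; first exact: inW1.
have e1 : rpair (alpha j) v = - rpair (alpha j *m N) v.
  by rewrite -{1}e rpair_ract mulmxA (simple_sr Hrd) mulNmx rpairNl.
have e2 : rpair (alpha j) v = 0.
  by have := posr_dom hd hp; have := hd j; lra.
apply: WJ_mul; first apply: (WJ_sr Hrd).
  by apply: contraT => /h1; rewrite e2 ltxx.
apply: IH; have : ract (sr j) (ract (sr j *m N) v) = ract (sr j) v by rewrite e.
by rewrite ractM mulmxA (srK Hrd) mul1mx ract_sr e2 scale0r subr0.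
Qed.


Lemma spanJ0 J : spanJ alpha J 0.
Proof.
exists (fun=> 0); split=> //; rewrite /zcomb big1 // => j _; exact: scale0r.
Qed.

(** Along a reduced word each letter subtracts a nonnegative multiple of the positive root
    [alpha j *m N]. *)
Lemma weight_sub_orbit J (om : lat n) M :
  (forall j, j \in J -> 0 <= ipair om (evec n j)) -> WJ J M ->
  posr (om - om *m M) /\ spanJ alpha J (om - om *m M).
Proof.
move=> h; elim/(WJ_ind Hrd) => [|N j hj hN hp [IH IH']].
  by rewrite mulmx1 subrr; split; [exact: posr0|exact: spanJ0].
have -> : om - om *m (sr j *m N) =
    (om - om *m N) + ipair om (evec n j) *: (alpha j *m N).
  by rewrite mulmxA mul_refl mulmxBl -scalemxAl opprB addrCA addrC.
split; first by apply: posrD => //; apply: posrZ => //; exact: h.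
by apply: spanJD => //; apply: spanJZ; apply: (spanJ_WJ hN); exact: spanJ_simple.
Qed.

Lemma spanJ_pair0 J (v : avec n) x :
  (forall j, j \notin J -> 0 < rpair (alpha j) v) ->
  (forall j, j \in J -> rpair (alpha j) v = 0) ->
  posr x -> rpair x v = 0 -> spanJ alpha J x.
Proof.
move=> h1 h0 [c [hc ->]] e; exists c; split => // j hj.
have hd k : 0 <= rpair (c k *: alpha k) v.
  rewrite rpairZl mulr_ge0 ?ler0z //.
  by case: (boolP (k \in J)) => [/h0 ->|/h1/ltW].
move/eqP: e; rewrite rpair_suml psumr_eq0 => [/allP/(_ j)|k _]; last exact: hd.
rewrite mem_index_enum rpairZl mulf_eq0 (gt_eqF (h1 j hj)) orbF /= => /(_ isT).
by rewrite intr_eq0 => /eqP.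
Qed.

(** This singles out the leading coefficients of the c_i: the weights of a W-orbit with the largest
    pairing with v form one orbit under W_J. If nothing is lost, each letter of a reduced word
    either fixes the weight or reflects it in a root orthogonal to v, hence in a root of J. *)
Lemma weight_orbit_face J (v : avec n) (om : lat n) M :
  (forall j, j \notin J -> 0 < rpair (alpha j) v) ->
  (forall j, j \in J -> rpair (alpha j) v = 0) ->
  (forall j, 0 <= ipair om (evec n j)) -> WG M ->
  0 <= rpair (om - om *m M) v /\
  (rpair (om - om *m M) v = 0 -> exists2 N, WJ J N & om *m M = om *m N).
Proof.
move=> h1 h0 hom /(WG_WJ Hrd) hM.
have hd k : 0 <= rpair (alpha k) v.
  by case: (boolP (k \in J)) => [/h0 ->|/h1/ltW].
have ge N : WJ setT N -> 0 <= rpair (om - om *m N) v.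
  by move=> hN; apply: posr_dom => //; have [] := weight_sub_orbit (fun j _ => hom j) hN.
split; first exact: ge.
elim/(WJ_ind Hrd): hM => [_|N j _ hN hp IH].
  by exists 1%:M => //; exact: WJ1.
have -> : om *m (sr j *m N) = om *m N - ipair om (evec n j) *: (alpha j *m N).
  by rewrite mulmxA mul_refl mulmxBl -scalemxAl.
rewrite opprB addrCA addrC rpairDl rpairZl => e.
have g1 := ge _ hN; have g2 := posr_dom hd hp.
have g3 : 0 <= (ipair om (evec n j))%:~R :> R by rewrite ler0z.
have e1 : rpair (om - om *m N) v = 0 by have := mulr_ge0 g3 g2; lra.
have [N' hN' e2] := IH e1.
have [z|nz] := eqVneq (ipair om (evec n j)) 0.
  by exists N' => //; rewrite z scale0r subr0.
have e3 : rpair (alpha j *m N) v = 0.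
  move: e; rewrite e1 add0r => /eqP; rewrite mulf_eq0 intr_eq0 (negbTE nz) /=.
  by move/eqP.
have hq := pact_in Hrd (WJ_WG hN) (simple_in Hrd j).
have hq' : RJ J (pact N (alpha j, evec n j)) by split=> //; exact: spanJ_pair0 e3.
exists (N' *m refl (pact N (alpha j, evec n j))).
  by apply: WJ_mul => //; exact: inW_gen.
rewrite mulmxA -e2 mul_refl /=; congr (_ - _ *: _).
by rewrite ipair_mulmx -mulmxA -trmx_mul mulmxV ?trmx1 ?mulmx1 // (WJ_unit Hrd hN).
Qed.

(** As the coroot of [alpha j] is the basis vector e_j, this is the span of the simple coroots of J,
    over the integers as well as over the reals. *)
Definition suppJ (V : zmodType) J (v : 'rV[V]_n) :=
  forall k : 'I_n, (forall j, j \in J -> nat_of_ord j != k) -> v 0 k = 0.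
Lemma suppJD (V : zmodType) J (u v : 'rV[V]_n) : suppJ J u -> suppJ J v -> suppJ J (u + v).
Proof. by move=> hu hv k hk; rewrite mxE hu // hv // addr0. Qed.
Lemma suppJN (V : zmodType) J (u : 'rV[V]_n) : suppJ J u -> suppJ J (- u).
Proof. by move=> hu k hk; rewrite mxE hu // oppr0. Qed.
Lemma suppJB (V : zmodType) J (u v : 'rV[V]_n) : suppJ J u -> suppJ J v -> suppJ J (u - v).
Proof. by move=> hu hv; apply: suppJD => //; exact: suppJN. Qed.
Lemma suppJ0 (V : zmodType) J : suppJ J (0 : 'rV[V]_n).
Proof. by move=> k _; rewrite mxE. Qed.
Lemma suppJZ (V : pzRingType) J (c : V) (u : 'rV[V]_n) : suppJ J u -> suppJ J (c *: u).
Proof. by move=> hu k hk; rewrite mxE hu // mulr0. Qed.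
Lemma suppJ_sum (V : zmodType) J (I : Type) (r : seq I) (P : pred I) (F : I -> 'rV[V]_n) :
  (forall i, P i -> suppJ J (F i)) -> suppJ J (\sum_(i <- r | P i) F i).
Proof.
move=> h; elim/big_ind: _ => //; [exact: suppJ0|].
move=> u v; exact: suppJD.
Qed.
Lemma suppJ_toA J (x : lat n) : suppJ J (toA x) <-> suppJ J x.
Proof.
split=> h k hk; last by rewrite mxE h.
by have /eqP := h k hk; rewrite mxE intr_eq0 => /eqP.
Qed.
Lemma suppJ_evec J j : j \in J -> suppJ J (evec n j).
Proof. by move=> hj k /(_ j hj) ne; rewrite mxE eq_sym (negbTE ne). Qed.
Lemma simple_lt j : (j < n)%N.
Proof.
rewrite ltnNge; apply/negP => h; have := root_pair2 Hrd (simple_in Hrd j).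
rewrite /ipair big1 // => k _; rewrite mxE; case: eqP => [e|_]; last by rewrite mulr0.
by have := ltn_ord k; rewrite e ltnNge h.
Qed.
Definition wo j : 'I_n := Ordinal (simple_lt j).
Lemma suppJ_expand J v : suppJ J v -> v = \sum_(j in J) v 0 (wo j) *: toA (evec n j).
Proof.
move=> h; apply/rowP => k; rewrite summxE.
case: (pselect (exists2 j, j \in J & nat_of_ord j = k)) => [[j hj e]|hn].
  rewrite (bigD1 j) //= !mxE /= -e eqxx mulr1 big1 ?addr0; first by congr (v _ _); apply: val_inj.
  by move=> i /andP[_ ne]; rewrite !mxE -e eq_sym val_eqE (negbTE ne) mulr0.
rewrite h; last by move=> j hj; apply/eqP => e; apply: hn; exists j.
rewrite big1 // => j hj; rewrite !mxE; case: eqP => [e|_]; last by rewrite mulr0.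
by case: hn; exists j.
Qed.

Lemma suppJ_corspan J v : suppJ J v -> corspan rts v.
Proof.
move/suppJ_expand=> ->; elim/big_ind: _ => [|u w|j _].
- by exists (fun=> 0); rewrite big1 // => p _; rewrite scale0r.
- exact: corspanD.
- by apply: corspanZ; exact: (corspan_coroot Hrd (simple_in Hrd j)).
Qed.

Lemma suppJ_nondeg J v : suppJ J v -> (forall j, j \in J -> rpair (alpha j) v = 0) -> v = 0.
Proof.
move=> h h0; apply: (corspan_eq0 Hrd (suppJ_corspan h)).
apply: rform_eq0; rewrite {1}(suppJ_expand h) rform_suml big1 // => j hj.
rewrite rformZl -[rform _ _ _]mul1r -[1](@mulVf _ 2%R) ?pnatr_eq0 // -mulrA.
have -> := rform_coroot (root_uniq Hrd) (root_pair2 Hrd) (root_closed Hrd) v (simple_in Hrd j).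
by rewrite /= h0 // !mulr0.
Qed.

Lemma suppJ_WJ_mulT J M (x : lat n) : WJ J M -> suppJ J (x *m M^T - x).
Proof.
elim/(WJ_ind Hrd) => [|N j hj hN _ IH]; first by rewrite trmx1 mulmx1 subrr; exact: suppJ0.
rewrite trmx_mul mulmxA mul_reflT /= addrAC; apply: suppJB => //.
by apply: suppJZ; exact: suppJ_evec.
Qed.
Lemma suppJ_WJ J M v : WJ J M -> suppJ J (ract M v - v).
Proof.
elim/(WJ_ind Hrd) => [|N j hj hN _ IH]; first by rewrite ract1 subrr; exact: suppJ0.
rewrite -ractM ract_sr addrAC; apply: suppJB => //.
by apply: suppJZ; apply/suppJ_toA; exact: suppJ_evec.
Qed.
Lemma suppJ_coroot J p : RJ J p -> suppJ J p.2.
Proof.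
have pos q : RJ J q -> posr q.1 -> suppJ J q.2.
  move=> hq /(root_conj_simple Hrd hq)[ws [i [hws hi e]]].
  have hM := wprod_WJ Hrd hws.
  have hr := pact_in Hrd (WJ_WG hM) (simple_in Hrd i).
  rewrite (root_inj Hrd (RJ_rts hq) hr e) /=; rewrite -[_ *m _](subrK (evec n i)).
  apply: suppJD; last exact: suppJ_evec.
  by apply: suppJ_WJ_mulT; exact: (WJ_inv Hrd).
move=> hp; case: (root_posr Hrd (RJ_rts hp)) => [|h]; first exact: pos.
by rewrite -[p.2]opprK; apply: suppJN; exact: (pos _ (RJ_opp Hrd hp) h).
Qed.

End Consequences.

(** * Affine Weyl group and the fundamental alcove *)


Lemma seq_argmin (T : eqType) (s : seq T) (P : T -> Prop) (f : T -> R) :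
  (exists2 x, x \in s & P x) ->
  exists x, [/\ x \in s, P x & forall y, y \in s -> P y -> f x <= f y].
Proof.
elim: s => [|a s IH]; first by case.
case: (pselect (exists2 x, x \in s & P x)) => [/IH[x [xs Px hx]] _|hn [x0]].
  case: (pselect (P a /\ f a < f x)) => [[Pa lt]|nlt].
    exists a; split; rewrite ?mem_head // => y; rewrite inE => /orP[/eqP-> //|ys Py].
    exact: le_trans (ltW lt) (hx _ ys Py).
  exists x; split; rewrite ?inE ?xs ?orbT // => y /orP[/eqP->|ys] Py; last exact: hx.
  by rewrite leNgt; apply/negP => lt; apply: nlt.
rewrite inE => /orP[/eqP->|xs] Px; last by case: hn; exists x0.
exists a; split; rewrite ?mem_head // => y; rewrite inE => /orP[/eqP-> //|ys Py].
by case: hn; exists y.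
Qed.

Lemma finite_of_inj (T : choiceType) (F : finType) (P : T -> Prop) (f : T -> F) :
  (forall x y, P x -> P y -> f x = f y -> x = y) ->
  exists2 s : seq T, uniq s & forall x, x \in s <-> P x.
Proof.
move=> fi.
pose g (y : F) : option T :=
  match pselect (exists2 x, P x & f x = y) with
  | left h => Some (projT1 (cid2 h)) | right _ => None end.
exists (undup (pmap g (enum F))); first exact: undup_uniq.
move=> x; rewrite mem_undup mem_pmap; split=> [/mapP[y _]|Px].
  by rewrite /g; case: pselect => // h [->]; case: cid2.
apply/mapP; exists (f x); first by rewrite mem_enum.
rewrite /g; case: pselect => [h|[]]; last by exists x.
by case: cid2 => y Py e /=; congr Some; apply: fi.
Qed.

Section Alcove.
Variables (n l : nat) (rts : seq (lat n * lat n)) (alpha : 'I_l -> lat n).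
Hypothesis Hrd : based_root_datum_sc rts alpha.
Variable J : {set 'I_l}.
Implicit Types (u v : avec n) (x y t : lat n) (p q : lat n * lat n) (M N : 'M[int]_n) (j : 'I_l).
Notation WG := (inWG rts).
Notation WJ := (inWM rts alpha J).
Notation RJ := (RM rts alpha J).
Notation sr := (sr alpha).
Notation posr := (posr alpha).
Notation suppJ := (suppJ J).

Definition posJ p := RJ p /\ posr p.1.

Lemma RJ_posJ p : RJ p -> posJ p \/ posJ (- p.1, - p.2).
Proof.
move=> hp; case: (root_posr Hrd (RJ_rts hp)) => h; first by left.
by right; split=> //; exact: RJ_opp.
Qed.

(** The sum of the positive coroots of M, usually written as 2 rho-check. It measures heights and,
    rescaled, gives an interior point of the alcove. *)
Definition rho2 : lat n := \sum_(p <- rts | `[< posJ p >]) p.2.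


(** The reflection in j permutes the positive coroots of M other than e_j, which it negates; so it
    lowers [rho2] by exactly 2e_j. *)
Lemma rho2_simple j : j \in J -> ipair (alpha j) rho2 = 2.
Proof.
move=> hj; pose a := (alpha j, evec n j).
have ain : a \in rts := simple_in Hrd j.
have pa : posJ a by split; [exact: RJ_simple|exact: posr_simple].
pose L := [seq p <- rts | `[< posJ p >] && (p != a)].
have rhoE : rho2 = evec n j + \sum_(p <- L) p.2.
  rewrite /rho2 -big_filter (bigD1_seq a) ?filter_uniq ?(uniq_rts Hrd) //=; last first.
    by rewrite mem_filter ain andbT; exact/asboolP.
  rewrite -[in LHS]big_filter -filter_predI; congr (_ + \sum_(i <- _) _).
  by apply: eq_filter => p; rewrite /= andbC.
pose f p := (p.1 *m sr j, p.2 *m (sr j)^T).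
have fK : involutive f.
  move=> p; rewrite /f /= -!mulmxA -trmx_mul (srK Hrd) trmx1 !mulmx1.
  by case: p.
have pe : perm_eq (map f L) L.
  have uL : uniq L by rewrite filter_uniq // (uniq_rts Hrd).
  have um : uniq (map f L) by rewrite map_inj_uniq //; exact: inv_inj.
  have hs : {subset map f L <= L}.
    move=> _ /mapP[p + ->]; rewrite !mem_filter => /andP[/andP[/asboolP[hp hpos] ne] hin].
    have fin := pair_closed Hrd ain hin.
    have ne1 : p.1 != alpha j.
      by apply: contraNneq ne => e; apply/eqP; apply: (root_inj Hrd).
    rewrite fin andbT; apply/andP; split.
      apply/asboolP; split; last exact: (simple_pos Hrd).
      by split=> //; apply: (spanJ_WJ (WJ_sr Hrd hj)) hp.2.
    apply/eqP => e; have := fK p; rewrite e => e2.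
    apply: (root_not_both Hrd hin hpos).
    rewrite -e2 /f /a /= (simple_sr Hrd) opprK; exact: posr_simple.
  apply: uniq_perm => // p; apply/idP/idP => [|hp]; first exact: hs.
  by rewrite -(fK p); apply: map_f; apply: hs; apply: map_f.
have e1 : rho2 *m (sr j)^T = - evec n j + \sum_(p <- L) p.2.
  rewrite rhoE mulmxDl mul_reflT (root_pair2 Hrd ain) /=; congr (_ + _).
    by apply/rowP => k; rewrite !mxE; ring.
  rewrite mulmx_suml -[RHS](perm_big _ pe) /= [RHS]big_map; exact: eq_bigr.
have e2 : ipair (alpha j) rho2 *: evec n j = 2 *: evec n j.
  have : rho2 - rho2 *m (sr j)^T = 2 *: evec n j.
    rewrite e1 rhoE; apply/rowP => k; rewrite !mxE; ring.
  by rewrite mul_reflT /= => <-; rewrite opprB addrCA subrr addr0.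
have := congr1 (fun w : lat n => w 0 (wo Hrd j)) e2; rewrite !mxE /= eqxx.
by rewrite !mulr1.
Qed.

Lemma posJ_rho2 p : posJ p -> 0 < ipair p.1 rho2.
Proof.
move=> [hp [c [hc ec]]]; have [d [hd ed]] := hp.2.
have dc := zcomb_inj Hrd (etrans (esym ec) ed).
have c0 j : j \notin J -> c j = 0 by move=> hj; rewrite dc hd.
have e : ipair p.1 rho2 = 2 * \sum_j c j.
  have -> : ipair p.1 rho2 = \sum_j ipair (c j *: alpha j) rho2.
    rewrite ec /zcomb; elim/big_rec2: _ => [|i x y _ <-]; last by rewrite ipairDl.
    by rewrite /ipair big1 // => k _; rewrite mxE mul0r.
  rewrite mulr_sumr; apply: eq_bigr => j _; rewrite ipairZl.
  by case: (boolP (j \in J)) => [/rho2_simple->|/c0->]; rewrite ?mul0r ?mulr0 // mulrC.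
rewrite e mulr_gt0 // lt_neqAle sumr_ge0 // andbT eq_sym psumr_eq0 //.
apply/negP => /allP h; have := root_neq0 Hrd (RJ_rts hp).
rewrite ec /zcomb big1 ?eqxx // => j _.
by have /eqP -> := h j (mem_index_enum _); rewrite scale0r.
Qed.

(** Bounding all positive roots instead of the highest ones avoids any splitting into irreducible
    components. *)
Definition alcv v := forall p, posJ p -> 0 < rpair p.1 v < 1.

Lemma span_posr_coef (x : lat n) : spanJ alpha J x -> posr x -> exists c : 'I_l -> int,
  [/\ forall j, 0 <= c j, forall j, j \notin J -> c j = 0 & x = zcomb alpha c].
Proof.
move=> [d [hd ed]] [c [hc ec]]; exists c; split=> // j hj.
by rewrite (zcomb_inj Hrd (etrans (esym ec) ed)) hd.
Qed.
Lemma span_posr_ge0 (x : lat n) v : spanJ alpha J x -> posr x ->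
  (forall j, j \in J -> 0 <= rpair (alpha j) v) -> 0 <= rpair x v.
Proof.
move=> h1 h2; have [c [hc c0 ->]] := span_posr_coef h1 h2 => h.
rewrite rpair_suml; apply: sumr_ge0 => j _; rewrite rpairZl.
case: (boolP (j \in J)) => [/h hj|/c0->]; last by rewrite mul0r.
by rewrite mulr_ge0 // ler0z.
Qed.
Lemma span_posr_gt0 (x : lat n) v : spanJ alpha J x -> posr x -> x != 0 ->
  (forall j, j \in J -> 0 < rpair (alpha j) v) -> 0 < rpair x v.
Proof.
move=> h1 h2 x0; have [c [hc c0 ex]] := span_posr_coef h1 h2 => h.
have ge j : 0 <= rpair (c j *: alpha j) v.
  rewrite rpairZl; case: (boolP (j \in J)) => [/h hj|/c0->]; last by rewrite mul0r.
  by rewrite mulr_ge0 ?ler0z // ltW.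
rewrite lt_neqAle span_posr_ge0 // => [|j /h/ltW //]; rewrite andbT eq_sym.
apply: contraNneq x0; rewrite ex rpair_suml => /eqP; rewrite psumr_eq0 // => /allP h0.
apply/eqP; rewrite /zcomb big1 // => j _.
have := h0 j (mem_index_enum _); rewrite rpairZl mulf_eq0 intr_eq0 /=.
case: (boolP (j \in J)) => [/h hj|/c0->]; last by rewrite scale0r.
by rewrite (gt_eqF hj) orbF => /eqP->; rewrite scale0r.
Qed.

(** Among the positive roots above a given one, a root with the largest pairing with [rho2] is a
    highest root, and on dominant vectors it bounds the given root from above. *)
Lemma alcove_alcv v : alcove rts alpha J v <-> alcv v.
Proof.
split=> [[hs hh] p hp|h]; last first.
  split=> [j hj|x [[[p [hp <-]] hx] _]].
    by case/andP: (h (alpha j, evec n j) (conj (RJ_simple Hrd hj) (posr_simple _ _))).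
  by case/andP: (h p (conj hp hx)).
rewrite (span_posr_gt0 hp.1.2 hp.2 (root_neq0 Hrd (RJ_rts hp.1)) hs) /=.
pose P (x : lat n) := posRM rts alpha J x /\ root_le alpha p.1 x.
have le_refl (x : lat n) : root_le alpha x x.
  exists (fun=> 0); split=> //; rewrite subrr /zcomb big1 // => j _; exact: scale0r.
have [] := @seq_argmin _ (map fst rts) P (fun x => - rpair x (toA rho2)).
  exists p.1; first by rewrite map_f // (RJ_rts hp.1).
  by split=> //; split; [exists p; case: hp|exact: hp.2].
move=> x [xs [hx lex] xmin].
have spx (y : lat n) : posRM rts alpha J y -> spanJ alpha J y by move=> [[q [[_ hq] <-]] _].
have spB (y z : lat n) : posRM rts alpha J y -> posRM rts alpha J z -> spanJ alpha J (z - y).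
  move=> /spx hy /spx hz; apply: spanJD => //; rewrite -scaleN1r; exact: spanJZ.
have hp1 : posRM rts alpha J p.1 by split; [exists p; case: hp|exact: hp.2].
have : highestRM rts alpha J x.
  split=> // y hy lexy.
  have sy : y \in map fst rts by case: hy => -[q [hq <-]] _; rewrite map_f // (RJ_rts hq).
  have Py : P y.
    split=> //; case: lex => d [hd ed]; case: lexy => d' [hd' ed'].
    exists (fun j => d j + d' j); split=> [j|]; first by rewrite addr_ge0.
    by rewrite zcombD -ed -ed' [RHS]addrC addrA subrK.
  have [e|ne] := eqVneq (y - x) 0; first by apply/eqP; rewrite -subr_eq0 e.
  have := xmin _ sy Py; rewrite lerN2 => hle.
  have : 0 < rpair (y - x) (toA rho2).
    apply: span_posr_gt0 => //; first exact: spB.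
    by move=> j hj; rewrite rpair_toA rho2_simple.
  by rewrite rpairBl subr_gt0 ltNge hle.
move/hh; apply: le_lt_trans; rewrite -subr_ge0 -rpairBl.
by apply: span_posr_ge0 => [||j /hs/ltW //]; first exact: spB.
Qed.

(** The denominator exceeds the pairing of [rho2] with any root, so every positive root of M takes a
    value strictly between 0 and 1. *)
Definition p0 : avec n := (1 + \sum_(p <- rts) `|rpair p.1 (toA rho2)|)^-1 *: toA rho2.
Lemma alcv_p0 : alcv p0.
Proof.
move=> p hp; rewrite rpairZr.
set S := \sum_(p <- rts) _.
have S0 : 0 <= S by apply: sumr_ge0.
have h1 : rpair p.1 (toA rho2) <= S.
  apply: le_trans (ler_norm _) _.
  rewrite /S (bigD1_seq p) ?(uniq_rts Hrd) ?(RJ_rts hp.1) //= lerDl.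
  exact: sumr_ge0.
have h2 : 0 < rpair p.1 (toA rho2) by rewrite rpair_toA ltr0z; exact: posJ_rho2.
have h3 : 0 < 1 + S by lra.
rewrite mulr_gt0 ?invr_gt0 //= mulrC ltr_pdivrMr // mul1r; lra.
Qed.

Notation F := (rform rts).
Let HF1 := root_uniq Hrd.
Let HF2 := root_pair2 Hrd.
Let HF3 := root_closed Hrd.

(** Both mutual pairings are negative integers. If one is -1, a reflection turns one coroot into the
    sum. If both are at most -2, the sum of the two coroots has nonpositive square length, so it
    vanishes. *)
Lemma coroot_sum p q : RJ p -> RJ q -> ipair p.1 q.2 < 0 ->
  p.2 + q.2 = 0 \/ exists2 r, RJ r & r.2 = p.2 + q.2.
Proof.
move=> hp hq h.
have hp' := RJ_rts hp; have hq' := RJ_rts hq.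
have ea := rform_coroot HF1 HF2 HF3 (toA q.2) hp'.
have eb := rform_coroot HF1 HF2 HF3 (toA p.2) hq'.
have gp := rform_coroot_gt0 HF2 hp'.
have gq := rform_coroot_gt0 HF2 hq'.
rewrite rformC rpair_toA in eb; rewrite rpair_toA in ea.
have hb : ipair q.1 p.2 < 0.
  rewrite -(ltrz0 R) -(pmulr_rlt0 _ gq) -eb ea pmulr_rlt0 // ltrz0 //.
have [a1|a1] := eqVneq (ipair p.1 q.2) (-1).
  right; exists (pact (refl p) q).
    by apply: (RJ_pact Hrd) => //; apply: inW_gen.
  by rewrite /pact /= (invmx_refl (HF2 hp')) mul_reflT a1 scaleN1r opprK addrC.
have [b1|b1] := eqVneq (ipair q.1 p.2) (-1).
  right; exists (pact (refl q) p).
    by apply: (RJ_pact Hrd) => //; apply: inW_gen.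
  by rewrite /pact /= (invmx_refl (HF2 hq')) mul_reflT b1 scaleN1r opprK.
left.
have a2 : (ipair p.1 q.2)%:~R <= -2%:~R :> R by rewrite -mulrNz ler_int; lia.
have b2 : (ipair q.1 p.2)%:~R <= -2%:~R :> R by rewrite -mulrNz ler_int; lia.
suff : toA (p.2 + q.2) = 0 by rewrite -(toA0 n) => /toA_inj.
apply: (corspan_eq0 Hrd); first by rewrite toAD; apply: corspanD; exact: (corspan_coroot Hrd).
apply: rform_eq0; apply/eqP; rewrite eq_le rform_ge0 andbT.
rewrite toAD rformDl !rformDr [F (toA q.2) (toA p.2)]rformC.
move: ea eb gp gq a2 b2.
set A := F (toA p.2) (toA p.2); set B := F (toA q.2) (toA q.2).
set C := F (toA p.2) (toA q.2); move: (_%:~R) (_%:~R) => a b; nra.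
Qed.

(** The coroot lattice contains no nonzero minuscule coweight. If the head of the list pairs
    negatively with another member, the two coroots cancel or merge into one and the list shortens;
    otherwise the head pairs to at least 2 with the whole sum. *)
Lemma minuscule_list (L : seq (lat n * lat n)) :
  (forall p, p \in L -> RJ p) ->
  (forall p, RJ p -> ipair p.1 (\sum_(q <- L) q.2) <= 1) -> \sum_(q <- L) q.2 = 0.
Proof.
have [m] := ubnP (size L); elim: m L => // m IH [|p L] hm hL hmin; first by rewrite big_nil.
case: (pselect (exists2 q, q \in L & ipair p.1 q.2 < 0)) => [[q qL hneg]|hn].
  have pe := perm_to_rem qL.
  have e : \sum_(q <- p :: L) q.2 = p.2 + q.2 + \sum_(q <- rem q L) q.2.
    by rewrite big_cons (perm_big _ pe) /= big_cons addrA.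
  have hrem r : r \in rem q L -> RJ r.
    by move=> /mem_rem hr; apply: hL; rewrite inE hr orbT.
  have sz : (size (rem q L)).+1 = size L by rewrite (perm_size pe).
  have hRq : RJ q by apply: hL; rewrite inE qL orbT.
  case: (coroot_sum (hL p (mem_head _ _)) hRq hneg) => [e0|[r hr er]].
    rewrite e e0 add0r; apply: IH => //; first by move: hm; rewrite /= -sz ltnS => /ltnW.
    by move=> r hr; have := hmin r hr; rewrite e e0 add0r.
  have e' : \sum_(q <- p :: L) q.2 = \sum_(q <- r :: rem q L) q.2.
    by rewrite e big_cons er.
  rewrite e'; apply: IH => [|t|t ht].
  - by move: hm; rewrite /= -sz ltnS.
  - by rewrite inE => /orP[/eqP-> //|/hrem].
  - by have := hmin t ht; rewrite e'.
have := hmin p (hL p (mem_head _ _)).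
rewrite big_cons ipairDr (HF2 (RJ_rts (hL p (mem_head _ _)))).
have : 0 <= ipair p.1 (\sum_(j <- L) j.2).
  have -> : ipair p.1 (\sum_(j <- L) j.2) = \sum_(j <- L) ipair p.1 j.2.
    elim/big_rec2: _ => [|i x y _ <-]; last by rewrite ipairDr.
    by rewrite /ipair big1 // => k _; rewrite mxE mulr0.
  rewrite big_seq; apply: sumr_ge0 => q hq; rewrite leNgt; apply/negP => h.
  by apply: hn; exists q.
by move=> h1 h2; exfalso; move: h1 h2; move: (ipair _ _); lia.
Qed.

Lemma suppJ_list (t : lat n) : suppJ t ->
  exists2 L, (forall p, p \in L -> RJ p) & t = \sum_(q <- L) q.2.
Proof.
pose Rep (t : lat n) := exists2 L, (forall p, p \in L -> RJ p) & t = \sum_(q <- L) q.2.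
have RepD (x y : lat n) : Rep x -> Rep y -> Rep (x + y).
  move=> [L hL ->] [L' hL' ->]; exists (L ++ L'); last by rewrite big_cat.
  by move=> p; rewrite mem_cat => /orP[/hL|/hL'].
have Rep0 : Rep 0 by exists [::] => //; rewrite big_nil.
have Rep1 p : RJ p -> Rep p.2.
  by move=> hp; exists [:: p]; rewrite ?big_seq1 // => q; rewrite inE => /eqP->.
have RepZ p (m : int) : RJ p -> Rep (m *: p.2).
  move=> hp; elim: m => [|m IH|m IH]; first by rewrite scale0r.
    have -> : m.+1%:Z = 1 + m%:Z by rewrite -PoszD.
    by rewrite scalerDl scale1r; apply: RepD => //; exact: Rep1.
  have -> : - m.+1%:Z = -1 + - m%:Z by rewrite -opprD -PoszD.
  rewrite scalerDl scaleN1r; apply: RepD => //.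
  exact: (Rep1 _ (RJ_opp Hrd hp)).
move=> ht.
suff -> : t = \sum_(j in J) t 0 (wo Hrd j) *: evec n j.
  elim/big_ind: _ => // j hj; exact: (RepZ (alpha j, evec n j) _ (RJ_simple Hrd hj)).
apply: (@toA_inj n); have := ht => /suppJ_toA/(suppJ_expand Hrd) ->.
by rewrite toA_sum; apply: eq_bigr => j _; rewrite toAZ mxE.
Qed.

Lemma minuscule (t : lat n) : suppJ t -> (forall p, RJ p -> ipair p.1 t <= 1) -> t = 0.
Proof. by move=> /suppJ_list[L hL ->] h; exact: minuscule_list. Qed.

End Alcove.


(* Lexicographic nonnegativity: a complex coweight x + iy is ordered by x first, then y. *)
Definition lge (r s : R) : Prop := 0 < r \/ r = 0 /\ 0 <= s.

Arguments lge (r s)%_ring_scope.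

Lemma lge_gt r s : 0 < r -> lge r s. Proof. by left. Qed.
Lemma lge_ge r s : lge r s -> 0 <= r. Proof. by case=> [/ltW //|[-> _]]. Qed.
Lemma lge_antisym r s : lge r s -> lge (- r) (- s) -> r = 0 /\ s = 0.
Proof. case=> [h|[e h]] [h'|[e' h']]; split; lra. Qed.
Lemma lge_shift r s t : lge r s -> 0 <= t -> lge (r + t) s.
Proof.
case=> [h|[-> h]] ht; first by left; lra.
have [->|nt] := eqVneq t 0; first by right; split=> //; rewrite addr0.
by left; rewrite add0r lt_neqAle eq_sym nt.
Qed.

Lemma int_ge1 (k : int) (r : R) : 0 < r -> r < k%:~R -> 1 <= k%:~R :> R.
Proof. by move=> h h'; rewrite (ler_int R 1) -gtz0_ge1 -(ltr_int R); lra. Qed.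
Lemma int_le0 (k : int) (r : R) : r < 1 -> k%:~R < r -> k%:~R <= 0 :> R.
Proof. by move=> h h'; rewrite (ler_int R _ 0) -ltzD1 add0r -(ltr_int R); lra. Qed.

(** * The closed alcove as a fundamental domain for complex points *)

Section Affine.
Variables (n l : nat) (rts : seq (lat n * lat n)) (alpha : 'I_l -> lat n).
Hypothesis Hrd : based_root_datum_sc rts alpha.
Variable J : {set 'I_l}.
Implicit Types (u v x y : avec n) (p q : lat n * lat n) (M N : 'M[int]_n) (j : 'I_l).
Implicit Types (t : lat n) (k : int).
Notation WG := (inWG rts).
Notation WJ := (inWM rts alpha J).
Notation RJ := (RM rts alpha J).
Notation suppJ := (suppJ J).
Notation posJ := (posJ rts alpha J).
Notation alcv := (alcv rts alpha J).
Notation p0 := (p0 rts alpha J).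
Notation F := (rform rts).
Let HF1 := root_uniq Hrd.
Let HF2 := root_pair2 Hrd.
Let HF3 := root_closed Hrd.

Definition closedA x y := forall p, posJ p ->
  lge (rpair p.1 x) (rpair p.1 y) /\ lge (1 - rpair p.1 x) (- rpair p.1 y).

(** A closed alcove point lies weakly on the same side as [p0] of every affine wall q = k, not only
    of the walls with k = 0 or 1: [p0] has its value strictly between consecutive integers. *)
Lemma closedA_side x y q k : closedA x y -> RJ q ->
  (k%:~R < rpair q.1 p0 -> lge (rpair q.1 x - k%:~R) (rpair q.1 y)) /\
  (rpair q.1 p0 < k%:~R -> lge (k%:~R - rpair q.1 x) (- rpair q.1 y)).
Proof.
move=> hc hq; case: (RJ_posJ Hrd hq) => hp; have [h1 h2] := hc _ hp;
  have /andP[a1 a2] := alcv_p0 Hrd hp; rewrite /= ?rpairNl in h1 h2 a1 a2; split=> hk.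
- have h := int_le0 a2 hk; apply: lge_shift => //; lra.
- have h := int_ge1 a1 hk; have := lge_shift h2 (t := k%:~R - 1).
  by rewrite (_ : 1 - _ + _ = k%:~R - rpair q.1 x); [apply; lra|lra].
- have hk' : - rpair q.1 p0 < (- k)%:~R by rewrite mulrNz; lra.
  have h := int_ge1 a1 hk'; have := lge_shift h2 (t := (- k)%:~R - 1).
  rewrite !opprK mulrNz (_ : 1 + _ + _ = rpair q.1 x - k%:~R); last lra.
  by rewrite mulrNz in h; apply; lra.
- have hk' : (- k)%:~R < - rpair q.1 p0 by rewrite mulrNz; lra.
  have h := int_le0 a2 hk'; rewrite mulrNz in h.
  by rewrite addrC; apply: lge_shift => //; lra.
Qed.

(** Reflecting [v] in the wall p = k changes its squared distance to [p0] by a positive multiple of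
    the product of the two signed heights over the wall; it drops exactly when the wall separates
    [v] from [p0]. *)
Lemma rform_refl_dist p v (k : int) : p \in rts ->
  let w := v - (rpair p.1 v - k%:~R) *: toA p.2 in
  F (w - p0) (w - p0) = F (v - p0) (v - p0) +
    (rpair p.1 v - k%:~R) * (rpair p.1 p0 - k%:~R) * F (toA p.2) (toA p.2).
Proof.
move=> hp; set d := _ - k%:~R => w.
have -> : w - p0 = (v - p0) + (- d) *: toA p.2.
  by rewrite /w scaleNr addrAC.
have := rpairBr p.1 v p0; move: (v - p0) => V eV.
rewrite rformDl !rformDr !rformZl !rformZr (rformC rts V (toA p.2)).
have := rform_coroot HF1 HF2 HF3 V hp; rewrite eV.
set A := F _ V; set B := F (toA p.2) (toA p.2).
have -> : rpair p.1 p0 - k%:~R = d - (rpair p.1 v - rpair p.1 p0) by rewrite /d; ring.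
move: (rpair p.1 v - _) => a h; have := congr1 (fun z => d * z) h; lra.
Qed.

Lemma affine_refl M t p k : RJ p -> WJ M -> suppJ t ->
  exists t', [/\ WJ (refl p *m M), suppJ t' &
   forall v, ract (refl p *m M) v + toA t' =
    ract M v + toA t - (rpair p.1 (ract M v + toA t) - k%:~R) *: toA p.2].
Proof.
move=> hp hM ht; exists (t *m (refl p)^T + k *: p.2); split.
- by apply: WJ_mul => //; exact: inW_gen.
- have hs := suppJ_coroot Hrd hp.
  by apply: suppJD; [rewrite mul_reflT; apply: suppJB => //|]; apply: suppJZ.
- move=> w; rewrite toAD toAZ -ract_toA -ractM addrA -ractD ract_refl scalerBl opprB.
  by rewrite addrAC addrA.
Qed.

(** The walls k = 0 and k = 1 place the value of each positive root p at the image of [p0] in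
    [0, 1], so p pairs with [t] to 0 if [p.1 *m M] is positive and to 1 if it is negative. Then [t]
    is minuscule, hence zero, and [M] keeps all simple roots positive. *)
Lemma no_sep_id M t : WJ M -> suppJ t ->
  (forall p k, posJ p ->
     0 <= (rpair p.1 (ract M p0 + toA t) - k%:~R) * (rpair p.1 p0 - k%:~R)) ->
  M = 1%:M /\ t = 0.
Proof.
move=> hM ht hs.
have key p : posJ p -> (posr alpha (p.1 *m M) /\ ipair p.1 t = 0) \/ 
    (posr alpha (- (p.1 *m M)) /\ ipair p.1 t = 1).
  move=> hp; have h0 := hs p 0 hp; have h1 := hs p 1 hp.
  have /andP[a1 a2] := alcv_p0 Hrd hp.
  rewrite rpairDr rpair_ract rpair_toA subr0 in h0 h1.
  have hz0 : 0 <= rpair (p.1 *m M) p0 + (ipair p.1 t)%:~R by nra.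
  have hz1 : rpair (p.1 *m M) p0 + (ipair p.1 t)%:~R <= 1 by nra.
  have hq := RJ_pact Hrd hM hp.1.
  case: (RJ_posJ Hrd hq) => hq'; have /andP[b1 b2] := alcv_p0 Hrd hq';
    rewrite /= ?rpairNl in b1 b2; [left|right]; split; try exact: hq'.2.
  - apply/eqP; rewrite eq_le -!ltzD1 add0r -!(ltr_int R) intrD; apply/andP; split; lra.
  - apply/eqP; rewrite eq_le -!ltzD1 -!(ltr_int R) intrD; apply/andP; split; lra.
have t0 : t = 0.
  apply: (minuscule Hrd ht) => p hp.
  case: (RJ_posJ Hrd hp) => /key /=; first by case=> [[_ ->]|[_ ->]].
  by rewrite ipairNl; case=> [[_]|[_]]; lia.
split=> //; apply: (WJ_pos_id Hrd hM) => j hj.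
have hpj : posJ (alpha j, evec n j) by split; [exact: (RJ_simple Hrd)|exact: posr_simple].
by case: (key _ hpj) => [[]|[_]] //; rewrite t0 /ipair big1 // => k _; rewrite mxE mulr0.
Qed.

(** The image of (x, y) lies on the side of the image of [p0], being moved by the same affine map,
    and on the side of [p0], being in the closed alcove. By antisymmetry of the order it is on the
    wall. *)
Lemma sep_fixed M t x y p k : WJ M -> suppJ t -> closedA x y ->
  closedA (ract M x + toA t) (ract M y) -> posJ p ->
  (rpair p.1 (ract M p0 + toA t) - k%:~R) * (rpair p.1 p0 - k%:~R) < 0 ->
  rpair p.1 (ract M x + toA t) = k%:~R /\ rpair p.1 (ract M y) = 0.
Proof.
move=> hM ht h1 h2 hp hs.
have [s1 s2] := closedA_side k h2 hp.1.
have [s3 s4] := closedA_side (k - ipair p.1 t) h1 (RJ_pact Hrd hM hp.1).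
rewrite /= intrB -rpair_ract -(rpair_ract p.1 M x) -(rpair_ract p.1 M y) in s3 s4.
move: hs s1 s2 s3 s4; rewrite !rpairDr !rpair_toA.
move: (rpair p.1 (ract M p0)) (rpair p.1 p0) (rpair p.1 (ract M x)) (rpair p.1 (ract M y))
  (k%:~R : R) ((ipair p.1 t)%:~R : R) => a b c d e f hs s1 s2 s3 s4.
have [lt|lt] : e < b \/ b < e.
  by case: (ltgtP e b) => h; [left|right|move: hs; rewrite h subrr mulr0 ltxx].
  have [|? ?] := lge_antisym (s1 lt); last by split; lra.
  rewrite (_ : - _ = e - f - c); last lra.
  by apply: s4; nra.
have [|? ?] := lge_antisym (s2 lt); last by split; lra.
rewrite (_ : - _ = c - (e - f)); last lra.
by rewrite opprK; apply: s3; nra.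
Qed.

(** Among the affine maps with the same effect on (x, y), take one moving [p0] least. A separating
    wall would contain the image of (x, y), so reflecting in it keeps the effect and moves [p0]
    less; hence no wall separates and the map is the identity. For a regular point the same applies
    to [M] itself. *)
Lemma alcove_rigid M t x y : WJ M -> suppJ t -> closedA x y ->
  closedA (ract M x + toA t) (ract M y) ->
  [/\ ract M x + toA t = x, ract M y = y &
    (forall p k, posJ p -> ~ (rpair p.1 x = k%:~R /\ rpair p.1 y = 0)) -> M = 1%:M].
Proof.
move=> hM ht h1 h2.
set X := ract M x + toA t; set Y := ract M y.
have [s us hs] := WJ_enum Hrd J.
pose P N := exists t', [/\ suppJ t', ract N x + toA t' = X & ract N y = Y].
(* The translation part is forced by [N], so the distance is a function on the finite group and
   attains its minimum. *)
pose f N := F (ract N p0 + (X - ract N x) - p0) (ract N p0 + (X - ract N x) - p0).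
have [] := @seq_argmin _ s P f; first by exists M; [exact/hs|exists t].
move=> N [/hs hN [t' [ht' eX eY]] hmin].
have tE N1 t1 : ract N1 x + toA t1 = X -> X - ract N1 x = toA t1.
  by move=> <-; rewrite addrAC subrr add0r.
have [N1 t0] : N = 1%:M /\ t' = 0.
  apply: no_sep_id => // p k hp; rewrite leNgt; apply/negP => hlt.
  have h2' : closedA (ract N x + toA t') (ract N y) by rewrite eX eY.
  have [f1 f2] := sep_fixed hN ht' h1 h2' hp hlt.
  have [t2 [hN2 ht2 e2]] := affine_refl k hp.1 hN ht'.
  have eX2 : ract (refl p *m N) x + toA t2 = X by rewrite e2 f1 subrr scale0r subr0.
  have eY2 : ract (refl p *m N) y = Y by rewrite -ractM ract_refl f2 scale0r subr0.
  have hle : f N <= f (refl p *m N) by apply: hmin; [exact/hs|exists t2].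
  move: hle; rewrite /f (tE _ _ eX) (tE _ _ eX2) e2 rform_refl_dist ?(RJ_rts hp.1) //.
  have := rform_coroot_gt0 HF2 (RJ_rts hp.1); nra.
move: eX eY; rewrite N1 t0 toA0 addr0 !ract1 => eX eY; split=> // hreg.
have [|-> //] := no_sep_id hM ht.
move=> p k hp; rewrite leNgt; apply/negP => hlt.
have [f1 f2] := sep_fixed hM ht h1 h2 hp hlt.
by apply: (hreg p k hp); rewrite eX eY.
Qed.

Lemma bounded_suppJ (K : nat) : exists2 T : seq (lat n), uniq T &
  forall t, t \in T <-> (suppJ t /\ forall p, p \in rts -> (`|ipair p.1 t| <= K)%N).
Proof.
pose f t : {ffun 'I_(size rts) -> 'I_(K + K).+1} :=
  [ffun i => inord (absz (ipair (nth (0, 0) rts (val i)).1 t + K%:Z))].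
apply: (finite_of_inj (f := f)) => t t' [ht bt] [ht' bt'] e.
suff : toA (t - t') = 0.
  by rewrite -(toA0 n) => /toA_inj/eqP; rewrite subr_eq0 => /eqP.
have hs : suppJ (toA (t - t')) by apply/suppJ_toA; exact: suppJB.
apply: (corspan_eq0 Hrd (suppJ_corspan Hrd hs)) => p hp.
have hi : (index p rts < size rts)%N by rewrite index_mem.
have := congr1 (fun g : {ffun _ -> _} => val (g (Ordinal hi))) e.
rewrite !ffunE /= nth_index //.
rewrite toAB rpairBr !rpair_toA.
have := bt _ hp; have := bt' _ hp; move: (ipair p.1 t) (ipair p.1 t') => a b b1 b2.
rewrite !inordK; [move=> e2|lia|lia].
by have -> : a = b; [lia|rewrite subrr].
Qed.

(* Minimise the distance from x' to p0 over the affine orbit (x', y') of (x, y); among the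
   minimisers, minimise its derivative in the direction y'. *)
Lemma to_alcove x y : exists M t,
  [/\ WJ M, suppJ t & closedA (ract M x + toA t) (ract M y)].
Proof.
have [s us hs] := WJ_enum Hrd J.
pose C := \sum_(M <- s) \sum_(p <- rts) (`|rpair p.1 (ract M x)| + `|rpair p.1 p0|).
pose X (c : 'M[int]_n * lat n) := ract c.1 x + toA c.2.
pose f c := F (X c - p0) (X c - p0).
pose g (c : 'M[int]_n * lat n) := F (ract c.1 y) (X c - p0).
have f00 : 0 <= f (1%:M, 0) by apply: rform_ge0.
have C0 : 0 <= C by apply: sumr_ge0 => M _; apply: sumr_ge0 => p _; rewrite addr_ge0.
(* A candidate no farther from [p0] than the starting point satisfies |<p,t>| <= |r| + [C] with r^2
   <= [f (1%:M, 0)]; since |r| <= r^2 + 1, this [K] bounds all pairings of its translation part and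
   leaves finitely many candidates. *)
have [K hK] : exists K : nat, C + f (1%:M, 0) + 1 <= K%:R.
  exists (Num.truncn (C + f (1%:M, 0) + 1)).+1; apply: ltW; apply: truncnS_gt.
have [T uT hT] := bounded_suppJ K.
pose cand := [seq (M, t) | M <- s, t <- T].
have candP M t : WJ M -> suppJ t -> f (M, t) <= f (1%:M, 0) -> (M, t) \in cand.
  move=> hM ht hf; apply: allpairs_f; first exact/hs.
  apply/hT; split=> // p hp.
  have h1 : rpair p.1 (X (M, t) - p0) ^+ 2 <= f (M, t).
    rewrite /f /rform (bigD1_seq p.1) ?map_f //= -expr2 lerDl.
    by apply: sumr_ge0 => b _; rewrite -expr2 sqr_ge0.
  have h2 : `|rpair p.1 (ract M x)| + `|rpair p.1 p0| <= C.
    rewrite /C (bigD1_seq M) /= //; last exact/hs.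
    rewrite (bigD1_seq p) ?(uniq_rts Hrd) //= -addrA lerDl addr_ge0 //.
      by apply: sumr_ge0 => q _; rewrite addr_ge0.
    by apply: sumr_ge0 => N _; apply: sumr_ge0 => q _; rewrite addr_ge0.
  rewrite rpairBr rpairDr rpair_toA in h1.
  have h3 : `|(ipair p.1 t)%:~R| <= K%:R :> R.
    move: (ler_norm (rpair p.1 (ract M x))) (ler_norm (- rpair p.1 (ract M x))).
    move: (ler_norm (rpair p.1 p0)) (ler_norm (- rpair p.1 p0)).
    rewrite !normrN => n1 n2 n3 n4; rewrite ler_norml; apply/andP; split; nra.
  by rewrite -(ler_nat R) natr_absz intr_norm.
have in1 : (1%:M, 0) \in cand by apply: candP => //; [exact: WJ1|exact: suppJ0].
have candW c : c \in cand -> WJ c.1 /\ suppJ c.2.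
  by case/allpairsP => -[M t] [/hs hM /hT[ht _] ->].
have [] := @seq_argmin _ cand (fun=> True) f; first by exists (1%:M, 0).
move=> c0 [c0in _ fmin].
have [] := @seq_argmin _ cand (fun c => f c = f c0) g; first by exists c0.
move=> [M t] [cin fc gmin]; have [hM ht] := candW _ cin.
exists M, t; split=> //.
have hf c : c \in cand -> f (M, t) <= f c by move=> hc; rewrite fc; exact: fmin.
have f1 := hf _ in1.
suff main p k : posJ p -> (k = 0 \/ k = 1) ->
    let r := rpair p.1 (X (M, t)) - k%:~R in let e := rpair p.1 p0 - k%:~R in
    0 <= r * e /\ (r = 0 -> 0 <= rpair p.1 (ract M y) * e).
  move=> p hp; have /andP[a1 a2] := alcv_p0 Hrd hp.
  have [] := main p 0 hp (or_introl erefl); have [] := main p 1 hp (or_intror erefl).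
  rewrite !subr0 /X /=; set r := rpair p.1 (_ + _); set z := rpair p.1 (ract M y).
  move=> b1 b2 b3 b4; split.
  - have [r0|rn] := eqVneq r 0; first by right; split=> //; have := b4 r0; nra.
    by left; rewrite lt_neqAle eq_sym rn; nra.
  - have [r0|rn] := eqVneq r 1.
      right; split; first by rewrite r0 subrr.
      by have := b2 (_ : r - 1 = 0); rewrite r0 subrr => /(_ erefl); nra.
    by left; rewrite lt_neqAle eq_sym subr_eq0 eq_sym rn; nra.
move=> hp _ r e.
have gp := rform_coroot_gt0 HF2 (RJ_rts hp.1).
have [t2 [hM2 ht2 e2]] := affine_refl k hp.1 hM ht.
pose c2 := (refl p *m M, t2).
have X2 : X c2 = X (M, t) - r *: toA p.2 by rewrite /X /= e2.
have f2 : f c2 = f (M, t) + r * e * F (toA p.2) (toA p.2).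
  by rewrite /f X2 rform_refl_dist // (RJ_rts hp.1).
have le2 : f (M, t) <= f c2.
  case: (leP (f c2) (f (1%:M, 0))) => h; first by apply: hf; exact: candP.
  exact: le_trans f1 (ltW h).
split; first by move: le2; rewrite f2; nra.
(* On the wall itself the reflection does not move the real part, so the reflected pair is again a
   minimiser of [f]; comparing [g] gives the sign of the second coordinate. *)
move=> r0; have fe : f c2 = f (M, t) by rewrite f2 r0 !mul0r addr0.
have c2in : c2 \in cand by apply: candP => //; rewrite fe.
have := gmin c2 c2in (etrans fe fc).
rewrite /g X2 r0 scale0r subr0 /= -ractM ract_refl rformDl rformNl rformZl -subr_ge0.
have := rform_coroot HF1 HF2 HF3 (X (M, t) - p0) (RJ_rts hp.1).
rewrite rpairBr.
have -> : rpair p.1 (X (M, t)) - rpair p.1 p0 = - e by rewrite /r in r0; rewrite /e; lra.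
move: gp; set B := F _ _; set D := F _ (X _ - _); set z := rpair p.1 _.
move=> gp hD; rewrite [_ + _ - _](_ : _ = - (z * D)); last by ring.
have : 2 * (- (z * D)) = z * e * B by rewrite mulrN mulrCA hD; ring.
nra.
Qed.

End Affine.


(** * Alcove automorphisms and their fixed points *)

Section Automorphism.
Variables (n l : nat) (rts : seq (lat n * lat n)) (alpha : 'I_l -> lat n).
Hypothesis Hrd : based_root_datum_sc rts alpha.
Variable J : {set 'I_l}.
Implicit Types (u v x y : avec n) (p q : lat n * lat n) (M N : 'M[int]_n) (j : 'I_l).
Implicit Types (t : lat n).
Notation WG := (inWG rts).
Notation WJ := (inWM rts alpha J).
Notation RJ := (RM rts alpha J).
Notation suppJ := (suppJ J).
Notation posJ := (posJ rts alpha J).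
Notation alcv := (alcv rts alpha J).
Notation p0 := (p0 rts alpha J).
Notation closedA := (closedA rts alpha J).

(** In terms of all affine walls, invariance of the alcove under an affine map permuting the walls
    reduces to one test point. *)
Lemma alcv_side v : alcv v <->
  forall p (k : int), RJ p -> 0 < (rpair p.1 p0 - k%:~R) * (rpair p.1 v - k%:~R).
Proof.
split=> [h p k hp|h p hp]; last first.
  have := h p 0 hp.1; have := h p 1 hp.1; have /andP[] := alcv_p0 Hrd hp.
  by rewrite !subr0 => *; apply/andP; split; nra.
have pos q (m : int) : posJ q -> 0 < (rpair q.1 p0 - m%:~R) * (rpair q.1 v - m%:~R).
  move=> hq; have /andP[a1 a2] := alcv_p0 Hrd hq; have /andP[b1 b2] := h q hq.
  case: (ltP 0 m) => hm.
    have : 1 <= m%:~R :> R by rewrite (ler_int R 1).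
    nra.
  have : m%:~R <= 0 :> R by rewrite (ler_int R m 0).
  nra.
case: (RJ_posJ Hrd hp) => [/pos//|/(pos _ (- k))].
by rewrite /= !rpairNl mulrNz; nra.
Qed.

(** Translate by [lam], then return to the closed alcove by an affine Weyl element. The image of
    [p0] is on no wall, so it is interior, and the composite therefore preserves the alcove. This
    realises the class of [lam] in the stabiliser of the alcove. *)
Lemma alcove_auto (lam : lat n) : exists M (mu : lat n),
  [/\ WJ M, suppJ (mu - lam) & forall v, alcv v <-> alcv (ract M v + toA mu)].
Proof.
have [M [t [hM ht hc]]] := to_alcove Hrd J (p0 + toA lam) 0.
exists M, (lam *m M^T + t).
set mu := lam *m M^T + t.
have e : ract M p0 + toA mu = ract M (p0 + toA lam) + toA t.
  by rewrite ractD ract_toA /mu toAD addrA.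
split=> //.
  rewrite /mu addrAC; apply: suppJD => //. exact: (suppJ_WJ_mulT Hrd _ hM).
have a0 : alcv (ract M p0 + toA mu).
  move=> p hp; have [h1 h2] := hc p hp; rewrite -e in h1 h2.
  have nz (k : int) : rpair p.1 (ract M p0 + toA mu) != k%:~R.
    rewrite rpairDr rpair_ract rpair_toA.
    have := (alcv_side _).1 (alcv_p0 Hrd (J := J)) _ (k - ipair p.1 mu) (RJ_pact Hrd hM hp.1).
    rewrite /= intrB => h; apply/eqP => h0; move: h.
    by rewrite (_ : _ - (_ - _) = 0) ?mulr0 ?ltxx //; lra.
  have := lge_ge h1; have := lge_ge h2; have := nz 0; have := nz 1.
  rewrite !lt_neqAle => n1 n0 g1 g0; rewrite eq_sym n0 g0 n1 /=; lra.
have sg p (k : int) : RJ p -> 0 < (rpair p.1 p0 - k%:~R) * (rpair p.1 (ract M p0 + toA mu) - k%:~R).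
  by move=> hp; apply: (alcv_side _).1.
have sh p (k : int) v : rpair p.1 (ract M v + toA mu) - k%:~R =
    rpair (p.1 *m M) v - (k - ipair p.1 mu)%:~R.
  by rewrite rpairDr rpair_ract rpair_toA intrB; ring.
move=> v; split=> /alcv_side h; apply/alcv_side => p k hp.
  have := h _ (k - ipair p.1 mu) (RJ_pact Hrd hM hp).
  by have := sg p k hp; rewrite !sh /=; move: (_ - _) (_ - _) (_ - _) => a b c; nra.
pose q := pact (invmx M) p.
have hq : RJ q by apply: RJ_pact => //; exact: WJ_inv.
have eq1 : q.1 *m M = p.1 by rewrite /q /= mulmxKV // (WJ_unit Hrd hM).
have := h q (k + ipair q.1 mu) hq; have := sg q (k + ipair q.1 mu) hq.
rewrite !sh eq1 addrK; move: (_ - _) (_ - _) (_ - _) => a b c; nra.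
Qed.

Lemma finite_order M : WJ M -> exists2 d, (0 < d)%N & iter d (mulmx M) 1%:M = 1%:M.
Proof.
move=> hM; have [s us hs] := WJ_enum Hrd J.
pose f k := iter k (mulmx M) 1%:M.
have fW k : WJ (f k) by elim: k => [|k IH]; [exact: WJ1|apply: WJ_mul].
have uM := WJ_unit Hrd hM.
have fD (i j : nat) : f (i + j)%N = f i *m f j.
  by elim: i => [|i IH]; rewrite ?mul1mx // addSn /f !iterS -/(f _) IH mulmxA.
have : ~~ uniq (map f (iota 0 (size s).+1)).
  apply/negP => /uniq_leq_size h.
  have /h : {subset map f (iota 0 (size s).+1) <= s} by move=> _ /mapP[k _ ->]; apply/hs.
  by rewrite size_map size_iota ltnn.
move=> /(uniqPn 1%:M)[i [j [ij]]]; rewrite size_map size_iota => hj.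
rewrite !(nth_map 0%N) ?size_iota // ?(ltn_trans ij) // !nth_iota ?(ltn_trans ij) //.
rewrite !add0n => e; exists (j - i)%N; first by rewrite subn_gt0.
have ui := WJ_unit Hrd (fW i).
have : f i *m f (j - i)%N = f i *m 1%:M by rewrite -(fD i (j - i)%N) subnKC ?(ltnW ij) // mulmx1.
by move/(can_inj (mulKmx ui)).
Qed.

(** Roots of M kill [nu], so [f] preserves the alcove. A power of [f] is a translation; as the
    alcove is bounded, that translation is zero. The orbit of [p0] is then finite, and its
    barycentre is a fixed point, interior by convexity. *)
Lemma alcove_fixpoint M (mu : lat n) (nu : avec n) : WJ M -> suppJ (toA mu - nu) ->
  (forall j, j \in J -> rpair (alpha j) nu = 0) ->
  (forall v, alcv v <-> alcv (ract M v + toA mu)) ->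
  exists2 b, alcv b & ract M b + toA mu = b + nu.
Proof.
move=> hM hs hnu hal; have [d d0 hd] := finite_order hM.
have nu0 p : RJ p -> rpair p.1 nu = 0.
  move=> [_ [c [hc ->]]]; rewrite rpair_suml big1 // => j _; rewrite rpairZl.
  by case: (boolP (j \in J)) => [/hnu->|/hc->]; rewrite ?mulr0 ?mul0r.
pose f v := ract M v + (toA mu - nu).
have fal v : alcv v -> alcv (f v).
  move=> /hal h p hp; have := h p hp.
  by rewrite /f addrA rpairBr (nu0 _ hp.1) subr0.
have fB k u v : iter k f u - iter k f v = ract (iter k (mulmx M) 1%:M) (u - v).
  elim: k => [|k IH]; first by rewrite ract1.
  by rewrite !iterS /f opprD addrACA subrr addr0 -ractB -/f IH ractM.
pose kap := iter d f p0 - p0.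
have step v : iter d f v = v + kap.
  have := fB d v p0; rewrite hd ract1 /kap => e.
  by rewrite addrCA -e addrC subrK.
have it m : iter m (iter d f) p0 = p0 + m%:R *: kap.
  elim: m => [|m IH]; first by rewrite scale0r addr0.
  by rewrite iterS IH step -natr1 scalerDl scale1r [RHS]addrA.
have ial k v : alcv v -> alcv (iter k f v).
  by move=> hv; elim: k => // k IH; rewrite iterS; exact: fal.
(* All multiples of [kap] keep [p0] in the alcove, so the simple roots of J vanish on it; it also
   lies in the span of the coroots of J. *)
have kap0 : kap = 0.
  apply: (suppJ_nondeg Hrd (J := J)).
    have fs k : suppJ (iter k f p0 - p0).
      elim: k => [|k IH]; first by rewrite subrr; exact: suppJ0.
      rewrite iterS -(subrK (iter k f p0) (f _)) -addrA; apply: suppJD => //.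
      rewrite /f addrAC; apply: suppJD => //; exact: (suppJ_WJ Hrd).
    exact: fs.
  move=> j hj.
  have hp : posJ (alpha j, evec n j) by split; [exact: RJ_simple|exact: posr_simple].
  have bd (m : nat) : -1 < m%:R * rpair (alpha j) kap < 1.
    have /andP[a1 a2] := alcv_p0 Hrd hp.
    have : alcv (iter m (iter d f) p0).
      elim: (m) => [|i IH]; first exact: alcv_p0.
      by rewrite iterS; exact: ial.
    move=> /(_ _ hp); rewrite it rpairDr rpairZr /= => /andP[b1 b2] /=; apply/andP; split.
      by move: a2 b1 => /=; lra.
    by move: a1 b2 => /=; lra.
  apply/eqP; apply: contraT => nz.
  have [m hm] : exists m : nat, 1 < m%:R * `|rpair (alpha j) kap|.
    exists (Num.truncn (`|rpair (alpha j) kap|^-1)).+1.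
    rewrite -ltr_pdivrMr ?normr_gt0 // mul1r; exact: truncnS_gt.
  have := bd m; by rewrite -ltr_norml normrM normr_nat ltNge (ltW hm).
pose b := (d%:R)^-1 *: \sum_(k < d) iter k f p0.
have dn0 : (d%:R : R) != 0 by rewrite pnatr_eq0 -lt0n.
have fb : f b = b.
  have fav : f b = (d%:R)^-1 *: \sum_(k < d) iter k.+1 f p0.
    rewrite /f /b ractZ ract_sum; under [in RHS]eq_bigr do rewrite iterS.
    rewrite big_split /= scalerDr; congr (_ + _).
    by rewrite sumr_const card_ord -[X in _ *: X]scaler_nat scalerA mulVf // scale1r.
  rewrite fav /b; congr (_ *: _).
  case: (d) d0 (step p0) => // m _; rewrite kap0 addr0 => e.
  by rewrite big_ord_recr [RHS]big_ord_recl /= -iterS e addrC.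
exists b; last by move: fb; rewrite /f addrA => /eqP; rewrite subr_eq => /eqP.
move=> p hp.
have dp : 0 < (d%:R : R) by rewrite ltr0n.
have hk k : 0 < rpair p.1 (iter k f p0) < 1 by apply: ial hp; exact: alcv_p0.
have hne : (0 < #|'I_d|)%N by rewrite card_ord.
rewrite /b rpairZr rpair_sumr; apply/andP; split.
  rewrite mulr_gt0 ?invr_gt0 // lt_neqAle sumr_ge0 => [|k _]; last by have /andP[/ltW] := hk k.
  rewrite andbT eq_sym psumr_eq0 => [|k _]; last by have /andP[/ltW] := hk k.
  apply/negP => /allP/(_ (Ordinal d0) (mem_index_enum _)) /=.
  by have /andP[/lt0r_neq0/negbTE->] := hk 0%N.
rewrite mulrC ltr_pdivrMr // mul1r -[d in ltRHS]card_ord -sumr_const.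
rewrite -subr_gt0 -sumrB lt_neqAle sumr_ge0 => [|k _]; last by have /andP[_ /ltW] := hk k; rewrite subr_ge0.
rewrite andbT eq_sym psumr_eq0 => [|k _]; last by have /andP[_ /ltW] := hk k; rewrite subr_ge0.
apply/negP => /allP/(_ (Ordinal d0) (mem_index_enum _)) /=.
by rewrite subr_eq0; have /andP[_ /lt_eqF] := hk 0%N; rewrite eq_sym => ->.
Qed.

Lemma WJ_fix M (nu : avec n) : (forall j, j \in J -> rpair (alpha j) nu = 0) ->
  WJ M -> ract M nu = nu.
Proof.
move=> h; elim/(WJ_ind Hrd) => [|N j hj _ _ IH]; first exact: ract1.
by rewrite -ractM IH ract_sr h // scale0r subr0.
Qed.
Lemma RJ_orth (nu : avec n) p : (forall j, j \in J -> rpair (alpha j) nu = 0) ->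
  RJ p -> rpair p.1 nu = 0.
Proof.
move=> hnu [_ [c [hc ->]]]; rewrite rpair_suml big1 // => j _; rewrite rpairZl.
by case: (boolP (j \in J)) => [/hnu->|/hc->]; rewrite ?mulr0 ?mul0r.
Qed.

Lemma closedA_auto M (mu : lat n) x y : WJ M ->
  (forall v, alcv v <-> alcv (ract M v + toA mu)) ->
  closedA x y -> closedA (ract M x + toA mu) (ract M y).
Proof.
move=> hM hal hc p hp.
have /andP[a1 a2] := (hal p0).1 (alcv_p0 Hrd (J := J)) p hp.
have hq := RJ_pact Hrd hM hp.1.
have [s1 _] := closedA_side Hrd (0 - ipair p.1 mu) hc hq.
have [_ s2] := closedA_side Hrd (1 - ipair p.1 mu) hc hq.
move: s1 s2 a1 a2; rewrite /= !rpairDr !rpair_toA !rpair_ract !intrB => s1 s2 a1 a2; split.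
  by rewrite (_ : _ + _ = rpair (p.1 *m M) x - (0 - (ipair p.1 mu)%:~R)); [apply: s1; lra|ring].
by rewrite (_ : 1 - _ = 1 - (ipair p.1 mu)%:~R - rpair (p.1 *m M) x); [apply: s2; lra|ring].
Qed.

Lemma alcv_stab M t x y : alcv x -> WJ M -> ract M x = x + toA t -> ract M y = y -> M = 1%:M.
Proof.
move=> ha hM ex ey.
have hc : closedA x y by move=> p /ha/andP[a b]; split; apply: lge_gt; lra.
have ht : suppJ (- t).
  apply: suppJN; apply/suppJ_toA; have := suppJ_WJ Hrd x hM.
  by rewrite ex addrAC subrr add0r.
have hc' : closedA (ract M x + toA (- t)) (ract M y) by rewrite ex ey toAN addrK.
have [_ _ h] := alcove_rigid Hrd hM ht hc hc'.
apply: h => p k /ha/andP[a b] [e _]; rewrite e in a b.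
by rewrite (ltr0z) in a; rewrite (ltr_int R k 1) in b; lia.
Qed.

(** No root of M takes the value 1 on the character of (x, y) defined by [chr]: phase an integer and
    modulus 1. *)
Definition regA x y := forall p (k : int), posJ p -> ~ (rpair p.1 x = k%:~R /\ rpair p.1 y = 0).

(* If G moves x + iy by nu modulo the cocharacter lattice, an affine Weyl transformation brings
   x + iy to a point of the closed alcove fixed by the alcove automorphism attached to nu. *)
Lemma monodromy_normal_form H (mu t0 : lat n) (nu x y : avec n) G :
  WJ H -> suppJ (toA mu - nu) -> (forall j, j \in J -> rpair (alpha j) nu = 0) ->
  (forall v, alcv v <-> alcv (ract H v + toA mu)) ->
  WJ G -> ract G x = x + nu - toA t0 -> ract G y = y ->
  exists U t', [/\ WJ U, suppJ t' & let x' := ract U x + toA t' in let y' := ract U y in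
    [/\ closedA x' y', ract H x' + toA mu = x' + nu, ract H y' = y' &
        regA x' y' -> U *m G *m invmx U = H]].
Proof.
move=> hH hs hnu hal hG ex ey.
have [U [t' [hU ht' hc]]] := to_alcove Hrd J x y.
exists U, t'; split=> // x' y'.
have uU := WJ_unit Hrd hU; have uH := WJ_unit Hrd hH.
pose g := U *m G *m invmx U.
have hg : WJ g by apply: WJ_mul; [exact: WJ_mul|exact: WJ_inv].
have gU v : ract g (ract U v) = ract U (ract G v) by rewrite !ractM /g mulmxKV.
have ey' : ract g y' = y' by rewrite gU ey.
(* Translation part of the monodromy after conjugation by the affine map ([U], [t']). *)
pose t2 : lat n := t' + t0 *m U^T - t' *m g^T.
have ex' : x' + nu = ract g x' + toA t2.
  rewrite /x' ractD gU ex ractB ractD (WJ_fix hnu hU) /t2 toAB toAD -!ract_toA.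
  by apply/rowP => k; rewrite !mxE; ring.
(* The alcove automorphism and the conjugated monodromy both send (x', y') into the closed alcove
   and differ by the affine Weyl element ([M], [t]). Rigidity makes this element fix the point and,
   in the regular case, makes [M] trivial. *)
pose M := g *m invmx H.
have hM : WJ M by apply: WJ_mul => //; exact: WJ_inv.
have MH v : ract M (ract H v) = ract g v by rewrite ractM /M mulmxKV.
pose t := t2 - mu *m M^T.
have eX : ract M (ract H x' + toA mu) + toA t = x' + nu.
  rewrite ractD MH /t toAB -ract_toA ex'.
  by apply/rowP => k; rewrite !mxE; ring.
have ht : suppJ t.
  apply/suppJ_toA.
  have -> : toA t = (x' + nu - (ract H x' + toA mu)) -
      (ract M (ract H x' + toA mu) - (ract H x' + toA mu)).
    by rewrite -eX; apply/rowP => k; rewrite !mxE; ring.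
  apply: suppJB; last exact: (suppJ_WJ Hrd).
  have -> : x' + nu - (ract H x' + toA mu) = - (ract H x' - x') - (toA mu - nu).
    by apply/rowP => k; rewrite !mxE; ring.
  by apply: suppJB => //; apply: suppJN; exact: (suppJ_WJ Hrd).
have hc1 := closedA_auto hH hal hc.
have hc2 : closedA (ract M (ract H x' + toA mu) + toA t) (ract M (ract H y')).
  rewrite eX MH ey' => p hp; rewrite rpairDr (RJ_orth hnu hp.1) addr0; exact: hc.
have [e1 e2 e3] := alcove_rigid Hrd hM ht hc1 hc2.
rewrite eX in e1; rewrite MH ey' in e2; split=> // hreg.
have M1 : M = 1%:M.
  apply: e3 => p k hp [h1 h2]; apply: (hreg p k hp).
  by rewrite -e1 rpairDr (RJ_orth hnu hp.1) addr0 in h1; rewrite -e2 in h2.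
by rewrite -/g -[g](mulmxKV uH) -/M M1 mul1mx.
Qed.

End Automorphism.

(** * Orbit sums and the Jacobian of the quotient map *)


Lemma sumr_const_seq (V : nmodType) (I : Type) (r : seq I) (P : pred I) (x : V) :
  \sum_(i <- r | P i) x = x *+ count P r.
Proof. by rewrite big_const_seq iter_addr_0. Qed.

Section Enum.
Variables (n l : nat) (rts : seq (lat n * lat n)) (alpha : 'I_l -> lat n).
Hypothesis Hrd : based_root_datum_sc rts alpha.
Variable J : {set 'I_l}.
Variable s : seq 'M[int]_n.
Hypothesis us : uniq s.
Hypothesis hs : forall M, M \in s <-> inWM rts alpha J M.
Implicit Types (M N : 'M[int]_n) (x y om : lat n).
Notation WJ := (inWM rts alpha J).

Lemma perm_mulr M : WJ M -> perm_eq [seq N *m M | N <- s] s.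
Proof.
move=> hM; have uM := WJ_unit Hrd hM.
have um : uniq [seq N *m M | N <- s] by rewrite map_inj_uniq //; exact: can_inj (mulmxK uM).
apply: uniq_perm => // N; apply/mapP/idP => [[N' /hs hN ->]|/hs hN].
  by apply/hs; exact: WJ_mul.
by exists (N *m invmx M); [apply/hs; apply: WJ_mul => //; exact: WJ_inv|rewrite mulmxKV].
Qed.
Lemma perm_mull M : WJ M -> perm_eq [seq M *m N | N <- s] s.
Proof.
move=> hM; have uM := WJ_unit Hrd hM.
have um : uniq [seq M *m N | N <- s] by rewrite map_inj_uniq //; exact: can_inj (mulKmx uM).
apply: uniq_perm => // N; apply/mapP/idP => [[N' /hs hN ->]|/hs hN].
  by apply/hs; exact: WJ_mul.
by exists (invmx M *m N); [apply/hs; apply: WJ_mul => //; exact: WJ_inv|rewrite mulKVmx].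
Qed.
Lemma sum_mulr (V : nmodType) (f : 'M[int]_n -> V) M : WJ M ->
  \sum_(N <- s) f (N *m M) = \sum_(N <- s) f N.
Proof. by move=> /perm_mulr h; rewrite -[RHS](perm_big _ h) big_map. Qed.
Lemma sum_mull (V : nmodType) (f : 'M[int]_n -> V) M : WJ M ->
  \sum_(N <- s) f (M *m N) = \sum_(N <- s) f N.
Proof. by move=> /perm_mull h; rewrite -[RHS](perm_big _ h) big_map. Qed.

(** Here k is the order of the stabiliser; it does not depend on the function summed. *)
Lemma sum_orbit om (o : seq (lat n)) : uniq o ->
  (forall x, x \in o <-> exists2 M, WJ M & x = om *m M) ->
  exists2 k, (0 < k)%N & forall (V : nmodType) (f : lat n -> V),
    \sum_(M <- s) f (om *m M) = (\sum_(x <- o) f x) *+ k.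
Proof.
move=> uo ho; pose k := count (fun M => om *m M == om) s.
have k0 : (0 < k)%N.
  rewrite -has_count; apply/hasP; exists 1%:M; first by apply/hs; exact: WJ1.
  by rewrite mulmx1.
exists k => // V f.
have cnt x : x \in o -> count (fun M => om *m M == x) s = k.
  move=> /ho[M hM ->]; rewrite -(permP (perm_mulr hM)) count_map; apply: eq_count => N /=.
  by rewrite mulmxA; apply/eqP/eqP => [/(can_inj (mulmxK (WJ_unit Hrd hM)))|->].
rewrite -sumrMnl.
transitivity (\sum_(M <- s) \sum_(x <- o) (if om *m M == x then f x else 0)).
  apply: eq_big_seq => M /hs hM.
  rewrite (bigD1_seq (om *m M)) //=; last by apply/ho; exists M.
  by rewrite eqxx big1 ?addr0 // => x /negbTE; rewrite eq_sym => ->.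
rewrite exchange_big; apply: eq_big_seq => x /cnt <- /=.
by rewrite -big_mkcond /= sumr_const_seq.
Qed.

Notation rho := (rho2 rts alpha J).
Definition wdom x := forall j, j \in J -> 0 <= ipair x (evec n j).

Lemma rho_pos x : posr alpha x -> spanJ alpha J x -> x != 0 -> 0 < ipair x rho.
Proof.
move=> h1 h2 h3; rewrite -(ltr0z R) -rpair_toA; apply: (span_posr_gt0 Hrd h2 h1 h3) => j hj.
by rewrite rpair_toA rho2_simple.
Qed.

Lemma central_fix x M : (forall j, j \in J -> ipair x (evec n j) = 0) -> WJ M -> x *m M = x.
Proof.
move=> x0 hM.
have h1 : wdom x by move=> j hj; rewrite x0.
have h2 : wdom (- x) by move=> j hj; rewrite ipairNl x0.
have [h3 _] := weight_sub_orbit Hrd h1 hM.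
have [h4 _] := weight_sub_orbit Hrd h2 hM; rewrite mulNmx -opprD in h4.
by apply/esym/eqP; rewrite -subr_eq0; apply/eqP; exact: (posr_antisym Hrd h3 h4).
Qed.

Lemma wdom_coroot x p : wdom x -> posJ rts alpha J p -> 0 <= ipair x p.2.
Proof.
move=> hx [hp hpos]; rewrite leNgt; apply/negP => hneg.
have [h1 _] := weight_sub_orbit Hrd hx (inW_gen hp).
rewrite mul_refl opprB addrCA subrr addr0 in h1.
have h2 : posr alpha (- (ipair x p.2 *: p.1)).
  by rewrite -scaleNr; apply: posrZ => //; rewrite oppr_ge0 ltW.
have /eqP := posr_antisym Hrd h1 h2.
by rewrite (scale_lat_eq0 _ (root_neq0 Hrd (RJ_rts hp))) (lt_eqF hneg).
Qed.

Lemma ipair_sumr (I : Type) (r : seq I) (P : pred I) x (f : I -> lat n) :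
  ipair x (\sum_(i <- r | P i) f i) = \sum_(i <- r | P i) ipair x (f i).
Proof.
apply: (big_morph (ipair x)) => [u v|]; first by rewrite ipairDr.
by rewrite /ipair big1 // => k _; rewrite mxE mulr0.
Qed.

Lemma wdom_rho x : wdom x -> 0 <= ipair x rho.
Proof.
move=> hx; rewrite ipair_sumr; apply: sumr_ge0 => p /asboolP hp; exact: wdom_coroot.
Qed.

Lemma ipair_evec2 (i j : 'I_l) : ipair (evec n j) (evec n i) = (i == j)%:R.
Proof. by rewrite (ipair_evec (wo Hrd i)) mxE. Qed.

Lemma fund_rho (j : 'I_l) : j \in J -> wdom (evec n j) /\ 0 < ipair (evec n j) rho.
Proof.
move=> hj.
have hd : wdom (evec n j) by move=> i _; rewrite ipair_evec2 ler0n.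
split=> //; rewrite ipair_sumr.
have hp : posJ rts alpha J (alpha j, evec n j) by split; [exact: RJ_simple|exact: posr_simple].
rewrite (big_rem (alpha j, evec n j)) /= ?(simple_in Hrd) // asboolT // ipair_evec2 eqxx.
have : 0 <= \sum_(y <- rem (alpha j, evec n j) rts | `[< posJ rts alpha J y >]) ipair (evec n j) y.2.
  by apply: sumr_ge0 => p /asboolP hp'; exact: wdom_coroot.
move: (\sum_(_ <- _ | _) _); lia.
Qed.

(** An element of the orbit with the largest pairing with [rho] is dominant, since reflecting away a
    negative coordinate would increase the pairing. *)
Lemma wdom_rep x : exists2 M, WJ M & wdom (x *m M).
Proof.
have [] := @seq_argmin _ s (fun=> True) (fun M => - rpair (x *m M) (toA rho)).
  by exists 1%:M => //; apply/hs; exact: WJ1.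
move=> M [/hs hM _ hmin]; exists M => // j hj; rewrite leNgt; apply/negP => hneg.
have hM2 : WJ (M *m sr alpha j) by apply: WJ_mul => //; exact: WJ_sr.
have := hmin (M *m sr alpha j) ((hs _).2 hM2) I.
rewrite mulmxA mul_refl /= lerN2 rpairBl rpairZl !rpair_toA rho2_simple //.
rewrite -intrM -intrB ler_int; move: hneg; move: (ipair _ _) (ipair _ _); lia.
Qed.

Section Invariants.
Variables (T : Type) (K : nzRingType) (a : T -> lat n -> K).
Hypothesis a0 : forall t, a t 0 = 1.
Hypothesis aD : forall t x y, a t (x + y) = a t x * a t y.
Variable E : (T -> K) -> Prop.
Hypothesis Eadd : forall f g, E f -> E g -> E (fun t => f t + g t).
Hypothesis Eopp : forall f, E f -> E (fun t => - f t).
Hypothesis Emul : forall f g, E f -> E g -> E (fun t => f t * g t).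
Hypothesis E1 : E (fun=> 1).
Hypothesis Ediv : forall f k, (0 < k)%N -> E (fun t => f t *+ k) -> E f.
Hypothesis Efund : forall j, j \in J -> E (fun t => \sum_(M <- s) a t (evec n j *m M)).
Hypothesis Eout : forall k : 'I_n, (forall j, j \in J -> nat_of_ord j != k) ->
  E (fun t => a t (evec n k)) /\ E (fun t => a t (- evec n k)).

Let S x t := \sum_(M <- s) a t (x *m M).

Lemma E0 : E (fun=> 0).
Proof. by have := Eadd E1 (Eopp E1); congr E; apply: funext => t; rewrite subrr. Qed.
Lemma Esum (I : Type) (r : seq I) (P : pred I) (f : I -> T -> K) :
  (forall i, P i -> E (f i)) -> E (fun t => \sum_(i <- r | P i) f i t).
Proof.
move=> h; elim: r => [|i r IH].
  by have := E0; congr E; apply: funext => t; rewrite big_nil.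
case Pi: (P i); last by move: IH; congr E; apply: funext => t; rewrite big_cons Pi.
by have := Eadd (h i Pi) IH; congr E; apply: funext => t; rewrite big_cons Pi.
Qed.
Lemma Emuln f k : E f -> E (fun t => f t *+ k).
Proof.
move=> hf; elim: k => [|k IH].
  by have := E0; congr E; apply: funext => t; rewrite mulr0n.
by have := Eadd hf IH; congr E; apply: funext => t; rewrite mulrS.
Qed.

Lemma S_mul x M t : WJ M -> S (x *m M) t = S x t.
Proof.
move=> hM; rewrite /S; under eq_bigr do rewrite -mulmxA.
exact: (sum_mull (fun N => a t (x *m N))).
Qed.
Lemma S_prod x y t : S x t * S y t = \sum_(N <- s) S (x + y *m N) t.
Proof.
rewrite /S mulr_suml.
under eq_bigr => M _ do rewrite mulr_sumr.
rewrite [RHS]exchange_big; apply: eq_big_seq => M /hs hM /=.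
rewrite -(sum_mulr (fun N => a t (x *m M) * a t (y *m N)) hM).
by apply: eq_bigr => N _; rewrite -aD mulmxDl mulmxA.
Qed.

Lemma E_central x : (forall j, j \in J -> ipair x (evec n j) = 0) -> E (fun t => a t x).
Proof.
move=> hx.
have Ez (k : 'I_n) (m : int) : (forall j, j \in J -> nat_of_ord j != k) ->
    E (fun t => a t (m *: evec n k)).
  move=> /Eout[e1 e2].
  have en (m' : nat) u : E (fun t => a t u) -> E (fun t => a t (u *+ m')).
    move=> hu; elim: m' => [|m' IH]; first by have := E1; congr E; apply: funext => t; rewrite mulr0n a0.
    by have := Emul hu IH; congr E; apply: funext => t; rewrite -aD mulrS.
  case: (intP m) => [|m'|m'].
  - by have := E1; congr E; apply: funext => t; rewrite scale0r a0.
  - by have := en m'.+1 _ e1; congr E; apply: funext => t; rewrite -scaler_nat natz.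
  - by have := en m'.+1 _ e2; congr E; apply: funext => t; rewrite mulNrn -scaler_nat natz scaleNr.
rewrite (lat_expand x).
elim: (index_enum _) => [|k r IH].
  by have := E1; congr E; apply: funext => t; rewrite big_nil a0.
suff hk : E (fun t => a t (x 0 k *: evec n k)).
  by have := Emul hk IH; congr E; apply: funext => t; rewrite big_cons aD.
case: (pselect (forall j, j \in J -> nat_of_ord j != k)) => [|hn]; first exact: Ez.
have -> : x 0 k = 0.
  apply/eqP; apply: contra_notT hn => nz j hj; apply: contraNneq nz => e.
  by have := hx j hj; rewrite e ipair_evec => ->.
by have := E1; congr E; apply: funext => t; rewrite scale0r a0.
Qed.

(** Induction on the height of a dominant y. If y has a positive coordinate j, the product of the
    orbit sums of y - e_j and e_j is a positive multiple of that of y plus orbit sums of lower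
    height. Only closure properties of [E] enter, so [E] may be a ring of polynomials or the
    equality of two characters. *)
Lemma E_orbit_sum x : E (fun t => \sum_(M <- s) a t (x *m M)).
Proof.
suff dom y : wdom y -> E (S y).
  have [M hM hd] := wdom_rep x.
  by have := dom _ hd; congr E; apply: funext => t; rewrite S_mul.
have [m] : exists m : nat, ipair y rho < m%:Z.
  exists (absz (ipair y rho)).+1; lia.
elim: m y => [|m IH] y hm hy; first by have := wdom_rho hy; rewrite leNgt hm.
case: (pselect (exists2 j, j \in J & 0 < ipair y (evec n j))) => [[j hj pj]|hn]; last first.
  have y0 j : j \in J -> ipair y (evec n j) = 0.
    move=> hj; apply/eqP; rewrite eq_le (hy j hj) andbT leNgt; apply/negP => h.
    by apply: hn; exists j.
  have fx M : WJ M -> y *m M = y by exact: central_fix.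
  have := Emuln (size s) (E_central y0); congr E; apply: funext => t.
  rewrite /S; rewrite (eq_big_seq (fun=> a t y)) => [|M /hs/fx-> //].
  by rewrite sumr_const_seq count_predT.
have [hdj hrj] := fund_rho hj.
pose x' := y - evec n j.
have hx' : wdom x'.
  move=> i hi; rewrite ipairDl ipairNl ipair_evec2.
  case: eqP => [->|_]; last by rewrite subr0; exact: hy.
  by rewrite subr_ge0 -gtz0_ge1.
have Ex' : E (S x').
  apply: IH => //; rewrite /x' ipairDl ipairNl.
  by move: hm hrj; move: (ipair _ _) (ipair _ _); lia.
pose z N := x' + evec n j *m N.
(* Marks the terms of the product lying in the orbit of y. The identity is one of them, so their
   number k can be divided out. *)
pose B N := `[< exists2 M, WJ M & z N *m M = y >].
pose k := count B s.
have k0 : (0 < k)%N.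
  rewrite -has_count; apply/hasP; exists 1%:M; first by apply/hs; exact: WJ1.
  by apply/asboolP; exists 1%:M; rewrite ?mulmx1 /z ?mulmx1 ?subrK //; exact: WJ1.
apply: (Ediv k0).
have low N : ~~ B N -> WJ N -> E (S (z N)).
  move=> /asboolPn hB hN; have [M hM hd] := wdom_rep (z N).
  suff : E (S (z N *m M)) by congr E; apply: funext => t; rewrite S_mul.
  apply: IH => //.
  have [h1 h2] := weight_sub_orbit Hrd hx' hM.
  have [h3 h4] := weight_sub_orbit Hrd hdj (WJ_mul hN hM).
  have e : y - z N *m M = (x' - x' *m M) + (evec n j - evec n j *m (N *m M)).
    by rewrite /z mulmxDl mulmxA addrACA -opprD /x' subrK.
  have : 0 < ipair (y - z N *m M) rho.
    rewrite e; apply: rho_pos; [exact: posrD|exact: spanJD|rewrite -e subr_eq0].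
    by apply/eqP => ez; apply: hB; exists M.
  by rewrite ipairDl ipairNl; move: hm; move: (ipair _ _) (ipair _ _); lia.
have : E (fun t => S x' t * S (evec n j) t + - \sum_(N <- s | (N \in s) && ~~ B N) S (z N) t).
  apply: Eadd; first by apply: Emul => //; exact: Efund.
  by apply: Eopp; apply: Esum => N /andP[/hs h2 h1]; exact: low.
congr E; apply: funext => t; rewrite S_prod (bigID B) /= -big_seq_cond addrK.
rewrite -sumr_const_seq; apply: eq_bigr => N /asboolP[M hM <-].
by rewrite -/(S _ t) S_mul.
Qed.

Lemma E_prod_sum (L : seq (lat n)) x :
  E (fun t => \sum_(M <- s) a t (x *m M) * \prod_(y <- L) (1 - a t (y *m M))).
Proof.
elim: L x => [|y L IH] x.
  have := E_orbit_sum x; congr E; apply: funext => t.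
  by apply: eq_bigr => M _; rewrite big_nil mulr1.
have := Eadd (IH x) (Eopp (IH (x + y))); congr E; apply: funext => t.
rewrite -sumrB; apply: eq_bigr => M _.
by rewrite big_cons mulmxDl aD mulrA mulrBr mulr1 mulrBl.
Qed.

End Invariants.
End Enum.


(** Independence of characters with coefficients of the form additive plus constant: such
    coefficients appear when an orbit sum of characters is differentiated. *)
Lemma affine_char_indep (n : nat) (I : eqType) (K : idomainType) (s : seq I)
    (chi L : I -> lat n -> K) (c : I -> K) :
  uniq s -> (forall i x y, chi i (x + y) = chi i x * chi i y) ->
  (forall i x, chi i x != 0) -> (forall i x y, L i (x + y) = L i x + L i y) ->
  (forall i j, i \in s -> j \in s -> i != j -> exists k, chi i k != chi j k) ->
  (forall x, \sum_(i <- s) (L i x + c i) * chi i x = 0) ->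
  forall i, i \in s -> (forall x, L i x = 0) /\ c i = 0.
Proof.
move=> + chiD chi0; elim: s L c => // i0 s IH L c /= /andP[i0s us] LD dist h.
have L0 i : L i 0 = 0 by apply: (addrI (L i 0)); rewrite -LD !addr0.
(* Apply f |-> f(. + k) - chi_{i0}(k) f twice: this kills the i0 term. *)
have hs i : i \in s -> (forall x, L i x = 0) /\ c i = 0.
  move=> ins.
  have [|||k hk] := dist i i0; rewrite ?mem_head ?inE ?ins ?orbT //.
    by apply: contraNneq i0s => <-.
  pose d j := chi j k - chi i0 k.
  have hd : d i != 0 by rewrite subr_eq0.
  have := IH (fun j x => d j ^+ 2 * L j x)
    (fun j => d j ^+ 2 * c j + 2 * d j * (chi j k * L j k)) us.
  case/(_ _ _ _ i ins).
  - by move=> j x y; rewrite LD mulrDr.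
  - by move=> j1 j2 h1 h2; apply: dist; rewrite inE ?h1 ?h2 orbT.
  - move=> x.
    have := h (x + k + k); have := h (x + k); have := h x; rewrite !big_cons => e0 e1 e2.
    have e : \sum_(j <- s) (d j ^+ 2 * L j x + (d j ^+ 2 * c j + 2 * d j * (chi j k * L j k))) * chi j x =
        \sum_(j <- s) (L j (x + k + k) + c j) * chi j (x + k + k)
        - 2 * chi i0 k * (\sum_(j <- s) (L j (x + k) + c j) * chi j (x + k))
        + chi i0 k ^+ 2 * (\sum_(j <- s) (L j x + c j) * chi j x).
      rewrite !mulr_sumr -sumrB -big_split /=; apply: eq_bigr => j _.
      by rewrite !LD !chiD /d; ring.
    rewrite e.
    have -> : \sum_(j <- s) (L j (x + k + k) + c j) * chi j (x + k + k) =
       - ((L i0 (x + k + k) + c i0) * chi i0 (x + k + k)).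
      by apply/eqP; rewrite -addr_eq0 addrC e2.
    have -> : \sum_(j <- s) (L j (x + k) + c j) * chi j (x + k) =
       - ((L i0 (x + k) + c i0) * chi i0 (x + k)).
      by apply/eqP; rewrite -addr_eq0 addrC e1.
    have -> : \sum_(j <- s) (L j x + c j) * chi j x = - ((L i0 x + c i0) * chi i0 x).
      by apply/eqP; rewrite -addr_eq0 addrC e0.
    by rewrite !LD !chiD; ring.
  move=> hL hc.
  have Li x : L i x = 0.
    by have /eqP := hL x; rewrite mulf_eq0 expf_eq0 /= (negbTE hd) => /eqP.
  split=> //; move/eqP: hc; rewrite Li !mulr0 addr0 mulf_eq0 expf_eq0 /= (negbTE hd).
  by move/eqP.
move=> i; rewrite inE => /orP[/eqP->|]; last exact: hs.
have e x : L i0 x + c i0 = 0.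
  have := h x; rewrite big_cons big_seq big1 => [|j /hs[-> ->]]; last by rewrite addr0 mul0r.
  by rewrite addr0 => /eqP; rewrite mulf_eq0 (negbTE (chi0 _ _)) orbF => /eqP.
have c0 : c i0 = 0 by have := e 0; rewrite L0 add0r.
by split=> // x; have := e x; rewrite c0 addr0.
Qed.

Section Jacobian.
Variables (n l : nat) (rts : seq (lat n * lat n)) (alpha : 'I_l -> lat n).
Hypothesis Hrd : based_root_datum_sc rts alpha.
Variable J : {set 'I_l}.
Variable s : seq 'M[int]_n.
Hypothesis us : uniq s.
Hypothesis hs : forall M, M \in s <-> inWM rts alpha J M.
Notation WJ := (inWM rts alpha J).
Variable o : 'I_n -> seq (lat n).
Hypothesis uo : forall i, uniq (o i).
Hypothesis ho : forall i x, x \in o i <-> exists2 M, WJ M & x = evec n i *m M.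
Variable K : numFieldType.
Variable a : lat n -> K.
Hypothesis a0 : a 0 = 1.
Hypothesis aD : forall x y, a (x + y) = a x * a y.
Hypothesis areg : forall M, WJ M -> (forall x, a (x *m M) = a x) -> M = 1%:M.
Implicit Types (x : lat n) (y : 'rV[K]_n).

Definition lpair x y : K := \sum_k (x 0 k)%:~R * y 0 k.
Lemma lpairD x x' y : lpair (x + x') y = lpair x y + lpair x' y.
Proof. by rewrite /lpair -big_split; apply: eq_bigr => k _; rewrite mxE intrD mulrDl. Qed.
Lemma lpair_evec (k : 'I_n) y : lpair (evec n k) y = y 0 k.
Proof.
rewrite /lpair (bigD1 k) //= mxE eqxx mul1r big1 ?addr0 // => i hi.
by rewrite mxE val_eqE (negbTE hi) mul0r.
Qed.
Lemma char_neq0 x : a x != 0.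
Proof.
by apply/eqP => e; have := a0; rewrite -(subrr x) aD e mul0r => /eqP; rewrite eq_sym oner_eq0.
Qed.

(** A tangent vector [y] is a character a(x)(1 + e<x,y>) over the dual numbers. If the basis orbit
    sums do not see e, neither does any orbit sum, since all are polynomials in them. As [a] has
    trivial stabiliser, its W_J-translates are distinct characters, and their independence forces
    <x,y> = 0. *)
Lemma jacobian_inj y : (forall i, \sum_(x <- o i) lpair x y * a x = 0) -> y = 0.
Proof.
move=> hy.
have lp0 : lpair 0 y = 0 by rewrite /lpair big1 // => k _; rewrite mxE mul0r.
(* Dual numbers as upper triangular 2 by 2 matrices; [b] switches the tangent part on or off. *)
pose U (b : K) x : 'M[K]_2 := \matrix_(i, j)
  (if i == j then a x else if (i == 0) && (j == 1) then b * lpair x y * a x else 0).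
pose A (t : bool) := U (t : nat)%:R.
have A0 t : A t 0 = 1.
  apply/matrixP => i j; rewrite !mxE lp0 a0 mulr0 mul0r.
  by case: (i == j) => //; case: ifP.
have AD t x x' : A t (x + x') = A t x * A t x'.
  apply/matrixP => i j; rewrite !mxE big_ord_recl big_ord1 !mxE.
  have [-> | ->] : i = 0 \/ i = 1 by case: i => -[|[|]] // h; [left|right]; exact: val_inj.
    have [-> | ->] : j = 0 \/ j = 1 by case: j => -[|[|]] // h; [left|right]; exact: val_inj.
      by rewrite /= aD mulr0 addr0.
    by rewrite /= aD lpairD; ring.
  have [-> | ->] : j = 0 \/ j = 1 by case: j => -[|[|]] // h; [left|right]; exact: val_inj.
    by rewrite /= mulr0 mul0r addr0.
  by rewrite /= aD mul0r add0r.
pose E (f : bool -> 'M[K]_2) := f true = f false.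
have main x : \sum_(M <- s) lpair (x *m M) y * a (x *m M) = 0.
  have Efsum (r : seq (lat n)) : \sum_(x <- r) lpair x y * a x = 0 ->
      \sum_(x <- r) A true x = \sum_(x <- r) A false x.
    move=> e; apply/matrixP => i j; rewrite !summxE.
    under eq_bigr do rewrite mxE; under [RHS]eq_bigr do rewrite mxE.
    case: (i == j) => //; case: (_ && _) => //.
    under eq_bigr do rewrite mul1r; rewrite e.
    by rewrite big1 // => z _; rewrite !mul0r.
  have : E (fun t => \sum_(M <- s) A t (x *m M)).
    apply: (E_orbit_sum Hrd us hs (a := A)) => //.
    - by move=> f g; rewrite /E => -> ->.
    - by move=> f; rewrite /E => ->.
    - by move=> f g; rewrite /E => -> ->.
    - move=> f k k0; rewrite /E -!scaler_nat.
      have nz : k%:R != 0 :> K by rewrite pnatr_eq0 -lt0n.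
      by move/(can_inj (scalerK nz)).
    - move=> j hj; rewrite /E.
      have [k k0 hk] := sum_orbit Hrd us hs (uo (wo Hrd j)) (ho (wo Hrd j)).
      by rewrite (hk _ (A true)) (hk _ (A false)) Efsum.
    - move=> k hk.
      have fx M : WJ M -> evec n k *m M = evec n k.
        apply: (central_fix Hrd) => j hj.
        by rewrite (ipair_evec (wo Hrd j)) mxE /= (negbTE (hk j hj)).
      have lk : lpair (evec n k) y = 0.
        have [m m0 hm] := sum_orbit Hrd us hs (uo k) (ho k).
        have := hm _ (fun x => lpair x y * a x); rewrite hy mul0rn.
        rewrite (eq_big_seq (fun=> lpair (evec n k) y * a (evec n k))) => [|M /hs/fx-> //].
        rewrite sumr_const_seq count_predT => /eqP; rewrite mulrn_eq0 mulf_eq0.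
        rewrite (negbTE (char_neq0 _)) orbF; case/orP => [|/eqP //].
        have : 1%:M \in s by apply/hs; exact: WJ1.
        by case: (s).
      have lkN : lpair (- evec n k) y = 0.
        by apply: (addrI (lpair (evec n k) y)); rewrite -lpairD subrr lp0 lk addr0.
      have h1 u : lpair u y = 0 -> A true u = A false u.
        by move=> e; have := Efsum [:: u]; rewrite !big_seq1 e mul0r; apply.
      by split; exact: h1.
  move/(congr1 (fun B : 'M[K]_2 => B 0 1)); rewrite !summxE.
  under eq_bigr do rewrite mxE /= mul1r.
  by move=> ->; rewrite big1 // => M _; rewrite mxE /= !mul0r.
have [] := @affine_char_indep n _ K s (fun M x => a (x *m M)) (fun M x => lpair (x *m M) y)
  (fun=> 0) us _ _ _ _ _ 1%:M.
- by move=> M x x'; rewrite mulmxDl aD.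
- by move=> M x; exact: char_neq0.
- by move=> M x x'; rewrite mulmxDl lpairD.
- move=> M N /hs hM /hs hN ne; apply: contrapT => hn.
  have uN := WJ_unit Hrd hN; move/eqP: ne; apply.
  suff e : invmx N *m M = 1%:M by rewrite -[M](mulKVmx uN) e mulmx1.
  apply: areg; first by apply: WJ_mul => //; exact: (WJ_inv Hrd).
  move=> x; rewrite mulmxA; apply/eqP; apply: contraT => hk; case: hn.
  by exists (x *m invmx N); rewrite mulmxKV.
- by move=> x; under eq_bigr do rewrite addr0; exact: main.
- by apply/hs; exact: WJ1.
move=> h _; apply/rowP => k; rewrite mxE -lpair_evec.
by have := h (evec n k); rewrite mulmx1.
Qed.

Lemma jacobian_surj (e : 'I_n -> K) : exists y, forall i, \sum_(x <- o i) lpair x y * a x = e i.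
Proof.
pose A : 'M[K]_n := \matrix_(k, i) \sum_(x <- o i) (x 0 k)%:~R * a x.
have AE y i : (y *m A) 0 i = \sum_(x <- o i) lpair x y * a x.
  rewrite mxE; under eq_bigr do rewrite mxE mulr_sumr.
  rewrite exchange_big; apply: eq_bigr => x _ /=; rewrite /lpair mulr_suml.
  by apply: eq_bigr => k _; rewrite mulrCA mulrA.
have uA : A \in unitmx.
  rewrite -row_free_unit -kermx_eq0; apply/rowV0P => v /sub_kermxP hv.
  by apply: jacobian_inj => i; rewrite -AE hv mxE.
exists ((\row_i e i) *m invmx A) => i.
by rewrite -AE mulmxKV // mxE.
Qed.

End Jacobian.

(** * The complex exponential *)


Definition cs (r : R) : R := cos (2 * PI * r).
Definition sn (r : R) : R := sin (2 * PI * r).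
Arguments cs r%_ring_scope.
Arguments sn r%_ring_scope.

Lemma csD (r t : R) : cs (r + t) = cs r * cs t - sn r * sn t.
Proof. by rewrite /cs -RplusE Raxioms.Rmult_plus_distr_l cos_plus. Qed.
Lemma snD (r t : R) : sn (r + t) = sn r * cs t + cs r * sn t.
Proof. by rewrite /sn -RplusE Raxioms.Rmult_plus_distr_l sin_plus. Qed.
Lemma cs0 : cs 0 = 1. Proof. by rewrite /cs RIneq.Rmult_0_r cos_0. Qed.
Lemma sn0 : sn 0 = 0. Proof. by rewrite /sn RIneq.Rmult_0_r sin_0. Qed.
Lemma cs1 : cs 1 = 1. Proof. by rewrite /cs RIneq.Rmult_1_r cos_2PI. Qed.
Lemma sn1 : sn 1 = 0. Proof. by rewrite /sn RIneq.Rmult_1_r sin_2PI. Qed.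
Lemma csN (r : R) : cs (- r) = cs r.
Proof. by rewrite /cs -RoppE RIneq.Ropp_mult_distr_r_reverse cos_neg. Qed.
Lemma snN (r : R) : sn (- r) = - sn r.
Proof. by rewrite /sn -RoppE RIneq.Ropp_mult_distr_r_reverse sin_neg. Qed.
Lemma cs_int (k : int) : cs k%:~R = 1 /\ sn k%:~R = 0.
Proof.
have h (m : nat) : cs m%:R = 1 /\ sn m%:R = 0.
  elim: m => [|m [IH1 IH2]]; first by rewrite cs0 sn0.
  by rewrite -natr1 csD snD IH1 IH2 cs1 sn1; split; ring.
case: (intP k) => [|m|m]; [exact: (h 0%N)|exact: h|].
have [h1 h2] := h m.+1.
by rewrite mulrNz csN snN -[_%:~R]/(m.+1%:R) h1 h2 oppr0.
Qed.

(* e^s e^{2 pi i r} *)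
Definition expo (r s : R) : CC := (exp s * cs r +i* (exp s * sn r))%C.
Arguments expo (r s)%_ring_scope.

Lemma expo_gt0 (s : R) : 0 < exp s. Proof. by apply/RltP; exact: exp_pos. Qed.
Lemma expD (s t : R) : exp (s + t)%R = exp s * exp t. Proof. exact: exp_plus. Qed.
Lemma expoD r s r' s' : expo (r + r') (s + s') = expo r s * expo r' s'.
Proof.
rewrite /expo csD snD expD; apply/eqP; rewrite eq_complex /=; apply/andP; split; apply/eqP; ring.
Qed.
Lemma expo_int (k : int) : expo k%:~R 0 = 1.
Proof.
by rewrite /expo; have [-> ->] := cs_int k; rewrite exp_0 mulr1 mulr0.
Qed.
Lemma expo0 : expo 0 0 = 1. Proof. exact: (expo_int 0). Qed.
Lemma expo_neq0 r s : expo r s != 0.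
Proof.
apply/eqP => h; have : expo (r + - r) (s + - s) = 0 by rewrite expoD h mul0r.
by rewrite !subrr expo0 => /eqP; rewrite oner_eq0.
Qed.
(** For the fractional part f of r, vanishing of the sine leaves 2 pi f among 0, pi and 2 pi. The
    value pi gives a negative real number, and 2 pi contradicts f < 1. *)
Lemma expo_eq1 r s : expo r s = 1 -> s = 0 /\ exists k : int, r = k%:~R.
Proof.
move=> h; pose k := Num.floor r; pose f := r - k%:~R.
have /andP[k1 k2] := Num.Theory.floor_itv r.
have f0 : 0 <= f by rewrite subr_ge0.
have f1 : f < 1 by rewrite ltrBlDl; rewrite intrD in k2.
have : expo f s = 1.
  have -> : expo f s = expo r s * expo (- k)%:~R 0 by rewrite -expoD mulrNz addr0.
  by rewrite expo_int mulr1.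
move/eqP; rewrite eq_complex /= => /andP[/eqP e1 /eqP e2].
have e0 := expo_gt0 s.
have sf : sn f = 0.
  by apply/eqP; have /eqP := e2; rewrite mulf_eq0 (gt_eqF e0).
have PI0 : 0 < (PI : R) by apply/RltP; exact: PI_RGT_0.
have tE : Rmult (Rmult 2 PI) f = 2 * PI * f :> R by [].
have [] : Rmult (Rmult 2 PI) f = 0 \/ Rmult (Rmult 2 PI) f = PI \/ Rmult (Rmult 2 PI) f = Rmult 2 PI.
  apply: sin_eq_O_2PI_0; last exact: sf.
    apply/RleP; rewrite tE; apply: mulr_ge0 => //; apply: mulr_ge0; [exact: ler0n|exact: ltW].
  by apply/RleP; rewrite tE -[X in _ <= X]/(2 * (PI : R)); move: (PI : R) PI0 => P P0; nra.
- rewrite tE => h0.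
  have f00 : f = 0 by move: h0; move: (PI : R) PI0 => P; nra.
  move: e1; rewrite f00 cs0 mulr1 => e1; split.
    by apply: exp_inv; rewrite exp_0.
  by exists k; apply/eqP; rewrite -subr_eq0 -/f f00.
- case=> hh; exfalso.
    by move: e1; rewrite /cs hh cos_PI -[IZR _]/(-1 : R) mulrN1; lra.
  move: hh; rewrite tE -[X in _ = X -> _]/(2 * (PI : R)); move: (PI : R) PI0 => P P0; nra.
Qed.
Lemma expo_surj (z : CC) : z != 0 -> exists r s, z = expo r s.
Proof.
case: z => a b; rewrite eq_complex /= => nz.
pose N : R := Num.sqrt (a ^+ 2 + b ^+ 2).
have sq0 : 0 < a ^+ 2 + b ^+ 2.
  rewrite lt_neqAle eq_sym paddr_eq0 ?sqr_ge0 // !sqrf_eq0 nz /=.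
  by rewrite addr_ge0 ?sqr_ge0.
have N0 : 0 < N by rewrite sqrtr_gt0.
have N2 : N ^+ 2 = a ^+ 2 + b ^+ 2 by rewrite sqr_sqrtr // ltW.
have eN : exp (ln N) = N by apply: exp_ln; apply/RltP.
pose c := a / N.
have c1 : c ^+ 2 + (b / N) ^+ 2 = 1.
  by rewrite /c !expr_div_n -mulrDl -N2 divff // expf_neq0 // gt_eqF.
have cb : -1 <= c <= 1.
  by rewrite -ler_norml -(@expr_le1 _ 2) // real_normK ?num_real //; have := sqr_ge0 (b / N); lra.
have [t ht] : exists t, cos t = c /\ sin t = b / N.
  have cbR : (Rle (Ropp 1) c /\ Rle c 1)%type by case/andP: cb => h1 h2; split; apply/RleP.
  have e1 := cos_acos c cbR; have e2 := sin_acos c cbR.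
  have e3 : sin (acos c) = `|b / N|.
    rewrite e2 RsqrtE -sqrtr_sqr; congr Num.sqrt.
    by rewrite -[Rminus _ _]/(1 - c * c) -expr2; lra.
  case: (lerP 0 (b / N)) => hb; first by exists (acos c); rewrite e1 e3 ger0_norm.
  by exists (Ropp (acos c)); rewrite cos_neg sin_neg e1 e3 RoppE ltr0_norm // opprK.
have PI0 : 2 * (PI : R) != 0.
  by rewrite mulf_neq0 // gt_eqF //; apply/RltP; exact: PI_RGT_0.
exists (t / (2 * PI)), (ln N).
have et : Rmult (Rmult 2 PI) (t / (2 * PI))%R = t.
  by rewrite -[LHS]/(2 * (PI : R) * (t / (2 * PI))) mulrC divfK.
rewrite /expo /cs /sn et eN; case: ht => -> ->; rewrite /c.
by rewrite ![N * _]mulrC !divfK // gt_eqF.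
Qed.
Lemma expiE (q : rat) : expi q = expo (ratr q) 0.
Proof. by rewrite /expi /expo /cs /sn exp_0 !mul1r. Qed.
Lemma expi_eq1 (q : rat) : expi q = 1 -> denq q = 1.
Proof.
rewrite expiE => /expo_eq1[_ [k hk]].
have : ratr q = ratr k%:~R :> R by rewrite hk ratr_int.
by move/(fmorph_inj _) => ->; rewrite denq_int.
Qed.

(** * Puiseux series: valuations and leading coefficients *)


Lemma denq1_int (q : rat) : denq q == 1 -> exists z : int, q = z%:~R.
Proof. by move=> /eqP h; exists (numq q); rewrite -[LHS]divq_num_den h divr1. Qed.

Lemma sum_cover (T : eqType) (V : nmodType) (F : T -> V) (s1 s2 : seq T) :
  uniq s1 -> uniq s2 -> (forall r, r \in s1 -> F r != 0 -> r \in s2) ->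
  (forall r, r \in s2 -> F r != 0 -> r \in s1) ->
  \sum_(r <- s1) F r = \sum_(r <- s2) F r.
Proof.
move=> u1 u2 h1 h2.
have red s : \sum_(r <- s) F r = \sum_(r <- [seq r <- s | F r != 0]) F r.
  rewrite big_filter [LHS](bigID (fun r => F r != 0)) /= [X in _ + X]big1 ?addr0 //.
  by move=> r; rewrite negbK => /eqP.
rewrite red [RHS]red; apply: perm_big; apply: uniq_perm; rewrite ?filter_uniq // => r.
rewrite !mem_filter; case: (eqVneq (F r) 0) => //= nz.
by apply/idP/idP => /[dup] hr; [move/h1|move/h2]; apply.
Qed.

Section Puiseux.
Implicit Types (f g h : Pui) (q r v : rat) (N : nat) (m : int).

Lemma supp_in_mul f N N' m : supp_in f N m -> (0 < N')%N -> supp_in f (N * N') m.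
Proof.
move=> h N0 q /h/andP[/denq1_int[z hz] ->]; rewrite andbT.
have -> : q *+ (N * N') = (z * N'%:Z)%:~R by rewrite mulrnA hz intrM mulr_natr.
by rewrite denq_int.
Qed.
Lemma supp_in_common f g : is_pui f -> is_pui g -> exists N m1 m2,
  [/\ (0 < N)%N, supp_in f N m1 & supp_in g N m2].
Proof.
move=> [N1 [m1 [N10 h1]]] [N2 [m2 [N20 h2]]]; exists (N1 * N2)%N, m1, m2; split.
- by rewrite muln_gt0 N10.
- exact: supp_in_mul.
- by rewrite mulnC; exact: supp_in_mul.
Qed.

Definition grid N m q' := [seq m%:~R + j%:R / N%:R : rat | j <- iota 0 (Num.truncn q').+1].
Lemma grid_uniq N m q' : (0 < N)%N -> uniq (grid N m q').
Proof.
move=> N0; rewrite map_inj_uniq ?iota_uniq // => i j /addrI.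
have nz : (N%:R : rat)^-1 != 0 by rewrite invr_eq0 pnatr_eq0 -lt0n.
by move/(mulIf nz)/eqP; rewrite eqr_nat => /eqP.
Qed.
Lemma grid_cover f g N m1 m2 q r : (0 < N)%N -> supp_in f N m1 -> supp_in g N m2 ->
  f r * g (q - r) != 0 -> r \in grid N m1 ((q - m1%:~R - m2%:~R) *+ N).
Proof.
move=> N0 hf hg; rewrite mulf_eq0 negb_or => /andP[/hf/andP[/denq1_int[z hz] h1] /hg/andP[_ h2]].
have Np : 0 < (N%:R : rat) by rewrite ltr0n.
have hzm : m1 * N%:Z <= z.
  by rewrite -(ler_int rat) -hz intrM -[_ *+ N]mulr_natr ler_pM2r.
pose j := absz (z - m1 * N%:Z)%R.
have jE : j%:R = r *+ N - m1%:~R * N%:R :> rat.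
  by rewrite /j natr_absz ger0_norm ?subr_ge0 // intrB hz intrM.
apply/mapP; exists j; last first.
  by rewrite jE -[r *+ N]mulr_natr -mulrBl mulfK ?gt_eqF // addrC subrK.
rewrite mem_iota add0n leq0n ltnS /=.
have h : j%:R <= (q - m1%:~R - m2%:~R) *+ N.
  rewrite jE -[r *+ N]mulr_natr -[leRHS]mulr_natr -mulrBl ler_pM2r //; lra.
by rewrite truncn_ge_nat //; apply: le_trans h; rewrite ler0n.
Qed.

(** Frees Cauchy products from the choice of a grid: any list containing all exponents that
    contribute gives the same sum. *)
Lemma sum_grid f g N m1 m2 q (rs : seq rat) : (0 < N)%N -> supp_in f N m1 -> supp_in g N m2 ->
  uniq rs -> (forall r, f r != 0 -> g (q - r) != 0 -> r \in rs) ->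
  \sum_(j < (Num.truncn ((q - m1%:~R - m2%:~R) *+ N)).+1)
     f (m1%:~R + j%:R / N%:R) * g (q - (m1%:~R + j%:R / N%:R)) =
  \sum_(r <- rs) f r * g (q - r).
Proof.
move=> N0 hf hg urs hr.
rewrite -(big_mkord xpredT (fun j => f (m1%:~R + j%:R / N%:R) * g (q - (m1%:~R + j%:R / N%:R)))).
rewrite /index_iota subn0.
have -> : \sum_(i <- iota 0 (Num.truncn ((q - m1%:~R - m2%:~R) *+ N)).+1)
   f (m1%:~R + i%:R / N%:R) * g (q - (m1%:~R + i%:R / N%:R)) =
   \sum_(r <- grid N m1 ((q - m1%:~R - m2%:~R) *+ N)) f r * g (q - r) by rewrite big_map.
apply: sum_cover => //; first exact: grid_uniq.
  by move=> r _; rewrite mulf_eq0 negb_or => /andP[h1 h2]; exact: hr.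
by move=> r _; exact: grid_cover.
Qed.

Lemma pprod_sum f g h q (rs : seq rat) : is_pui f -> is_pui g -> pprod f g h -> uniq rs ->
  (forall r, f r != 0 -> g (q - r) != 0 -> r \in rs) -> h q = \sum_(r <- rs) f r * g (q - r).
Proof.
move=> pf pg hp urs hr; have [N [m1 [m2 [N0 hf hg]]]] := supp_in_common pf pg.
by rewrite (hp N m1 m2 N0 hf hg q) (sum_grid N0 hf hg urs hr).
Qed.

Lemma pprod_intro f g h :
  (forall q, exists2 rs, uniq rs & (forall r, f r != 0 -> g (q - r) != 0 -> r \in rs) /\
     h q = \sum_(r <- rs) f r * g (q - r)) -> pprod f g h.
Proof.
move=> H N m1 m2 N0 hf hg q; have [rs urs [hr ->]] := H q.
by rewrite (sum_grid N0 hf hg urs hr).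
Qed.

Lemma pval_uniq f v v' : pval f v -> pval f v' -> v = v'.
Proof. by move=> [h1 h2] [h3 h4]; have := h2 _ h3; have := h4 _ h1; lra. Qed.

Lemma pval_exists f : is_pui f -> (exists q, f q != 0) -> exists v, pval f v.
Proof.
move=> [N [m [N0 hf]]] [q0 hq0].
have Np : 0 < (N%:R : rat) by rewrite ltr0n.
have idx q : f q != 0 -> exists j : nat, q = m%:~R + j%:R / N%:R.
  move=> /hf/andP[/denq1_int[z hz] h1].
  have hzm : m * N%:Z <= z.
    by rewrite -(ler_int rat) -hz intrM -[_ *+ N]mulr_natr ler_pM2r.
  exists (absz (z - m * N%:Z)%R); rewrite natr_absz ger0_norm ?subr_ge0 // intrB -hz intrM.
  by rewrite -[q *+ N]mulr_natr -mulrBl mulfK ?gt_eqF // addrC subrK.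
have ex : exists j : nat, f (m%:~R + j%:R / N%:R) != 0.
  by have [j e] := idx _ hq0; exists j; rewrite -e.
case: (ex_minnP ex) => j hj hmin; exists (- (m%:~R + j%:R / N%:R)).
split; rewrite opprK // => q hq; have [i e] := idx _ hq; rewrite e in hq *.
by rewrite lerD2l ler_pM2r ?invr_gt0 // ler_nat; exact: hmin.
Qed.

Lemma pprod_lead f g h v w : is_pui f -> is_pui g -> pprod f g h -> pval f v -> pval g w ->
  pval h (v + w) /\ h (- (v + w)) = f (- v) * g (- w).
Proof.
move=> pf pg hp [f0 fm] [g0 gm].
have e : h (- (v + w)) = f (- v) * g (- w).
  rewrite (pprod_sum (rs := [:: - v]) pf pg hp) // ?big_seq1.
    by congr (_ * g _); ring.
  move=> r /fm h1 /gm h2; rewrite inE; apply/eqP; lra.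
split=> //; split; first by rewrite e mulf_neq0.
move=> q; apply: contraNT; rewrite -ltNge => lt; apply/eqP.
rewrite (pprod_sum (rs := [::]) pf pg hp) ?big_nil // => r /fm h1 /gm h2; exfalso; clear -h1 h2 lt; lra.
Qed.

End Puiseux.

Section Lead.
Variable n : nat.
Implicit Types (x y : lat n) (w : 'rV[rat]_n) (a : lat n -> Pui).

Definition qpair x w : rat := \sum_k (x 0 k)%:~R * w 0 k.
Lemma qpairD x y w : qpair (x + y) w = qpair x w + qpair y w.
Proof. by rewrite /qpair -big_split; apply: eq_bigr => k _; rewrite mxE intrD mulrDl. Qed.
Lemma qpair0 w : qpair 0 w = 0.
Proof. by rewrite /qpair big1 // => k _; rewrite mxE mul0r. Qed.
Definition toR w : avec n := map_mx ratr w.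
Lemma rpair_toR x w : rpair x (toR w) = ratr (qpair x w).
Proof.
rewrite /rpair /qpair rmorph_sum; apply: eq_bigr => k _.
by rewrite mxE rmorphM /= ratr_int.
Qed.

Definition hasval a w := forall x, pval (a x) (qpair x w).
Definition lead a w x : CC := a x (- qpair x w).

Lemma additive_qpair (f : lat n -> rat) : (forall x y, f (x + y) = f x + f y) ->
  exists w, forall x, f x = qpair x w.
Proof.
move=> fD; exists (\row_k f (evec n k)) => x.
have f0 : f 0 = 0 by apply: (addrI (f 0)); rewrite -fD !addr0.
have fN y : f (- y) = - f y by apply: (addrI (f y)); rewrite -fD !subrr f0.
have fn y (k : nat) : f (y *+ k) = k%:R * f y.
  elim: k => [|k IH]; first by rewrite mulr0n f0 mul0r.
  by rewrite mulrS fD IH -add1n natrD mulrDl mul1r.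
have fZ (m : int) y : f (m *: y) = m%:~R * f y.
  have sZ (k : nat) : k%:Z *: y = y *+ k by rewrite -[RHS]scaler_nat natz.
  case: (intP m) => [|k|k]; first by rewrite scale0r f0 mul0r.
    by rewrite sZ fn.
  by rewrite scaleNr fN sZ fn mulrNz mulNr.
rewrite {1}(lat_expand x).
rewrite /qpair (big_morph f fD f0); apply: eq_bigr => k _.
by rewrite fZ mxE.
Qed.

(** Each series [a x] is nonzero because its product with [a (- x)] is 1; valuations add, so they
    come from a rational cocharacter. *)
Lemma isA_hasval a : isA a -> exists w, hasval a w.
Proof.
move=> [hp a0 aM].
have ex x : exists v, pval (a x) v.
  apply: pval_exists => //; apply: contrapT => hn.
  have z q : a x q = 0.
    by apply/eqP; apply: contraT => h; case: hn; exists q.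
  have := pprod_sum (rs := [::]) (q := 0) (hp x) (hp (- x)) (aM x (- x)).
  rewrite subrr a0 /pone eqxx big_nil => /(_ isT) h.
  have /eqP : (1 : CC) = 0 by apply: h => r; rewrite z eqxx.
  by rewrite oner_eq0.
pose v x := projT1 (cid (ex x)).
have hv x : pval (a x) (v x) by rewrite /v; case: cid.
have [|w hw] := @additive_qpair v.
  move=> x y; have [h _] := pprod_lead (hp x) (hp y) (aM x y) (hv x) (hv y).
  exact: pval_uniq h.
by exists w => x; rewrite -hw.
Qed.

Lemma leadD a w x y : isA a -> hasval a w -> lead a w (x + y) = lead a w x * lead a w y.
Proof.
move=> [hp a0 aM] hv; rewrite /lead qpairD.
by have [_ ->] := pprod_lead (hp x) (hp y) (aM x y) (hv x) (hv y).
Qed.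
Lemma lead0 a w : isA a -> lead a w 0 = 1.
Proof. by move=> [_ a0 _]; rewrite /lead qpair0 a0 /pone oppr0 eqxx. Qed.
Lemma lead_neq0 a w x : hasval a w -> lead a w x != 0.
Proof. by move=> /(_ x)[]. Qed.
Lemma hasval_lt a w x q : hasval a w -> q < - qpair x w -> a x q = 0.
Proof.
move=> /(_ x)[_ h] lt; apply/eqP; apply: contraT => /h; rewrite leNgt lt //.
Qed.
End Lead.


Lemma fin_enum_spec (n : nat) (P : lat n -> Prop) :
  (exists s : seq (lat n), uniq s /\ forall x, x \in s <-> P x) ->
  uniq (fin_enum P) /\ forall x, x \in fin_enum P <-> P x.
Proof. exact: epsilon_spec. Qed.

(** * The quotient map on Puiseux points: lowest terms, descent, valuations *)

Section Chevalley.
Variables (n l : nat) (rts : seq (lat n * lat n)) (alpha : 'I_l -> lat n).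
Hypothesis Hrd : based_root_datum_sc rts alpha.
Implicit Types (x y : lat n) (w : 'rV[rat]_n) (a : lat n -> Pui) (M G H : 'M[int]_n).
Implicit Types (J : {set 'I_l}).
Notation WG := (inWG rts).
Notation WJ := (inWM rts alpha).

Definition oJ J x := fin_enum (fun y => exists2 M, WJ J M & y = x *m M).
Lemma oJ_spec J x : uniq (oJ J x) /\ forall y, y \in oJ J x <-> exists2 M, WJ J M & y = x *m M.
Proof.
apply: fin_enum_spec; have [s us hs] := WJ_enum Hrd J.
exists (undup [seq x *m M | M <- s]); split; first exact: undup_uniq.
move=> y; rewrite mem_undup; split=> [/mapP[M /hs hM ->]|[M /hs hM ->]]; first by exists M.
exact: map_f.
Qed.
Lemma oJ_perm J x G : WJ J G -> perm_eq [seq u *m G | u <- oJ J x] (oJ J x).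
Proof.
move=> hG; have [uo ho] := oJ_spec J x; have uG := WJ_unit Hrd hG.
apply: uniq_perm => //; first by rewrite map_inj_uniq //; exact: can_inj (mulmxK uG).
move=> u; apply/mapP/idP => [[u' /ho[M hM ->] ->]|/ho[M hM ->]].
  by apply/ho; exists (M *m G); rewrite ?mulmxA //; exact: WJ_mul.
exists (x *m (M *m invmx G)); last by rewrite mulmxA mulmxKV.
by apply/ho; exists (M *m invmx G) => //; apply: WJ_mul => //; exact: (WJ_inv Hrd).
Qed.
Definition oG x := fin_enum (orbitW rts x).
Lemma oG_spec x : uniq (oG x) /\ forall y, y \in oG x <-> orbitW rts x y.
Proof.
apply: fin_enum_spec; have [u h] := oJ_spec setT x.
exists (oJ setT x); split=> // y; split=> [/h[M /WJ_WG hM ->]|[M [hM ->]]]; first by exists M.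
by apply/h; exists M => //; exact: WG_WJ.
Qed.
Lemma cmapE a i q : cmap rts a i q = \sum_(x <- oG (evec n i)) a x q.
Proof. by []. Qed.

Lemma evec_dom (i : 'I_n) (j : 'I_l) : 0 <= ipair (evec n i) (evec n j).
Proof. by rewrite (ipair_evec (wo Hrd j)) mxE ler0n. Qed.

Definition facet J (v : avec n) := (forall j, j \notin J -> 0 < rpair (alpha j) v) /\
  (forall j, j \in J -> rpair (alpha j) v = 0).

Lemma facet_of (v : avec n) : (forall j, 0 <= rpair (alpha j) v) ->
  facet [set j | rpair (alpha j) v == 0] v.
Proof.
move=> h; split=> j; rewrite inE; last by move/eqP.
by move=> ne; rewrite lt_neqAle eq_sym ne h.
Qed.

Lemma orbit_val J w (i : 'I_n) x : facet J (toR w) -> x \in oG (evec n i) ->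
  qpair x w <= qpair (evec n i) w /\
  (qpair x w = qpair (evec n i) w <-> x \in oJ J (evec n i)).
Proof.
move=> [f1 f0] /(oG_spec _).2[M [hM ->]].
have [h1 h2] := weight_orbit_face Hrd f1 f0 (evec_dom i) hM.
rewrite rpairBl !rpair_toR in h1 h2; split; first by rewrite -(ler_rat R) -subr_ge0.
split=> [e|].
  move: h2; rewrite e subrr => /(_ erefl)[N hN e'].
  by apply/(oJ_spec _ _).2; exists N.
move=> /(oJ_spec _ _).2[N hN ->]; apply: (fmorph_inj (ratr : {rmorphism rat -> R})).
by rewrite /= -!rpair_toR -rpair_ract (WJ_fix Hrd f0 hN).
Qed.

(** Larger valuation means lower exponent, so at the lowest exponent only the W_J-orbit of the basis
    weight contributes. *)
Lemma cmap_lead J a w (i : 'I_n) : hasval a w -> facet J (toR w) ->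
  cmap rts a i (- qpair (evec n i) w) = \sum_(x <- oJ J (evec n i)) lead a w x.
Proof.
move=> hv hf; rewrite cmapE.
transitivity (\sum_(x <- oJ J (evec n i)) a x (- qpair (evec n i) w)).
  apply: sum_cover.
  - exact: (oG_spec _).1.
  - exact: (oJ_spec _ _).1.
  - move=> x hx nz; have [le hiff] := orbit_val hf hx; apply/hiff/eqP.
    rewrite eq_le le /= leNgt; apply: contraNN nz => lt.
    by rewrite (hasval_lt hv) // ltrN2.
  - move=> x /(oJ_spec _ _).2[M hM ->] _; apply/(oG_spec _).2; exists M; split=> //.
    exact: WJ_WG hM.
apply: eq_big_seq => x hx; rewrite /lead; congr (a x (- _)); apply/esym.
have hx' : x \in oG (evec n i).
  have /(oJ_spec _ _).2[M hM ->] := hx; apply/(oG_spec _).2; exists M; split=> //.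
  exact: WJ_WG hM.
by have [_ [_ ->]] := orbit_val hf hx'.
Qed.

Lemma cmap_lt J a w (i : 'I_n) q : hasval a w -> facet J (toR w) -> q < - qpair (evec n i) w ->
  cmap rts a i q = 0.
Proof.
move=> hv hf lt; rewrite cmapE big_seq big1 // => x hx; have [le _] := orbit_val hf hx.
by rewrite (hasval_lt hv) //; apply: lt_le_trans lt _; rewrite lerN2.
Qed.

Lemma oJ_central J (i : 'I_n) : (forall j, j \in J -> nat_of_ord j != i) -> oJ J (evec n i) = [:: evec n i].
Proof.
move=> h; have [u ho] := oJ_spec J (evec n i).
have fx M : WJ J M -> evec n i *m M = evec n i.
  apply: (central_fix Hrd) => j hj.
  by rewrite (ipair_evec (wo Hrd j)) mxE /= (negbTE (h j hj)).
apply: perm_small_eq => //; apply: uniq_perm => // y; rewrite inE.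
apply/idP/eqP => [/ho[M /fx -> ->]//|->]; apply/ho.
by exists 1%:M; rewrite ?mulmx1 //; exact: WJ1.
Qed.

Lemma orbit_perm x G : WG G -> perm_eq [seq y *m G | y <- oG x] (oG x).
Proof.
move=> hG; have [u ho] := oG_spec x; have uG := WG_unit Hrd hG.
have um : uniq [seq y *m G | y <- oG x] by rewrite map_inj_uniq //; exact: can_inj (mulmxK uG).
apply: uniq_perm => // y; apply/mapP/idP => [[z /ho[M [hM ->]] ->]|/ho[M [hM ->]]].
  by apply/ho; exists (M *m G); rewrite mulmxA; split=> //; exact: WG_mul.
exists (x *m (M *m invmx G)); last by rewrite -!mulmxA mulVmx // mulmx1.
by apply/ho; exists (M *m invmx G); split=> //; apply: WG_mul => //; exact: (WG_inv Hrd).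
Qed.
Lemma cmap_act a G : WG G -> cmap rts (fun x => a (x *m G)) = cmap rts a.
Proof.
move=> hG; apply: funext => i; apply: funext => q; rewrite !cmapE.
by rewrite -[RHS](perm_big _ (orbit_perm (evec n i) hG)) big_map.
Qed.
Lemma isA_act a G : isA a -> isA (fun x => a (x *m G)).
Proof.
move=> [h1 h2 h3]; split=> // [|x y]; first by rewrite mul0mx.
by rewrite mulmxDl; exact: h3.
Qed.

Lemma expi_neq0 q : expi q != 0. Proof. by rewrite expiE expo_neq0. Qed.

Lemma sigma_coef a h x q : sigmaA a = actT h a -> a (x *m invmx h) q = expi q * a x q.
Proof. by move=> /(congr1 (fun f => f x q)). Qed.

Lemma sigma_val a w h x : hasval a w -> sigmaA a = actT h a ->
  qpair (x *m invmx h) w = qpair x w.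
Proof.
move=> hv hs; apply: (pval_uniq (hv _)).
have [h1 h2] := hv x; split; first by rewrite (sigma_coef _ _ hs) mulf_neq0 // expi_neq0.
by move=> q; rewrite (sigma_coef _ _ hs) mulf_eq0 negb_or => /andP[_]; exact: h2.
Qed.

(** The Galois generator rescales coefficients without moving exponents, so the Weyl element fixes
    [w] and lies in its stabiliser W_J. *)
Lemma sigma_stab J a w h : hasval a w -> facet J (toR w) -> WG h ->
  sigmaA a = actT h a -> WJ J (invmx h).
Proof.
move=> hv [f1 f0] hh hs; apply: (stab_dominant Hrd f0 f1); first exact: (WG_inv Hrd).
by apply: rpair_inj => x; rewrite rpair_ract !rpair_toR (sigma_val _ hv hs).
Qed.

Lemma sigma_lead a w h x : hasval a w -> sigmaA a = actT h a ->
  lead a w (x *m invmx h) = expi (- qpair x w) * lead a w x.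
Proof. by move=> hv hs; rewrite /lead (sigma_val _ hv hs) (sigma_coef _ _ hs). Qed.

(** Descent to F: the orbit sum is Weyl invariant, hence Galois invariant, so a nonzero coefficient
    at exponent q forces exp(2 pi i q) = 1. *)
Lemma cmap_integral a h i q : WG h -> sigmaA a = actT h a -> cmap rts a i q != 0 -> denq q = 1.
Proof.
move=> hh hs nz; apply: expi_eq1.
have e : expi q * cmap rts a i q = cmap rts a i q.
  rewrite -[in RHS](cmap_act a (WG_inv Hrd hh)) !cmapE mulr_sumr.
  by apply: eq_bigr => x _; rewrite (sigma_coef _ _ hs).
by apply: (mulIf nz); rewrite e mul1r.
Qed.

(** The orbit point closest to the interior point [p0] is dominant: reflecting away a negative
    simple root value would bring it closer. *)
Lemma dominant_rep (v : avec n) : exists2 G, WG G & forall j, 0 <= rpair (alpha j) (ract G v).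
Proof.
have [s us hs] := WJ_enum Hrd setT.
pose f M := rform rts (ract M v - p0 rts alpha setT) (ract M v - p0 rts alpha setT).
have [] := @seq_argmin _ s (fun=> True) f; first by exists 1%:M => //; apply/hs; exact: WJ1.
move=> G [/hs hG _ hmin]; exists G; first exact: WJ_WG hG.
move=> j; have hp : posJ rts alpha setT (alpha j, evec n j).
  by split; [apply: (RJ_simple Hrd); rewrite inE|exact: posr_simple].
have /andP[a1 _] := alcv_p0 Hrd hp.
have hM2 : WJ setT (sr alpha j *m G) by apply: WJ_mul => //; apply: (WJ_sr Hrd); rewrite inE.
have := hmin _ ((hs _).2 hM2) I; rewrite /f -ractM ract_sr.
have := @rform_refl_dist _ _ _ _ Hrd setT (alpha j, evec n j) (ract G v) 0 (simple_in Hrd j).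
rewrite /= !subr0 => ->.
have := rform_coroot_gt0 (root_pair2 Hrd) (simple_in Hrd j) => /= gp.
by rewrite lerDl -mulrA pmulr_lge0 // mulr_gt0.
Qed.

(** For i outside J the lowest coefficient of c_i(a) is a single nonzero character value, so [w] is
    at most [w'] at i; symmetrically outside J'. A case check on J and J' then shows that the
    difference d has d_j <alpha_j, d> <= 0 for every simple root, so its square length is
    nonpositive, while d lies in the span of the coroots. *)
Lemma dominant_val_uniq J J' a a' w w' : hasval a w -> hasval a' w' ->
  facet J (toR w) -> facet J' (toR w') -> cmap rts a = cmap rts a' -> w = w'.
Proof.
move=> hv hv' hf hf' ec.
have le1 (K K' : {set 'I_l}) b b' u u' (i : 'I_n) : hasval b u -> hasval b' u' ->
    facet K (toR u) -> facet K' (toR u') -> cmap rts b = cmap rts b' ->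
    (forall j, j \in K -> nat_of_ord j != i) -> u 0 i <= u' 0 i.
  move=> h1 h2 f1 f2 e hi; have := cmap_lead i h1 f1.
  rewrite (oJ_central hi) big_seq1 e => e2.
  have qe z : qpair (evec n i) z = z 0 i.
    rewrite /qpair (bigD1 i) //= mxE eqxx mul1r big1 ?addr0 // => k ki.
    by rewrite mxE val_eqE (negbTE ki) mul0r.
  rewrite leNgt; apply/negP => lt; have := lead_neq0 (evec n i) h1.
  by rewrite -e2 (cmap_lt h2 f2) ?eqxx // !qe ltrN2.
pose d := toR w - toR w'.
have d1 (i : 'I_n) : (forall j, j \in J -> nat_of_ord j != i) -> d 0 i <= 0.
  by move=> hi; rewrite !mxE subr_le0 ler_rat; apply: (le1 J J' a a').
have d2 (i : 'I_n) : (forall j, j \in J' -> nat_of_ord j != i) -> 0 <= d 0 i.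
  by move=> hi; rewrite !mxE subr_ge0 ler_rat; apply: (le1 J' J a' a).
have woE (K : {set 'I_l}) j : j \notin K -> forall k, k \in K -> nat_of_ord k != wo Hrd j.
  by move=> hj k hk; apply: contraNneq hj => /= /val_inj <-.
have hs : suppJ [set: 'I_l] d.
  move=> i hi; suff /eqP : d 0 i == 0 :> R by [].
  by rewrite eq_le d1 ?d2 // => j _; apply: hi; rewrite inE.
have r0 : rform rts d d = 0.
  apply/eqP; rewrite eq_le rform_ge0 andbT {1}(suppJ_expand Hrd hs) rform_suml.
  apply: sumr_le0 => j _; rewrite rformZl -(pmulr_rle0 _ (ltr0Sn R 1)) mulrCA.
  have := rform_coroot (root_uniq Hrd) (root_pair2 Hrd) (root_closed Hrd) d (simple_in Hrd j).
  move=> /= ->.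
  have gp := rform_coroot_gt0 (root_pair2 Hrd) (simple_in Hrd j); rewrite /= in gp.
  rewrite mulrCA pmulr_rle0 // rpairBr.
  case: hf => f1 f0; case: hf' => f1' f0'.
  case: (boolP (j \in J)) => hj; case: (boolP (j \in J')) => hj'.
  - by rewrite f0 // f0' // subrr mulr0.
  - rewrite f0 // sub0r mulrN oppr_le0 mulr_ge0 //; first by apply: d2; exact: woE.
    exact/ltW/f1'.
  - rewrite f0' // subr0 mulr_le0_ge0 //; first by apply: d1; exact: woE.
    exact/ltW/f1.
  - have -> : d 0 (wo Hrd j) = 0; last by rewrite mul0r.
    by apply/eqP; rewrite eq_le d1 ?d2 //; exact: woE.
have d0 : d = 0.
  apply: (suppJ_nondeg Hrd hs) => j _.
  exact: (rform_eq0 r0 (simple_in Hrd j)).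
move/eqP: d0; rewrite subr_eq0 => /eqP/rowP e; apply/rowP => k.
by have := e k; rewrite !mxE => /(fmorph_inj _).
Qed.

End Chevalley.

(** * The discriminant and the monodromy of regular points *)


Section Discriminant.
Variables (n l : nat) (rts : seq (lat n * lat n)) (alpha : 'I_l -> lat n).
Hypothesis Hrd : based_root_datum_sc rts alpha.
Variables (J : {set 'I_l}) (w : 'rV[rat]_n).
Hypothesis Hf : facet alpha J (toR w).
Implicit Types (x y : lat n) (a : lat n -> Pui) (M G H : 'M[int]_n).
Notation WG := (inWG rts).
Notation WJ := (inWM rts alpha J).
Notation RJ := (RM rts alpha J).
Notation oJ := (oJ rts alpha J).

Definition good a := [/\ isA a, hasval a w & exists g, WG g /\ sigmaA a = actT g a].

Lemma is_pui_add (f g : Pui) : is_pui f -> is_pui g -> is_pui (fun q => f q + g q).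
Proof.
move=> pf pg; have [N [m1 [m2 [N0 h1 h2]]]] := supp_in_common pf pg.
exists N, (Num.min m1 m2); split=> // q; case: (eqVneq (f q) 0) => [->|/h1/andP[-> h]].
  by rewrite add0r => /h2/andP[-> h] /=; apply: le_trans h; rewrite ler_int ge_min lexx orbT.
by move=> _ /=; apply: le_trans h; rewrite ler_int ge_min lexx.
Qed.
Lemma is_pui0 : is_pui (fun=> 0).
Proof. by exists 1%N, 0; split=> // q; rewrite eqxx. Qed.

Lemma central_idx (i : 'I_n) : (l <= i)%N -> forall j : 'I_l, j \in J -> nat_of_ord j != i.
Proof. by move=> hi j _; rewrite neq_ltn (leq_trans (ltn_ord j) hi). Qed.

Lemma in_Abar_cmap a : isA a -> hasval a w -> in_Abar l (cmap rts a).
Proof.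
move=> ha hv; split=> [i|i hi].
  rewrite /cmap; elim: (fin_enum _) => [|x r IH].
    by have := is_pui0; congr is_pui; apply: funext => q; rewrite big_nil.
  case: ha => hp _ _; have := is_pui_add (hp x) IH.
  by congr is_pui; apply: funext => q; rewrite big_cons.
exists (- qpair (evec n i) w); rewrite (cmap_lead Hrd i hv Hf) (oJ_central Hrd (central_idx hi)).
by rewrite big_seq1 lead_neq0.
Qed.

(** Nonvanishing of the last coordinates is automatic: their lowest coefficient is a single
    character value. *)
Lemma newtonP c : newton l rts (toR w) c <-> exists2 a, good a & c = cmap rts a.
Proof.
split=> [[_ [a [ha -> hs hv]]]|[a [ha hv hs] ->]].
  exists a => //; split=> // x; have [v [e pv]] := hv x.
  by move: e; rewrite rpair_toR => /(fmorph_inj _) <-.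
split; first exact: in_Abar_cmap.
by exists a; split=> // x; exists (qpair x w); rewrite rpair_toR.
Qed.

(** The lowest exponent of c_i may fail to be an integer. Then there is no such coordinate on F^n,
    but the coefficient is zero by descent, so the constant 0 represents it. *)
Definition lvar (i : 'I_n) : cpoly n :=
  if denq (qpair (evec n i) w) == 1 then PVar i (- numq (qpair (evec n i) w)) else PConst n 0.
Lemma peval_lvar a i : good a ->
  peval (cmap rts a) (lvar i) = \sum_(x <- oJ (evec n i)) lead a w x.
Proof.
move=> [ha hv [g [hg hs]]]; rewrite -(cmap_lead Hrd i hv Hf) /lvar.
case: eqP => [e|ne] /=.
  by congr (cmap _ _ _ _); rewrite mulrNz -[in RHS](divq_num_den (qpair _ _)) e divr1.
apply/esym/eqP; apply: contraT => nz; case: ne.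
by have := cmap_integral Hrd hg hs nz; rewrite denqN.
Qed.

Let T := {a | good a}.
Let Ld (t : T) x := lead (projT1 t) w x.
Let coord (t : T) := cmap rts (projT1 t).
Let Epoly (f : T -> CC) := exists P, forall t, f t = peval (coord t) P.
Let central (i : 'I_n) := [forall j, (j \in J) ==> (nat_of_ord j != i)].
Let Z t := \prod_(i | central i) Ld t (evec n i).
(** Inverses of central characters are not polynomials in [c]. Since [Z] never vanishes on the
    stratum, polynomiality is asked only after multiplication by a power of [Z]. *)
Let E (f : T -> CC) := exists k : nat, Epoly (fun t => f t * Z t ^+ k).

Let centralP (i : 'I_n) : reflect (forall j, j \in J -> nat_of_ord j != i) (central i).
Proof.
apply: (iffP forallP) => [h j hj|h j]; last by apply/implyP; exact: h.
exact: (implyP (h j)).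
Qed.
Let Epoly_add f g : Epoly f -> Epoly g -> Epoly (fun t => f t + g t).
Proof. by move=> [P hP] [Q hQ]; exists (PAdd P Q) => t; rewrite hP hQ. Qed.
Let Epoly_mul f g : Epoly f -> Epoly g -> Epoly (fun t => f t * g t).
Proof. by move=> [P hP] [Q hQ]; exists (PMul P Q) => t; rewrite hP hQ. Qed.
Let Epoly_const z : Epoly (fun=> z). Proof. by exists (PConst n z). Qed.
Let Epoly_lead (i : 'I_n) : central i -> Epoly (fun t => Ld t (evec n i)).
Proof.
move=> /centralP hi; exists (lvar i) => -[a ha].
by rewrite /coord /Ld /= peval_lvar // (oJ_central Hrd hi) big_seq1.
Qed.
Let Epoly_prod (r : seq 'I_n) (B : pred 'I_n) : (forall i, B i -> central i) ->
  Epoly (fun t => \prod_(i <- r | B i) Ld t (evec n i)).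
Proof.
move=> hB; elim: r => [|i r IH].
  by have := Epoly_const 1; congr Epoly; apply: funext => t; rewrite big_nil.
case Bi: (B i); last by move: IH; congr Epoly; apply: funext => t; rewrite big_cons Bi.
have := Epoly_mul (Epoly_lead (hB i Bi)) IH.
by congr Epoly; apply: funext => t; rewrite big_cons Bi.
Qed.
Let Epoly_Z k : Epoly (fun t => Z t ^+ k).
Proof.
elim: k => [|k IH]; first by have := Epoly_const 1; congr Epoly; apply: funext => t; rewrite expr0.
have := Epoly_mul (@Epoly_prod (index_enum 'I_n) central (fun i h => h)) IH.
by congr Epoly; apply: funext => t; rewrite exprS.
Qed.

Let LdD t x y : Ld t (x + y) = Ld t x * Ld t y.
Proof. by case: t => a [ha hv hs]; rewrite /Ld /= leadD. Qed.
Let Ld0 t : Ld t 0 = 1.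
Proof. by case: t => a [ha hv hs]; rewrite /Ld /= lead0. Qed.
Let Ld_neq0 t x : Ld t x != 0.
Proof. by case: t => a [ha hv hs]; rewrite /Ld /= lead_neq0. Qed.

Let RJs := [seq p <- rts | `[< RJ p >]].
Let disc t := \prod_(p <- RJs) (1 - Ld t p.1).

(** The product over all roots of M is W_M-invariant, so the group sum computed by [E_prod_sum] at x
    = 0 is the order of W_M times it. *)
Let E_disc : E disc.
Proof.
have [s us hs] := WJ_enum Hrd J.
have s0 : (0 < size s)%N.
  have : 1%:M \in s by apply/hs; exact: WJ1.
  by case: (s).
have Eadd f g : E f -> E g -> E (fun t => f t + g t).
  move=> [k1 h1] [k2 h2]; exists (k1 + k2)%N.
  have := Epoly_add (Epoly_mul h1 (Epoly_Z k2)) (Epoly_mul h2 (Epoly_Z k1)).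
  by congr Epoly; apply: funext => t; rewrite exprD; ring.
have Emul f g : E f -> E g -> E (fun t => f t * g t).
  move=> [k1 h1] [k2 h2]; exists (k1 + k2)%N.
  have := Epoly_mul h1 h2.
  by congr Epoly; apply: funext => t; rewrite exprD; ring.
have Econst z : E (fun=> z).
  by exists 0%N; have := Epoly_const z; congr Epoly; apply: funext => t; rewrite mulr1.
have Eopp f : E f -> E (fun t => - f t).
  by move=> /(Emul _ _ (Econst (-1))); congr E; apply: funext => t; rewrite mulN1r.
have Ediv f k : (0 < k)%N -> E (fun t => f t *+ k) -> E f.
  move=> k0 /(Emul _ _ (Econst (k%:R^-1))); congr E; apply: funext => t.
  have nz : (k%:R : CC) != 0 by rewrite pnatr_eq0 -lt0n.
  by rewrite -[f t *+ k]mulr_natl mulKf.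
have Elead (i : 'I_n) : E (fun t => \sum_(x <- oJ (evec n i)) Ld t x).
  exists 0%N, (lvar i) => -[a ha]; rewrite /coord /Ld /= mulr1.
  by rewrite peval_lvar.
have Eprod : E (fun t => \sum_(M <- s) Ld t (0 *m M) *
    \prod_(y <- map fst RJs) (1 - Ld t (y *m M))).
  apply: (E_prod_sum Hrd us hs) => //.
  - move=> j hj.
    have [uo ho] := oJ_spec Hrd J (evec n (wo Hrd j)).
    have [k k0 hk] := sum_orbit Hrd us hs uo ho.
    have := Emul _ _ (Econst k%:R) (Elead (wo Hrd j)); congr E; apply: funext => t.
    by rewrite (hk _ (Ld t)) mulr_natl.
  - move=> k hk; split.
      have := Elead k; congr E; apply: funext => t.
      by rewrite (oJ_central Hrd hk) big_seq1.
    have ck : central k by apply/centralP.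
    (* Times [Z], the inverse of the k-th central character is the product of the other central
       ones. *)
    exists 1%N; have := @Epoly_prod (index_enum 'I_n) (fun i => central i && (i != k))
      (fun i h => (andP h).1).
    congr Epoly; apply: funext => t.
    by rewrite expr1 /Z [in RHS](bigD1 k) //= mulrA -LdD addrC subrr Ld0 mul1r.
have hW t M : WJ M -> \prod_(y <- map fst RJs) (1 - Ld t (y *m M)) = disc t.
  move=> hM; have uM := WJ_unit Hrd hM.
  rewrite /disc -(big_map fst xpredT (fun y => 1 - Ld t y)).
  have uL : uniq (map fst RJs).
    apply: (subseq_uniq _ (root_uniq Hrd)); apply: map_subseq; exact: filter_subseq.
  have inL x : x \in map fst RJs <-> exists2 p, RJ p & p.1 = x.
    split=> [/mapP[p]|[p hp <-]].
      by rewrite mem_filter => /andP[/asboolP hp _] ->; exists p.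
    by apply: map_f; rewrite mem_filter (RJ_rts hp) andbT; apply/asboolP.
  have pe : perm_eq [seq y *m M | y <- map fst RJs] (map fst RJs).
    apply: uniq_perm => //; first by rewrite map_inj_uniq //; exact: can_inj (mulmxK uM).
    move=> x; apply/mapP/idP => [[y /inL[p hp <-] ->]|/inL[p hp <-]].
      by apply/inL; exists (pact M p) => //; exact: (RJ_pact Hrd).
    exists (p.1 *m invmx M); last by rewrite mulmxKV.
    by apply/inL; exists (pact (invmx M) p) => //; apply: (RJ_pact Hrd) => //; exact: (WJ_inv Hrd).
  by rewrite -[RHS](perm_big _ pe) /= [RHS]big_map.
apply: (Ediv _ (size s) s0); move: Eprod; congr E; apply: funext => t.
rewrite (eq_big_seq (fun=> disc t)) => [|M /hs hM]; last by rewrite mul0mx Ld0 mul1r hW.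
by rewrite sumr_const_seq count_predT.
Qed.

(** The polynomial represents [disc] times a power of the nonvanishing [Z]. As its value depends on
    [c] alone, regularity does not depend on the lift. *)
Lemma discriminant_poly : exists P : cpoly n, forall a, good a ->
  (peval (cmap rts a) P != 0) <-> (forall p, RJ p -> lead a w p.1 != 1).
Proof.
have [k [P hP]] := E_disc; exists P => a ha.
have := hP (exist _ a ha); rewrite /coord /= => <-.
have Z0 : Z (exist _ a ha) ^+ k != 0.
  by rewrite expf_neq0 // prodf_seq_neq0; apply/allP => i _; rewrite Ld_neq0 implybT.
rewrite mulf_eq0 (negbTE Z0) orbF /disc prodf_seq_neq0; split.
  move=> /allP h p hp; have := h p; rewrite mem_filter (RJ_rts hp) andbT.
  by move=> /(_ (asboolT hp)); rewrite /Ld /= subr_eq0 eq_sym.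
move=> h; apply/allP => p; rewrite mem_filter => /andP[/asboolP/h hp _].
by rewrite /Ld /= subr_eq0 eq_sym.
Qed.

End Discriminant.


Lemma lat_ind (n : nat) (P : lat n -> Prop) : P 0 -> (forall x y, P x -> P y -> P (x + y)) ->
  (forall k : 'I_n, P (evec n k) /\ P (- evec n k)) -> forall x, P x.
Proof.
move=> P0 PD Pe x.
have Pn y (k : nat) : P y -> P (y *+ k).
  by move=> h; elim: k => [|k IH]; rewrite ?mulr0n // mulrS; exact: PD.
rewrite (lat_expand x).
elim/big_ind: _ => // k _; have [h1 h2] := Pe k.
have sZ (m : nat) (y : lat n) : m%:Z *: y = y *+ m by rewrite -[RHS]scaler_nat natz.
case: (intP (x 0 k)) => [|m|m]; first by rewrite scale0r.
  by rewrite sZ; exact: Pn.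
by rewrite scaleNr sZ -mulNrn; exact: Pn.
Qed.

(** Polar coordinates on A(C), with value exp(<lam,y> - 2 pi i <lam,x>). The sign is chosen so that
    the Galois action on leading coefficients becomes the shift of x by nu. *)
Definition chr (n : nat) (x y : avec n) (lam : lat n) : CC := expo (- rpair lam x) (rpair lam y).

Section Char.
Variable n : nat.
Implicit Types (x y : avec n) (lam : lat n).
Lemma chrD x y lam lam' : chr x y (lam + lam') = chr x y lam * chr x y lam'.
Proof. by rewrite /chr !rpairDl opprD expoD. Qed.
Lemma chr0 x y : chr x y 0 = 1.
Proof. by rewrite /chr !rpair0l oppr0 expo0. Qed.
Lemma chr_surj (chi : lat n -> CC) : chi 0 = 1 ->
  (forall lam lam', chi (lam + lam') = chi lam * chi lam') ->
  exists x y, forall lam, chi lam = chr x y lam.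
Proof.
move=> c0 cD.
have nz lam : chi lam != 0.
  by apply/eqP => e; have := c0; rewrite -(subrr lam) cD e mul0r => /eqP; rewrite eq_sym oner_eq0.
have ex k : exists rs : R * R, chi (evec n k) = expo rs.1 rs.2.
  by have [r [s e]] := expo_surj (nz (evec n k)); exists (r, s).
pose f (k : 'I_n) := projT1 (cid (ex k)).
exists (\row_k - (f k).1), (\row_k (f k).2).
apply: lat_ind => [|u v hu hv|k]; first by rewrite c0 chr0.
  by rewrite cD chrD hu hv.
have e : chi (evec n k) = chr (\row_k - (f k).1) (\row_k (f k).2) (evec n k).
  by rewrite /chr !rpair_evec !mxE opprK /f; case: cid.
split=> //; apply: (mulfI (nz (evec n k))).
by rewrite -cD subrr c0 e -chrD subrr chr0.
Qed.
Lemma chr_eq (x y x' y' : avec n) : (forall lam, chr x y lam = chr x' y' lam) ->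
  y = y' /\ exists t : lat n, x = x' + toA t.
Proof.
move=> h.
have hk (k : 'I_n) : y 0 k = y' 0 k /\ exists m : int, x 0 k = x' 0 k + m%:~R.
  have := h (evec n k); rewrite /chr !rpair_evec => e.
  have : expo (- x 0 k + x' 0 k) (y 0 k - y' 0 k) = 1.
    by rewrite expoD e -expoD addNr subrr expo0.
  move/expo_eq1 => [e1 [m e2]]; split; first by apply/eqP; rewrite -subr_eq0 e1.
  by exists (- m); rewrite mulrNz -e2; ring.
split; first by apply/rowP => k; case: (hk k).
exists (\row_k projT1 (cid (hk k).2)); apply/rowP => k; rewrite !mxE.
by case: cid.
Qed.
Lemma chr_ract M x y lam : chr x y (lam *m M) = chr (ract M x) (ract M y) lam.
Proof. by rewrite /chr !rpair_ract. Qed.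
End Char.

(** * Conjugacy of the monodromy with w(nu) *)

Section Monodromy.
Variables (n l : nat) (rts : seq (lat n * lat n)) (alpha : 'I_l -> lat n).
Hypothesis Hrd : based_root_datum_sc rts alpha.
Variables (J : {set 'I_l}).
Notation WG := (inWG rts).
Notation WJ := (inWM rts alpha J).
Notation RJ := (RM rts alpha J).
Implicit Types (x y v : avec n) (M G H U : 'M[int]_n).

Lemma pM_facts lam nu : pM rts alpha J lam nu ->
  [/\ exists w, nu = toR w, forall j, j \in J -> rpair (alpha j) nu = 0 &
      suppJ J (toA lam - nu)].
Proof.
move=> [s [us hs enu]].
have s0 : (size s)%:R != 0 :> R.
  rewrite pnatr_eq0 -lt0n; have : 1%:M \in s by apply/hs; exact: WJ1.
  by case: (s).
have actE M : M \in s -> actA M (toA lam) = ract (invmx M) (toA lam).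
  by move=> /hs hM; apply: actA_ract; rewrite mulmxV // (WJ_unit Hrd hM).
have fixN N : WJ N -> ract N nu = nu.
  move=> hN; rewrite enu ractZ ract_sum; congr (_ *: _).
  rewrite -[RHS](perm_big _ (perm_mulr Hrd us hs (WJ_inv Hrd hN))) big_map.
  apply: eq_big_seq => M hM; rewrite actE // ractM.
  have hM' := (hs M).1 hM.
  have uM := WJ_unit Hrd hM'; have uN := WJ_unit Hrd hN.
  by apply/esym/actA_ract; rewrite mulmxA mulmxKV // mulmxV.
split.
- pose w : 'rV[rat]_n := (size s)%:R^-1 *:
    \sum_(M <- s) map_mx (fun z : int => z%:~R) (lam *m (invmx M)^T).
  exists w; rewrite enu; apply/rowP => k; rewrite !mxE rmorphM fmorphV rmorph_nat; congr (_ * _).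
  rewrite !summxE rmorph_sum big_seq [RHS]big_seq; apply: eq_bigr => M hM.
  by rewrite actE // ract_toA !mxE /= ratr_int.
- move=> j hj; have := congr1 (rpair (alpha j)) (fixN _ (WJ_sr Hrd hj)).
  by rewrite rpair_ract (simple_sr Hrd) rpairNl; lra.
- have -> : toA lam - nu = (size s)%:R^-1 *: \sum_(M <- s) (toA lam - actA M (toA lam)).
    rewrite sumrB scalerBr -enu; congr (_ - _).
    by rewrite sumr_const_seq count_predT -[X in _ *: X]scaler_nat scalerA mulVf // scale1r.
  apply: suppJZ; rewrite big_seq; apply: suppJ_sum => M hM; rewrite actE //.
  rewrite -opprB; apply: suppJN; apply: (suppJ_WJ Hrd); apply: (WJ_inv Hrd); exact/hs.
Qed.

(** The inverse appears because [ract M] is [actA (invmx M)]. *)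
Lemma w_of_nuI lam nu mu M : pM rts alpha J lam nu -> suppJ J (mu - lam) -> WJ M ->
  (forall v, alcv rts alpha J v <-> alcv rts alpha J (ract M v + toA mu)) ->
  w_of_nu rts alpha J nu (invmx M).
Proof.
move=> hp hs hM hal; exists lam, mu; split=> //; last 2 first.
- exact: (WJ_inv Hrd).
- move=> v; rewrite (actA_ract v (mulVmx (WJ_unit Hrd hM))).
  by rewrite !(alcove_alcv Hrd).
pose z := mu - lam.
(* The coefficients are concentrated at the positions of the simple coroots, which already form a
   basis of the coroot lattice of M. *)
exists (fun i => \sum_(j in J) (z 0 (wo Hrd j)) * (nth (0, 0) rts i == (alpha j, evec n j))%:R).
split.
  move=> i hi hn; rewrite big1 // => j hj; case: eqP => [e|_]; last by rewrite mulr0.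
  by case: hn; rewrite e; exact: (spanJ_simple alpha hj).
have ez : z = \sum_(j in J) z 0 (wo Hrd j) *: evec n j.
  apply: (@toA_inj n); have /suppJ_toA/(suppJ_expand Hrd) -> := hs.
  by rewrite toA_sum; apply: eq_bigr => j _; rewrite toAZ mxE.
rewrite -/z [LHS]ez.
under [RHS]eq_bigr do rewrite scaler_suml.
rewrite [RHS]exchange_big; apply: eq_bigr => j hj /=.
have jin := simple_in Hrd j.
have hi : (index (alpha j, evec n j) rts < size rts)%N by rewrite index_mem.
rewrite (bigD1 (Ordinal hi)) //= nth_index // eqxx mulr1 big1 ?addr0 // => i ne.
case: eqP => [e|_]; last by rewrite mulr0 scale0r.
move: ne; rewrite -val_eqE /= -e index_uniq ?(uniq_rts Hrd) // eqxx //.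
Qed.

Lemma lead_chr (w : 'rV[rat]_n) (a : lat n -> Pui) h : good rts w a -> WG h ->
  sigmaA a = actT h a -> exists x y t, [/\ forall lam, lead a w lam = chr x y lam,
    ract (invmx h) y = y & ract (invmx h) x = x + toR w + toA t].
Proof.
move=> [ha hv _] hh hs.
have [x [y exy]] := chr_surj (lead0 w ha) (fun u u' => leadD u u' ha hv).
have [ey [t et]] : ract (invmx h) y = y /\ exists t, ract (invmx h) x = x + toR w + toA t.
  apply: chr_eq => u; rewrite -chr_ract -exy (sigma_lead _ hv hs) exy.
  by rewrite expiE rmorphN /= -rpair_toR /chr -expoD rpairDr opprD add0r addrC.
by exists x, y, t.
Qed.

(** The point [a] has the same image as [b] but arbitrary valuation. After a Weyl conjugation the
    valuation is dominant, hence equal to [w] by uniqueness, and the normal form applies to the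
    leading coefficients. Regularity is required of all lifts because the conjugate of [a] need not
    be [b]. *)
Lemma generic_monodromy (w : 'rV[rat]_n) (a b : lat n -> Pui) (mu : lat n) M h :
  facet alpha J (toR w) -> good rts w b -> isA a -> cmap rts a = cmap rts b ->
  (forall a', good rts w a' -> cmap rts a' = cmap rts b ->
     forall p, RJ p -> lead a' w p.1 != 1) ->
  WJ M -> suppJ J (toA mu - toR w) ->
  (forall v, alcv rts alpha J v <-> alcv rts alpha J (ract M v + toA mu)) ->
  WG h -> sigmaA a = actT h a ->
  exists2 g, WG g & h = g *m invmx M *m invmx g.
Proof.
move=> hf hb ha ec hreg hM hs hal hh hsig.
have [w1 hv1] := isA_hasval ha.
have [G hG hdom] := dominant_rep Hrd (toR w1).
pose a' lam := a (lam *m G).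
have ha' : isA a' := isA_act G ha.
have [w2 hv2] := isA_hasval ha'.
have uG := WG_unit Hrd hG.
have e2 : toR w2 = ract G (toR w1).
  apply: rpair_inj => x; rewrite rpair_ract !rpair_toR; congr ratr.
  by apply: (pval_uniq (hv2 x)); exact: hv1.
have ec' : cmap rts a' = cmap rts b by rewrite -ec; exact: (cmap_act Hrd).
have hf2 := facet_of (v := toR w2) (alpha := alpha); rewrite e2 in hf2.
have {}hf2 := hf2 hdom; rewrite -e2 in hf2.
case: (hb) => _ hvb _.
have ew : w2 = w := dominant_val_uniq Hrd hv2 hvb hf2 hf ec'.
rewrite ew in hv2.
have uh := WG_unit Hrd hh.
pose H := G *m invmx h *m invmx G.
pose h' := G *m h *m invmx G.
have hh' : WG h' by apply: WG_mul; [exact: WG_mul|exact: (WG_inv Hrd)].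
have uh' := WG_unit Hrd hh'.
have eH : invmx h' = H.
  have e : h' *m H = 1%:M.
    by rewrite /h' /H -!mulmxA mulKmx // mulKVmx // mulmxV.
  by rewrite -[RHS](mulKmx uh') e mulmx1.
have hsig' : sigmaA a' = actT h' a'.
  apply: funext => x; have := congr1 (fun f => f (x *m G)) hsig.
  by rewrite /sigmaA /actT /a' eH /H -!mulmxA mulVmx // mulmx1.
have hH : WJ H by rewrite -eH; exact: sigma_stab hv2 hf hh' hsig'.
have ga' : good rts w a' by split=> //; exists h'.
have [x [y [t [exy ey et]]]] := lead_chr ga' hh' hsig'.
rewrite eH in ey et.
have [f1 f0] := hf.
have et' : ract H x = x + toR w - toA (- t) by rewrite toAN opprK.
have [U [t' [hU ht' [hc _ _ hconj]]]] := monodromy_normal_form Hrd hM hs f0 hal hH et' ey.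
have eM : U *m H *m invmx U = M.
  (* A root of M equal to 1 at the transformed point would, transported by [U], be a root of M equal
     to 1 on the leading coefficients of [a']. *)
  apply: hconj => p k hp [e1 e3].
  have := hreg a' ga' ec' _ (RJ_pact Hrd hU hp.1); rewrite exy /chr /= -!rpair_ract e3.
  have -> : - rpair p.1 (ract U x) = (ipair p.1 t' - k)%:~R.
    by move: e1; rewrite rpairDr rpair_toA intrB => <-; ring.
  by rewrite expo_int eqxx.
have uU := WJ_unit Hrd hU; have uM := WJ_unit Hrd hM.
pose V := U *m G.
have hV : WG V by apply: WG_mul => //; exact: WJ_WG hU.
have uV := WG_unit Hrd hV.
have eV : M *m V = V *m invmx h.
  by rewrite -eM /H /V !mulmxA mulmxKV // mulmxKV.
have eV2 : V *m h = invmx M *m V.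
  by rewrite -[LHS](mulKmx uM) (mulmxA M) eV mulmxKV.
exists (invmx V); first exact: (WG_inv Hrd).
by rewrite invmxK -mulmxA -eV2 mulKmx.
Qed.

End Monodromy.

(** * Density *)


Section FormalExp.
Variable K : numFieldType.
Implicit Types (f g : {poly K}) (k m : nat) (c : K).

Lemma coefX_small f j k : f`_0 = 0 -> (k < j)%N -> (f ^+ j)`_k = 0.
Proof.
move=> f0; elim: j k => // j IH k hk; rewrite exprS coefM big1 // => -[i hi] _ /=.
case: i hi => [|i] hi; first by rewrite f0 mul0r.
by rewrite IH ?mulr0 //; lia.
Qed.

(* expc f k is the coefficient of X^k in exp f, for f without constant term. *)
Definition expc f k : K := \sum_(j < k.+1) (j`!%:R)^-1 * (f ^+ j)`_k.

Lemma expc_widen f k m : f`_0 = 0 -> (k < m)%N -> expc f k = \sum_(j < m) (j`!%:R)^-1 * (f ^+ j)`_k.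
Proof.
move=> f0 hk; rewrite /expc.
rewrite -[LHS](big_mkord xpredT (fun j => (j`!%:R)^-1 * (f ^+ j)`_k)).
rewrite -[RHS](big_mkord xpredT (fun j => (j`!%:R)^-1 * (f ^+ j)`_k)).
rewrite [RHS](big_cat_nat (n := k.+1)) //= [X in _ + X]big_nat_cond [X in _ + X]big1 ?addr0 //.
by move=> j /andP[/andP[hj _] _]; rewrite coefX_small ?mulr0.
Qed.

Lemma expc0 f : expc f 0 = 1.
Proof. by rewrite /expc big_ord1 expr0 fact0 invr1 mul1r coef1. Qed.
Lemma expc_zero k : expc 0 k = (k == 0%N)%:R.
Proof.
rewrite /expc big_ord_recl expr0 fact0 invr1 mul1r coef1 big1 ?addr0 // => i _.
by rewrite exprS mul0r coef0 mulr0.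
Qed.

(** By the binomial theorem the left side sums the terms [t a b] along diagonals. Terms with a + b >
    k vanish, so the triangle may be completed to the square of the right side. *)
Lemma expcD f g k : f`_0 = 0 -> g`_0 = 0 ->
  expc (f + g) k = \sum_(i < k.+1) expc f i * expc g (k - i).
Proof.
move=> f0 g0.
have fN j : (j`!%:R : K) != 0 by rewrite pnatr_eq0 -lt0n fact_gt0.
pose t a b := (a`!%:R)^-1 * (b`!%:R)^-1 * (f ^+ a * g ^+ b)`_k.
have -> : \sum_(i < k.+1) expc f i * expc g (k - i) = \sum_(a < k.+1) \sum_(b < k.+1) t a b.
  under eq_bigr => i _.
    rewrite (expc_widen (m := k.+1)) // (expc_widen (f := g) (m := k.+1)) ?ltnS ?leq_subr //.
    rewrite mulr_suml; under eq_bigr do rewrite mulr_sumr.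
    over.
  rewrite exchange_big; apply: eq_bigr => a _; rewrite exchange_big; apply: eq_bigr => b _ /=.
  rewrite /t coefM mulr_sumr; apply: eq_bigr => i _; ring.
have tz a b : (k < a + b)%N -> t a b = 0.
  move=> hab; rewrite /t coefM big1 ?mulr0 // => -[i hi] _ /=.
  case: (ltnP i a) => h; first by rewrite coefX_small ?mul0r.
  by rewrite [X in _ * X]coefX_small ?mulr0 //; lia.
have tj j a : (a <= j)%N -> (j`!%:R)^-1 * (g ^+ (j - a) * f ^+ a *+ 'C(j, a))`_k = t a (j - a)%N.
  move=> ha; rewrite /t coefMn -[_ *+ 'C(j, a)]mulr_natl (mulrC (f ^+ a)) mulrA; congr (_ * _).
  have := bin_fact ha => /(congr1 (fun z : nat => z%:R : K)); rewrite !natrM => e.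
  apply: (mulfI (fN j)); rewrite mulrA divff // mul1r -e.
  by move: (fN a) (fN (j - a)%N) => n1 n2; field; rewrite n1 n2.
have -> : expc (f + g) k = \sum_(0 <= j < k.+1) \sum_(0 <= a < k.+1 | (a <= j)%N) t a (j - a)%N.
  rewrite big_mkord; apply: eq_bigr => -[j hj] _ /=.
  rewrite addrC exprDn coef_sum mulr_sumr.
  rewrite -[LHS](big_mkord xpredT (fun i => j`!%:R^-1 * (g ^+ (j - i) * f ^+ i *+ 'C(j, i))`_k)).
  rewrite (big_nat_widen _ _ k.+1) //= big_nat_cond [RHS]big_nat_cond.
  by apply: eq_big => [a|a /andP[_ ha]]; [rewrite ltnS|exact: tj].
rewrite (exchange_big_dep_nat xpredT) //= big_mkord; apply: eq_bigr => -[a ha] _ /=.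
rewrite -[RHS](big_mkord xpredT (t a)).
transitivity (\sum_(a <= j < k.+1) t a (j - a)%N); first by rewrite (big_nat_widenl a 0).
rewrite -{1}[a]add0n big_addn.
rewrite [RHS](big_cat_nat (n := (k.+1 - a)%N)) //= ?leq_subr //.
rewrite [X in _ = _ + X]big_nat_cond [X in _ = _ + X]big1 ?addr0.
  by apply: eq_bigr => b _; rewrite addnK.
by move=> b /andP[/andP[hb _] _]; apply: tz; lia.
Qed.

Lemma expc_scale f g c k : (forall m, g`_m = c ^+ m * f`_m) -> expc g k = c ^+ k * expc f k.
Proof.
move=> h; have hX j m : (g ^+ j)`_m = c ^+ m * (f ^+ j)`_m.
  elim: j m => [|j IH] m.
    by rewrite !expr0 coef1; case: m => [|m]; rewrite /= ?mulr0 // mul1r.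
  rewrite !exprS !coefM mulr_sumr; apply: eq_bigr => -[i hi] _ /=.
  rewrite h IH -{3}(subnKC (_ : i <= m)%N) // exprD; ring.
rewrite /expc mulr_sumr; apply: eq_bigr => j _; rewrite hX; ring.
Qed.

Lemma expc_monomial c m k : (0 < m)%N -> (k <= m)%N ->
  expc (c *: 'X^m) k = (k == 0%N)%:R + (if k == m then c else 0).
Proof.
move=> m0 km.
have cX j : ((c *: 'X^m) ^+ j)`_k = c ^+ j * (k == (m * j)%N)%:R.
  by rewrite exprZn -exprM coefZ coefXn.
rewrite /expc; case: k km cX => [|k] km cX.
  rewrite big_ord1 cX muln0 eqxx expr0 fact0 invr1 !mul1r.
  by rewrite (ltn_eqF m0) addr0.
rewrite big_ord_recl big_ord_recl cX muln0 mulr0 add0r /= cX muln1 expr1 big1 => [|i _].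
  have -> : (bump 0 0)`! = 1%N by [].
  by rewrite mulr0 add0r addr0 invr1 mul1r; case: eqP; rewrite ?mulr1 ?mulr0.
rewrite cX; case: eqP => [e|_]; last by rewrite !mulr0.
by move: km; rewrite e /bump /=; nia.
Qed.

(** A new term of degree m leaves all lower coefficients alone and enters degree m linearly; this is
    what allows solving one order at a time. *)
Lemma expc_perturb f c m k : f`_0 = 0 -> (0 < m)%N -> (k <= m)%N ->
  expc (f + c *: 'X^m) k = expc f k + (if k == m then c else 0).
Proof.
move=> f0 m0 km.
rewrite expcD //; last by rewrite coefZ coefXn (ltn_eqF m0) mulr0.
rewrite big_ord_recr /= subnn expc_monomial // eqxx (ltn_eqF m0) addr0 mulr1 addrC; congr (_ + _).
case: k km => [|k] km; first by rewrite big_ord0 (ltn_eqF m0).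
rewrite big_ord_recl /= expc0 mul1r subn0 expc_monomial // add0r big1 ?addr0 //.
move=> i _; rewrite expc_monomial; [|by []|by rewrite /bump /=; lia].
have hi := ltn_ord i; rewrite /bump /= ifF; last by apply/negbTE; rewrite neq_ltn; lia.
by rewrite gtn_eqF ?addr0 ?mulr0 //; lia.
Qed.

End FormalExp.

Section Series.
Variable N0 : nat.
Hypothesis hN0 : (0 < N0)%N.
Implicit Types (v q r : rat) (z : nat -> CC) (k : nat).

(* The Puiseux series sum_k z_k eps^(k/N0 - v). *)
Definition ser v z : Pui := fun q =>
  let r := (q + v) *+ N0 in if (denq r == 1) && (0 <= r) then z `|numq r|%N else 0.
Notation gpt k v := (k%:R / N0%:R - v).

Let Nn0 : (N0%:R : rat) != 0. Proof. by rewrite pnatr_eq0 -lt0n. Qed.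

Lemma ser_at v z k : ser v z (gpt k v) = z k.
Proof.
rewrite /ser subrK -[_ *+ N0]mulr_natr divfK // ler0n andbT.
by rewrite -[k%:R]/((k%:Z)%:~R) denq_int numq_int.
Qed.
Lemma serP v z q : ser v z q != 0 -> exists k, q = gpt k v.
Proof.
rewrite /ser; case: ifP => [/andP[/denq1_int[m hm] h0] _|_]; last by rewrite eqxx.
exists `|m|%N; have m0 : 0 <= m by rewrite -(ler_int rat) -hm.
rewrite natr_absz ger0_norm // -hm -[_ *+ N0]mulr_natr mulfK //; ring.
Qed.
Lemma gpt_inj v k k' : gpt k v = gpt k' v :> rat -> k = k'.
Proof.
move/addIr => /(mulIf _) h; have := h (_ : N0%:R^-1 != 0).
by rewrite invr_eq0 => /(_ Nn0)/eqP; rewrite eqr_nat => /eqP.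
Qed.

Lemma is_pui_ser v z : denq (v *+ N0) == 1 -> is_pui (ser v z).
Proof.
move=> /denq1_int[m hm]; exists N0, (Num.floor (- v)); split=> // q /serP[k ->].
have -> : gpt k v *+ N0 = (k%:Z - m)%:~R.
  by rewrite mulrnBl hm -[_ / _ *+ _]mulr_natr divfK // intrB.
rewrite denq_int eqxx /=; have /andP[h _] := floor_itv (- v).
apply: le_trans h _; rewrite lerDr divr_ge0 // ler0n.
Qed.

Lemma pprod_ser v v' z z' :
  pprod (ser v z) (ser v' z') (ser (v + v') (fun k => \sum_(i < k.+1) z i * z' (k - i)%N)).
Proof.
apply: pprod_intro => q.
pose R0 := (q + (v + v')) *+ N0.
have addE k1 k2 r : r = gpt k1 v -> q - r = gpt k2 v' -> q = gpt (k1 + k2)%N (v + v').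
  by move=> e1 e2; rewrite -(subrK r q) e2 e1 natrD; ring.
have R0E k : q = gpt k (v + v') -> R0 = k%:R.
  by move=> e; rewrite /R0 e subrK -[_ *+ N0]mulr_natr divfK.
exists [seq gpt k v | k <- iota 0 (Num.truncn R0).+1].
  by rewrite map_inj_uniq ?iota_uniq // => k1 k2 /gpt_inj.
split=> [r /serP[k1 e1] /serP[k2 e2]|].
  have := R0E _ (addE _ _ _ e1 e2) => ->; rewrite natrK e1; apply/mapP; exists k1 => //.
  by rewrite mem_iota add0n ltnS leq_addr.
rewrite big_map.
case: (pselect (exists k, q = gpt k (v + v'))) => [[k e]|hn]; last first.
  rewrite big1 => [|k1 _].
    by apply/eqP; apply: contraT => /serP.
  apply/eqP; apply: contraT; rewrite mulf_eq0 negb_or => /andP[_ /serP[k2 e2]].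
  by case: hn; exists (k1 + k2)%N; apply: addE e2.
rewrite (R0E _ e) natrK e ser_at.
rewrite -[LHS](big_mkord xpredT (fun i => z i * z' (k - i)%N)) /index_iota subn0.
apply: eq_big_seq => i; rewrite mem_iota add0n ltnS => /andP[_ hi]; rewrite ser_at; congr (_ * _).
have -> : gpt k (v + v') - gpt i v = gpt (k - i)%N v' by rewrite natrB //; ring.
by rewrite ser_at.
Qed.

Lemma pval_ser v z : z 0%N != 0 -> pval (ser v z) v.
Proof.
move=> z0; have e : - v = gpt 0%N v by rewrite mul0r sub0r.
split; first by rewrite e ser_at.
by move=> q /serP[k ->]; rewrite lerDr divr_ge0 // ler0n.
Qed.
End Series.


Section Continuity.
Implicit Types (f g : R -> CC).
(** Continuity at t = 0 is enough: it keeps a nonzero value nonzero for some small t > 0. *)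
Definition ccont f := continuity_pt (fun t => complex.Re (f t)) (0 : R) /\
  continuity_pt (fun t => complex.Im (f t)) (0 : R).

Lemma ccont_const z : ccont (fun=> z).
Proof. by split; apply: continuity_pt_const. Qed.
Lemma ccont_add f g : ccont f -> ccont g -> ccont (fun t => f t + g t).
Proof.
move=> [f1 f2] [g1 g2]; split.
  have -> : (fun t => complex.Re (f t + g t)) =
      Ranalysis1.plus_fct (fun t => complex.Re (f t)) (fun t => complex.Re (g t)).
    by apply: funext => t; rewrite /plus_fct /minus_fct /mult_fct; case: (f t) => a b; case: (g t) => c d.
  exact: continuity_pt_plus.
have -> : (fun t => complex.Im (f t + g t)) =
    Ranalysis1.plus_fct (fun t => complex.Im (f t)) (fun t => complex.Im (g t)).
  by apply: funext => t; rewrite /plus_fct /minus_fct /mult_fct; case: (f t) => a b; case: (g t) => c d.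
exact: continuity_pt_plus.
Qed.
Lemma ccont_mul f g : ccont f -> ccont g -> ccont (fun t => f t * g t).
Proof.
move=> [f1 f2] [g1 g2]; split.
  have -> : (fun t => complex.Re (f t * g t)) = Ranalysis1.minus_fct
      (Ranalysis1.mult_fct (fun t => complex.Re (f t)) (fun t => complex.Re (g t)))
      (Ranalysis1.mult_fct (fun t => complex.Im (f t)) (fun t => complex.Im (g t))).
    by apply: funext => t; rewrite /plus_fct /minus_fct /mult_fct; case: (f t) => a b; case: (g t) => c d.
  by apply: continuity_pt_minus; apply: continuity_pt_mult.
have -> : (fun t => complex.Im (f t * g t)) = Ranalysis1.plus_fct
    (Ranalysis1.mult_fct (fun t => complex.Re (f t)) (fun t => complex.Im (g t)))
    (Ranalysis1.mult_fct (fun t => complex.Im (f t)) (fun t => complex.Re (g t))).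
  by apply: funext => t; rewrite /plus_fct /minus_fct /mult_fct; case: (f t) => a b; case: (g t) => c d.
by apply: continuity_pt_plus; apply: continuity_pt_mult.
Qed.
Lemma ccont_sum (I : Type) (r : seq I) (F : I -> R -> CC) :
  (forall i, ccont (F i)) -> ccont (fun t => \sum_(i <- r) F i t).
Proof.
move=> h; elim: r => [|i r IH].
  by have := ccont_const 0; congr ccont; apply: funext => t; rewrite big_nil.
by have := ccont_add (h i) IH; congr ccont; apply: funext => t; rewrite big_cons.
Qed.
Lemma cont_affine (a b : R) : continuity_pt (fun t : R => a + t * b) (0 : R).
Proof.
apply: (continuity_pt_plus (fun=> a) (fun t : R => t * b)); first exact: continuity_pt_const.
apply: (continuity_pt_mult id (fun=> b)); last exact: continuity_pt_const.
exact: (derivable_continuous_pt _ _ (derivable_pt_id _)).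
Qed.
Lemma ccont_expo (a b c d : R) : ccont (fun t : R => expo (a + t * b) (c + t * d)).
Proof.
have ce : continuity_pt (fun t : R => exp (c + t * d)%R) (0 : R).
  apply: (continuity_pt_comp (fun t : R => c + t * d) exp); first exact: cont_affine.
  exact: (derivable_continuous_pt _ _ (derivable_pt_exp _)).
have ca : continuity_pt (fun t : R => Rmult (Rmult 2 Rtrigo1.PI) (a + t * b)%R) (0 : R).
  apply: (continuity_pt_mult (fun=> Rmult 2 Rtrigo1.PI) (fun t : R => a + t * b)).
    exact: continuity_pt_const.
  exact: cont_affine.
split; apply: (continuity_pt_mult (fun t : R => exp (c + t * d)%R)) => //.
  apply: (continuity_pt_comp _ cos) => //; exact: (derivable_continuous_pt _ _ (derivable_pt_cos _)).
apply: (continuity_pt_comp _ sin) => //; exact: (derivable_continuous_pt _ _ (derivable_pt_sin _)).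
Qed.

Lemma cont_nonzero (f : R -> R) : continuity_pt f (0 : R) -> f 0 != 0 ->
  exists t : R, 0 < t < 1 /\ f t != 0.
Proof.
move=> hc nz.
have e0 : 0 < `|f 0| by rewrite normr_gt0.
have e1 : Rgt `|f 0| 0 by apply/RltP.
have [d [/RltP d0 hd]] := hc _ e1.
have {}d0 : 0 < d := d0.
have [t [t0 td t1]] : exists t : R, [/\ 0 < t, t < d & t < 1].
  by case: (ltP d 1) => h; [exists (d / 2)%R|exists (1 / 2)%R]; split; lra.
exists t; split; first by rewrite t0.
apply: contraTneq isT => ft.
have : Rlt (Rbasic_fun.Rabs (Rminus (f t) (f 0))) `|f 0|.
  apply: hd; split; first by split=> //; apply/eqP; rewrite eq_sym gt_eqF.
  apply/RltP; change (`|t - 0| < d); rewrite subr0 ger0_norm //.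
  exact: ltW.
by move/RltP; rewrite -[Rbasic_fun.Rabs _]/(`|f t - f 0|) ft sub0r normrN ltxx.
Qed.

Lemma ccont_nonzero f : ccont f -> f 0 != 0 -> exists t : R, 0 < t < 1 /\ f t != 0.
Proof.
move=> [h1 h2]; rewrite eq_complex negb_and => /orP[] nz.
  have [t [ht e]] := cont_nonzero h1 nz; exists t; split=> //.
  by apply: contraNneq e => ->.
have [t [ht e]] := cont_nonzero h2 nz; exists t; split=> //.
by apply: contraNneq e => ->.
Qed.

Lemma ccont_peval n (c : R -> 'I_n -> Pui) (P : cpoly n) :
  (forall i (j : int), ccont (fun t => c t i j%:~R)) -> ccont (fun t => peval (c t) P).
Proof.
move=> h; elim: P => [z|i j|P1 h1 P2 h2|P1 h1 P2 h2] /=.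
- exact: ccont_const.
- exact: h.
- exact: ccont_add.
- exact: ccont_mul.
Qed.
End Continuity.


Lemma expiD (p q : rat) : expi (p + q) = expi p * expi q.
Proof. by rewrite !expiE rmorphD -expoD addr0. Qed.
Lemma expi0 : expi 0 = 1.
Proof. by rewrite expiE rmorph0 expo0. Qed.
Lemma expi_int (z : int) : expi z%:~R = 1.
Proof. by rewrite expiE ratr_int expo_int. Qed.
Lemma expi_mul (p : rat) (k : nat) : expi (k%:R * p) = expi p ^+ k.
Proof.
elim: k => [|k IH]; first by rewrite mul0r expi0.
by rewrite -natr1 mulrDl mul1r expiD IH exprSr.
Qed.

Lemma common_den (n : nat) (w : 'rV[rat]_n) :
  exists2 N0, (0 < N0)%N & forall lam, denq (qpair lam w *+ N0) == 1.
Proof.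
pose N0 := (\prod_(k < n) absz (denq (w 0%R k)))%N.
exists N0; first by apply: prodn_gt0 => k; rewrite absz_gt0 denq_neq0.
have hk (k : 'I_n) : exists z : int, w 0 k *+ N0 = z%:~R.
  rewrite /N0 (bigD1 k) //=; set P := (\prod_(_ | _) _)%N.
  exists (numq (w 0 k) * P%:Z).
  rewrite intrM mulrnA -[w 0 k *+ _]mulr_natr natr_absz (gtr0_norm (denq_gt0 _)).
  by rewrite -{1}[w 0 k]divq_num_den divfK ?intr_eq0 ?denq_neq0 // mulr_natr.
move=> lam; apply/eqP.
suff [z ->] : exists z : int, qpair lam w *+ N0 = z%:~R by rewrite denq_int.
exists (\sum_k lam 0 k * projT1 (cid (hk k))).
rewrite rmorph_sum /qpair -sumrMnl; apply: eq_bigr => k _.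
by rewrite -mulrnAr rmorphM /=; case: cid => z /= ->.
Qed.

Lemma lpair_mulmx (n : nat) (K : numFieldType) (lam : lat n) (G : 'M[int]_n) (v : 'rV[K]_n) :
  lpair (lam *m G) v = lpair lam (\row_k lpair (evec n k *m G) v).
Proof.
have eG (j k : 'I_n) : (evec n j *m G) 0 k = G j k.
  rewrite mxE (bigD1 j) //= mxE eqxx mul1r big1 ?addr0 // => i ij.
  by rewrite mxE val_eqE (negbTE ij) mul0r.
rewrite /lpair.
under eq_bigr => k _ do rewrite mxE rmorph_sum mulr_suml.
rewrite exchange_big; apply: eq_bigr => j _ /=; rewrite mxE mulr_sumr.
by apply: eq_bigr => k _; rewrite eG rmorphM /= mulrA.
Qed.

(** * Solving for a prescribed image order by order *)

Section Approximation.
Variables (n l : nat) (rts : seq (lat n * lat n)) (alpha : 'I_l -> lat n).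
Hypothesis Hrd : based_root_datum_sc rts alpha.
Variables (J : {set 'I_l}) (w : 'rV[rat]_n).
Hypothesis Hf : facet alpha J (toR w).
Notation WG := (inWG rts).
Notation WJ := (inWM rts alpha J).
Notation oJ := (oJ rts alpha J).
Variables (M : 'M[int]_n) (mu : lat n).
Hypothesis hM : WJ M.
Variables (x y : avec n).
Hypothesis hx : alcv rts alpha J x.
Hypothesis ex : ract M x + toA mu = x + toR w.
Hypothesis ey : ract M y = y.
Variable N0 : nat.
Hypothesis hN0 : (0 < N0)%N.
Hypothesis hden : forall lam, denq (qpair lam w *+ N0) == 1.
Implicit Types (lam : lat n) (Y : 'I_n -> {poly CC}) (i : 'I_n) (k m : nat).

Let a := chr x y.
Let zeta := expi (N0%:R^-1).
Let N0n : (N0%:R : rat) != 0. Proof. by rewrite pnatr_eq0 -lt0n. Qed.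

Lemma chr_monodromy lam : a (lam *m M) = expi (- qpair lam w) * a lam.
Proof.
rewrite /a chr_ract ey; have -> : ract M x = x + toR w - toA mu by rewrite -ex addrK.
rewrite expiE rmorphN /= -rpair_toR /chr -expoD add0r rpairBr rpairDr rpair_toA.
rewrite -[rpair lam y in RHS]addr0 -[RHS]mulr1 -(expo_int (ipair lam mu)) -expoD addr0.
by congr expo; ring.
Qed.
Lemma chr_regular G : WJ G -> (forall lam, a (lam *m G) = a lam) -> G = 1%:M.
Proof.
move=> hG h; have [e1 [t e2]] : ract G y = y /\ exists t, ract G x = x + toA t.
  by apply: chr_eq => lam; rewrite -chr_ract; exact: h.
exact: (alcv_stab Hrd hx hG e2 e1).
Qed.

Lemma qpair_WJ lam G : WJ G -> qpair (lam *m G) w = qpair lam w.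
Proof.
move=> hG; apply: (fmorph_inj (ratr : {rmorphism rat -> R})).
by rewrite /= -!rpair_toR -rpair_ract (WJ_fix Hrd Hf.2 hG).
Qed.

Definition Yl Y lam : {poly CC} := \sum_k (lam 0 k)%:~R *: Y k.
Lemma YlD Y lam lam' : Yl Y (lam + lam') = Yl Y lam + Yl Y lam'.
Proof. by rewrite /Yl -big_split; apply: eq_bigr => k _; rewrite mxE intrD scalerDl. Qed.
Lemma Yl0 Y : Yl Y 0 = 0.
Proof. by rewrite /Yl big1 // => k _; rewrite mxE scale0r. Qed.

(** The condition for the series [bser Y] to satisfy the twisted Galois equation: sigma multiplies
    eps^(m/N0) by [zeta ^+ m]. *)
Definition equivariant Y := (forall j, (Y j)`_0 = 0) /\
  forall lam m, (Yl Y (lam *m M))`_m = zeta ^+ m * (Yl Y lam)`_m.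
Lemma Yl_coef0 Y lam : (forall j, (Y j)`_0 = 0) -> (Yl Y lam)`_0 = 0.
Proof. by move=> h; rewrite coef_sum big1 // => k _; rewrite coefZ h mulr0. Qed.

Definition bser Y lam : Pui := ser N0 (qpair lam w) (fun k => a lam * expc (Yl Y lam) k).

Lemma bser_isA Y : (forall j, (Y j)`_0 = 0) -> isA (bser Y).
Proof.
move=> Y0; split.
- by move=> lam; apply: is_pui_ser.
- apply: funext => q; rewrite /pone.
  case: (pselect (exists k : nat, q = k%:R / N0%:R - qpair 0 w)) => [[k ->]|hn].
    rewrite /bser ser_at // /a chr0 mul1r Yl0 expc_zero qpair0 subr0.
    by rewrite mulf_eq0 invr_eq0 (negbTE N0n) orbF pnatr_eq0.
  case: eqP => [q0|_].
    by case: hn; exists 0%N; rewrite q0 qpair0 mul0r subr0.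
  by apply/eqP; apply: contraT => /(serP hN0).
- move=> lam lam'.
  have := @pprod_ser N0 hN0 (qpair lam w) (qpair lam' w) (fun k => a lam * expc (Yl Y lam) k)
    (fun k => a lam' * expc (Yl Y lam') k).
  congr pprod; rewrite /bser qpairD; congr (ser _ _ _); apply: funext => k.
  rewrite /a chrD YlD expcD ?Yl_coef0 // mulr_sumr; apply: eq_bigr => i _; ring.
Qed.
Lemma bser_hasval Y : hasval (bser Y) w.
Proof.
move=> lam; apply: pval_ser => //; rewrite expc0 mulr1; exact: expo_neq0.
Qed.
Lemma bser_lead Y lam : lead (bser Y) w lam = a lam.
Proof.
rewrite /lead /bser; have -> : - qpair lam w = 0%:R / N0%:R - qpair lam w by rewrite mul0r sub0r.
by rewrite ser_at // expc0 mulr1.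
Qed.
Lemma bser_good Y : equivariant Y -> good rts w (bser Y).
Proof.
move=> [Y0 hY]; split; [exact: bser_isA|exact: bser_hasval|].
exists (invmx M); split; first by apply: (WG_inv Hrd); exact: WJ_WG hM.
apply: funext => lam; apply: funext => q; rewrite /sigmaA /psigma /actT invmxK /bser qpair_WJ //.
case: (pselect (exists k : nat, q = k%:R / N0%:R - qpair lam w)) => [[k ->]|hn]; last first.
  have z0 z : ser N0 (qpair lam w) z q = 0.
    by apply/eqP; apply: contraT => /(serP hN0).
  exact: etrans (etrans (congr1 (fun u => expi q * u) (z0 _)) (mulr0 _)) (esym (z0 _)).
apply: etrans (congr1 (fun u => expi _ * u) (ser_at hN0 _ _ _)) _.
apply: etrans _ (esym (ser_at hN0 _ _ _)).
rewrite chr_monodromy (expc_scale k (hY lam)) expiD expi_mul -/zeta; ring.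
Qed.

(** Weights outside the W_J-orbit start d > 0 grid steps above the lowest exponent, so at step m
    they involve [Y] only below degree m. *)
Lemma oG_split i lam : lam \in oG rts (evec n i) ->
  exists2 d : nat, qpair (evec n i) w - qpair lam w = d%:R / N0%:R &
    (d == 0%N) = (lam \in oJ (evec n i)).
Proof.
move=> hl; have [le hiff] := orbit_val Hrd Hf hl.
have /denq1_int[z1 e1] := hden lam; have /denq1_int[z2 e2] := hden (evec n i).
have e : qpair (evec n i) w - qpair lam w = (z2 - z1)%:~R / N0%:R.
  by rewrite intrB -e1 -e2 -mulrnBl -[_ *+ N0]mulr_natr mulfK.
have z0 : 0 <= z2 - z1.
  rewrite -(ler_int rat) -(pmulr_lge0 _ (_ : 0 < (N0%:R : rat)^-1)) ?invr_gt0 ?ltr0n //.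
  by rewrite -e subr_ge0.
exists `|z2 - z1|%N; first by rewrite e natr_absz ger0_norm.
apply/idP/idP => [/eqP h|/hiff h].
  apply/hiff/eqP; rewrite eq_sym -subr_eq0 e -(ger0_norm z0) -natr_absz h mul0r //.
move: e; rewrite h subrr => /esym/eqP; rewrite mulf_eq0 invr_eq0 (negbTE N0n) orbF intr_eq0.
by move/eqP=> ->.
Qed.

(** A change [v] in degree m of [Y] alters the coefficients of c at step m by the Jacobian of the
    W_J-orbit sums applied to [v], and nothing before. *)
Lemma bser_perturb Y (v : 'rV[CC]_n) m i k : (forall j, (Y j)`_0 = 0) -> (0 < m)%N -> (k <= m)%N ->
  let Y' j := Y j + v 0 j *: 'X^m in let q := k%:R / N0%:R - qpair (evec n i) w in
  cmap rts (bser Y') i q = cmap rts (bser Y) i q +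
    (if k == m then \sum_(lam <- oJ (evec n i)) lpair lam v * a lam else 0).
Proof.
move=> Y0 m0 km Y' q.
have YlE lam : Yl Y' lam = Yl Y lam + lpair lam v *: 'X^m.
  rewrite /Yl /lpair scaler_suml -big_split; apply: eq_bigr => j _.
  by rewrite scalerDr scalerA.
have term lam : lam \in oG rts (evec n i) -> bser Y' lam q = bser Y lam q +
    (if (k == m) && (lam \in oJ (evec n i)) then lpair lam v * a lam else 0).
  move=> /oG_split[d ed <-].
  case: (leqP d k) => hd; last first.
    have qn z : ser N0 (qpair lam w) z q = 0.
      apply/eqP; apply: contraT => /(serP hN0)[k' e]; exfalso.
      have : k%:R / N0%:R = (k' + d)%:R / N0%:R :> rat.
        by rewrite natrD mulrDl -ed; move: e; rewrite /q; lra.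
      have nI : (N0%:R : rat)^-1 != 0 by rewrite invr_eq0.
      move/(mulIf nI)/eqP; rewrite eqr_nat => /eqP; lia.
    rewrite ifF; last by apply/negbTE; rewrite negb_and; apply/orP; right; lia.
    exact: etrans (qn _) (esym (etrans (addr0 _) (qn _))).
  have -> : q = (k - d)%:R / N0%:R - qpair lam w.
    by rewrite natrB // mulrBl -ed /q; ring.
  apply: etrans (ser_at hN0 _ _ _) _.
  apply: etrans _ (congr1 (fun u => u + _) (esym (ser_at hN0 _ _ _))).
  rewrite YlE expc_perturb ?Yl_coef0 //; last by lia.
  rewrite mulrDr; congr (_ + _).
  case: (eqVneq (k - d)%N m) => h.
    have -> : k == m by apply/eqP; lia.
    have -> : d == 0%N by apply/eqP; lia.
    by rewrite mulrC.
  rewrite mulr0 ifF //; apply/negbTE; apply: contra h => /andP[/eqP-> /eqP->].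
  by rewrite subn0.
rewrite [LHS]cmapE; apply: etrans (eq_big_seq _ term) _.
rewrite big_split -cmapE; congr (_ + _).
case: eqP => _ /=; last by rewrite big1.
rewrite -big_mkcond /= -big_filter; apply: perm_big.
have [u1 h1] := oG_spec Hrd (evec n i); have [u2 h2] := oJ_spec Hrd J (evec n i).
apply: uniq_perm => //; first exact: filter_uniq.
move=> lam; rewrite mem_filter; case hl: (lam \in oJ (evec n i)) => //=.
have /h2[G hG ->] := hl; apply/h1; exists G; split=> //; exact: WJ_WG hG.
Qed.

Variable tgt : 'I_n -> Pui.
Hypothesis tgt0 : forall i, tgt i (- qpair (evec n i) w) = \sum_(lam <- oJ (evec n i)) a lam.
Hypothesis tgt_int : forall i k, (0 < k)%N ->
  tgt i (k%:R / N0%:R - qpair (evec n i) w) != 0 -> denq (k%:R / N0%:R - qpair (evec n i) w) = 1.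

(** At step m the error is removed by inverting the Jacobian at the regular character [a]. Step 0
    holds already because the leading coefficients of the target are the orbit sums of [a]. *)
Lemma series_approx m : exists2 Y, equivariant Y & forall i k, (k < m)%N ->
  cmap rts (bser Y) i (k%:R / N0%:R - qpair (evec n i) w) =
  tgt i (k%:R / N0%:R - qpair (evec n i) w).
Proof.
elim: m => [|m [Y hY IH]].
  exists (fun=> 0) => //; split=> [k|lam m]; first by rewrite coef0.
  by rewrite /Yl !big1 ?coef0 ?mulr0 // => k _; rewrite scaler0.
have [m0|m0] := posnP m.
  exists Y => // i k; rewrite m0 ltnS leqn0 => /eqP->.
  rewrite mul0r sub0r tgt0 (cmap_lead Hrd i (bser_hasval Y) Hf).
  by apply: eq_bigr => lam _; rewrite bser_lead.
pose e i := tgt i (m%:R / N0%:R - qpair (evec n i) w) -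
  cmap rts (bser Y) i (m%:R / N0%:R - qpair (evec n i) w).
have [s us hs] := WJ_enum Hrd J.
have uo i := (oJ_spec Hrd J (evec n i)).1; have ho i := (oJ_spec Hrd J (evec n i)).2.
have a0 : a 0 = 1 by exact: chr0.
have aD u u' : a (u + u') = a u * a u' by exact: chrD.
have [v hv] := jacobian_surj Hrd us hs uo ho a0 aD chr_regular e.
(* Target and current image both have integral exponents only, so a nonzero error at step m makes
   m/N0 - <omega_i, nu> an integer, and the two roots of unity agree. *)
have ee i : expi (qpair (evec n i) w) * e i = zeta ^+ m * e i.
  have [->|nz] := eqVneq (e i) 0; first by rewrite !mulr0.
  congr (_ * _); suff h : denq (m%:R / N0%:R - qpair (evec n i) w) = 1.
    have /denq1_int[z hz] := introT eqP h.
    rewrite -expi_mul -[LHS]mulr1 -(expi_int z) -hz -expiD; congr expi; ring.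
  have [_ _ [g [hg hgs]]] := bser_good hY.
  move: nz; rewrite /e.
  case: (eqVneq (tgt i (m%:R / N0%:R - qpair (evec n i) w)) 0) => [->|/tgt_int-> //].
  by rewrite sub0r oppr_eq0 => /(cmap_integral Hrd hg hgs).
(* v is determined by e, so the equivariance of e is inherited by v. *)
have vM : \row_k lpair (evec n k *m M) v = zeta ^+ m *: v.
  apply/eqP; rewrite -subr_eq0; apply/eqP.
  have lpB lam : lpair lam (\row_k lpair (evec n k *m M) v - zeta ^+ m *: v) =
      lpair (lam *m M) v - zeta ^+ m * lpair lam v.
    rewrite lpair_mulmx.
    rewrite /lpair mulr_sumr -sumrB; apply: eq_bigr => k _.
    by rewrite !mxE mulrBr mulrCA.
  apply: (jacobian_inj Hrd us hs uo ho a0 aD chr_regular) => i.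
  under eq_bigr do rewrite lpB mulrBl -mulrA.
  rewrite sumrB -mulr_sumr hv -ee; apply/eqP; rewrite subr_eq0; apply/eqP.
  rewrite -hv -[in RHS](perm_big _ (oJ_perm Hrd (evec n i) hM)) [in RHS]big_map mulr_sumr; apply: eq_big_seq => u /ho[G hG eu].
  have qu : qpair u w = qpair (evec n i) w by rewrite eu qpair_WJ.
  rewrite chr_monodromy qu.
  transitivity (lpair (u *m M) v * (expi (qpair (evec n i) w) * (expi (- qpair (evec n i) w) * a u))).
    by congr (_ * _); rewrite mulrA -expiD subrr expi0 mul1r.
  by rewrite mulrCA.
pose Y' j := Y j + v 0 j *: 'X^m.
have [Y0 hYM] := hY.
exists Y'.
  have YlE lam : Yl Y' lam = Yl Y lam + lpair lam v *: 'X^m.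
    rewrite /Yl /lpair scaler_suml -big_split; apply: eq_bigr => j _.
    by rewrite scalerDr scalerA.
  split=> [k|lam k]; first by rewrite coefD Y0 coefZ coefXn (ltn_eqF m0) mulr0 addr0.
  rewrite !YlE !coefD hYM mulrDr; congr (_ + _); rewrite !coefZ coefXn.
  case: eqP => [->|_]; last by rewrite !mulr0.
  have lv : lpair (lam *m M) v = zeta ^+ m * lpair lam v.
    rewrite lpair_mulmx vM /lpair mulr_sumr; apply: eq_bigr => j _.
    by rewrite mxE mulrCA.
  by rewrite lv !mulr1.
move=> i k; rewrite ltnS => km; rewrite bser_perturb //.
case: eqP => [->|ne]; last by rewrite addr0 IH //; lia.
by rewrite hv /e addrC subrK.
Qed.

End Approximation.


(** Only an upper bound on the exponents is recorded; below the lowest exponent all series in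
    question vanish anyway. *)
Lemma peval_bounded (n : nat) (Q : cpoly n) : exists B : int, forall c c' : 'I_n -> Pui,
  (forall i (j : int), j <= B -> c i j%:~R = c' i j%:~R) -> peval c Q = peval c' Q.
Proof.
elim: Q => [z|i j|P1 [B1 h1] P2 [B2 h2]|P1 [B1 h1] P2 [B2 h2]].
- by exists 0.
- by exists j => c c' h /=; exact: h.
- exists (Num.max B1 B2) => c c' h /=; congr (_ + _); [apply: h1|apply: h2] => i j hj;
    by apply: h; rewrite le_max hj ?orbT.
- exists (Num.max B1 B2) => c c' h /=; congr (_ * _); [apply: h1|apply: h2] => i j hj;
    by apply: h; rewrite le_max hj ?orbT.
Qed.

(** * Deformation along a segment in the alcove *)

Section Density.
Variables (n l : nat) (rts : seq (lat n * lat n)) (alpha : 'I_l -> lat n).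
Hypothesis Hrd : based_root_datum_sc rts alpha.
Variables (J : {set 'I_l}) (w : 'rV[rat]_n).
Hypothesis Hf : facet alpha J (toR w).
Notation WG := (inWG rts).
Notation WJ := (inWM rts alpha J).
Notation RJ := (RM rts alpha J).
Notation oJ := (oJ rts alpha J).
Variables (M : 'M[int]_n) (mu : lat n).
Hypothesis hM : WJ M.
Hypothesis hmu : suppJ J (toA mu - toR w).
Hypothesis hal : forall v, alcv rts alpha J v <-> alcv rts alpha J (ract M v + toA mu).

Lemma chr_alcv_neq1 (x y : avec n) p : alcv rts alpha J x -> RJ p -> chr x y p.1 != 1.
Proof.
move=> hx hp; apply/eqP => /expo_eq1[_ [k e]].
case: (RJ_posJ Hrd hp) => /hx/andP[] /=; rewrite ?rpairNl.
  have -> : rpair p.1 x = (- k)%:~R by rewrite mulrNz -e opprK.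
  by rewrite ltr0z (ltr_int R _ 1); lia.
by rewrite e ltr0z (ltr_int R _ 1); lia.
Qed.

Lemma generic_dense (b : lat n -> Pui) (Q : cpoly n) : good rts w b ->
  peval (cmap rts b) Q != 0 ->
  exists a, [/\ good rts w a, peval (cmap rts a) Q != 0 & forall p, RJ p -> lead a w p.1 != 1].
Proof.
move=> hb hQ; have [ha hv [h [hh hsig]]] := hb; have [f1 f0] := Hf.
have [x0 [y0 [t0 [exy ey et]]]] := lead_chr hb hh hsig.
have hH := sigma_stab Hrd hv Hf hh hsig.
have et' : ract (invmx h) x0 = x0 + toR w - toA (- t0) by rewrite toAN opprK.
have [U [t' [hU ht' []]]] := monodromy_normal_form Hrd hM hmu f0 hal hH et' ey.
set x1 := ract U x0 + toA t'; set y1 := ract U y0 => hc ex1 ey1 _.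
have [b0 hb0 eb0] := alcove_fixpoint Hrd hM hmu f0 hal.
pose xt (t : R) : avec n := x1 + t *: (b0 - x1).
(* The segment ends at the interior fixed point [b0] with second coordinate 0, so that coordinate is
   scaled down to zero. *)
pose yt (t : R) : avec n := y1 + t *: (- y1).
(* The target differs from the image of [b] only in its lowest coefficients, which follow the
   segment; at t = 0 it is that image. *)
pose ft t (i : 'I_n) : Pui := fun q => if q == - qpair (evec n i) w
  then \sum_(lam <- oJ (evec n i)) chr (xt t) (yt t) lam else cmap rts b i q.
have f00 : ft 0%R = cmap rts b.
  apply: funext => i; apply: funext => q; rewrite /ft; case: eqP => // ->.
  rewrite (cmap_lead Hrd i hv Hf) /xt /yt !scale0r !addr0.
  rewrite -[RHS](perm_big _ (oJ_perm Hrd (evec n i) hU)) [RHS]big_map; apply: eq_bigr => lam _.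
  rewrite exy chr_ract /chr /x1 rpairDr rpair_toA opprD -mulrNz.
  by rewrite -/y1 -{1}[rpair lam y1]addr0 expoD expo_int mulr1.
have cont : ccont (fun t => peval (ft t) Q).
  apply: ccont_peval => i j; rewrite /ft; case: eqP => _; last exact: ccont_const.
  rewrite /xt /yt; move: (x1) (y1) => x2 y2; apply: ccont_sum => lam.
  have := ccont_expo (- rpair lam x2)%R (- rpair lam (b0 - x2))%R (rpair lam y2) (- rpair lam y2)%R.
  congr ccont; apply: funext => t; rewrite /chr !(rpairDr, rpairZr, rpairNr).
  by congr expo; ring.
have [t [ht hft]] : exists t : R, 0 < t < 1 /\ peval (ft t) Q != 0.
  by apply: (ccont_nonzero cont); rewrite f00.
have /andP[t_gt0 t_lt1] := ht.
(* Weak inequalities at the closed alcove end and strict ones at [b0] give strict ones for every t >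
   0. *)
have hx : alcv rts alpha J (xt t).
  move=> p hp; have [c1 c2] := hc p hp; have /andP[b1 b2] := hb0 p hp.
  have c1' := lge_ge c1; have c2' := lge_ge c2.
  rewrite /xt rpairDr rpairZr rpairBr; apply/andP; split; nra.
have ext : ract M (xt t) + toA mu = xt t + toR w.
  have e1 : ract M x1 = x1 + toR w - toA mu by rewrite -ex1 addrK.
  have e2 : ract M b0 = b0 + toR w - toA mu by rewrite -eb0 addrK.
  rewrite /xt ractD ractZ ractB e1 e2; apply/rowP => k; rewrite !mxE; ring.
have eyt : ract M (yt t) = yt t by rewrite /yt ractD ractZ ractN ey1.
have [N0 hN0 hden] := common_den w.
have Nn0 : (N0%:R : rat) != 0 by rewrite pnatr_eq0 -lt0n.
have [B hB] := peval_bounded Q.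
(* An exponent up to [B] lies at most [tr i] grid steps above the lowest exponent of c_i; the sum
   over i dominates each of these bounds. *)
pose tr i := Num.truncn (`|B%:~R + qpair (evec n i) w| * N0%:R)%R.
pose m := (\sum_(i < n) tr i).+1.
have tgt0 i : ft t i (- qpair (evec n i) w) =
    \sum_(lam <- oJ (evec n i)) chr (xt t) (yt t) lam by rewrite /ft eqxx.
have tgt_int (i : 'I_n) (k : nat) : (0 < k)%N ->
    ft t i (k%:R / N0%:R - qpair (evec n i) w) != 0 -> denq (k%:R / N0%:R - qpair (evec n i) w) = 1.
  move=> k0; rewrite /ft ifF; first exact: (cmap_integral Hrd hh hsig).
  apply/negbTE; rewrite -subr_eq0 opprK subrK mulf_neq0 ?invr_eq0 // pnatr_eq0 -lt0n //.
have [Y hY hap] := series_approx Hrd Hf hM hx ext eyt hN0 hden tgt0 tgt_int m.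
exists (bser w (xt t) (yt t) N0 Y); split.
- exact: (bser_good Hrd Hf hM ext eyt hN0 hden hY).
- rewrite (_ : peval _ Q = peval (ft t) Q) //; apply: hB => i j hj.
  case: (ltP j%:~R (- qpair (evec n i) w)) => hlt.
    rewrite (cmap_lt Hrd (bser_hasval w (xt t) (yt t) hN0 Y) Hf hlt) /ft (lt_eqF hlt).
    by rewrite (cmap_lt Hrd hv Hf hlt).
  have /denq1_int[z hz] := hden (evec n i).
  have kz : (j * N0%:Z + z)%:~R = (j%:~R + qpair (evec n i) w) * N0%:R :> rat.
    by rewrite intrD intrM -hz -[_ *+ N0]mulr_natr mulrDl.
  have k0 : 0 <= j * N0%:Z + z.
    by rewrite -(ler_int rat) kz mulr_ge0 ?ler0n //; lra.
  pose k := absz (j * N0%:Z + z)%R.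
  have kE : k%:R = (j%:~R + qpair (evec n i) w) * N0%:R :> rat.
    by rewrite natr_absz ger0_norm.
  have -> : j%:~R = k%:R / N0%:R - qpair (evec n i) w :> rat.
    by rewrite kE mulfK // addrK.
  apply: hap; rewrite ltnS /m (bigD1 i) //=; apply: leq_trans (leq_addr _ _).
  rewrite truncn_ge_nat ?mulr_ge0 ?ler0n // kE ler_pM2r ?ltr0n //.
  apply: le_trans (ler_norm _); rewrite lerD2r ler_int //.
- by move=> p hp; rewrite (bser_lead _ _ _ hN0) chr_alcv_neq1.
Qed.

End Density.

Theorem theorem2p3 (n l : nat) (rts : seq (lat n * lat n)) (alpha : 'I_l -> lat n)
  (Hrd : based_root_datum_sc rts alpha)
  (J : {set 'I_l}) (nu : avec n) (Hnu : LambdaP_plus rts alpha J nu) :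
  exists X : ('I_n -> Pui) -> Prop,
    (forall c, X c -> newton l rts nu c) /\
    (exists U : ('I_n -> Pui) -> Prop,
       (forall c, U c -> X c) /\
       rel_open (newton l rts nu) U /\ rel_dense (newton l rts nu) U) /\
    (forall a : lat n -> Pui, isA a -> centralizer_torus rts a ->
       X (cmap rts a) ->
       forall h : 'M[int]_n, inWG rts h -> sigmaA a = actT h a ->
       exists w : 'M[int]_n, w_of_nu rts alpha J nu w /\
         exists g : 'M[int]_n, inWG rts g /\ h = g *m w *m invmx g).
Proof.
have [[lam hlam] hpos] := Hnu.
have [[w ew] h0 hs] := pM_facts Hrd hlam; subst nu.
have hf : facet alpha J (toR w) by [].
have [M [mu [hM hmu hal]]] := alcove_auto Hrd J lam.
have hmu' : suppJ J (toA mu - toR w).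
  rewrite -(subrK (toA lam) (toA mu)) -addrA -toAB; apply: suppJD => //.
  exact/suppJ_toA.
have [P hP] := discriminant_poly Hrd hf.
(* The set [X] is taken to be the open dense set itself: the stratum minus the zeros of the
   discriminant. *)
pose U c := newton l rts (toR w) c /\ peval c P != 0.
exists U; split; [by move=> c []|split].
- exists U; split=> //; split.
    exists (eq P) => c; split=> -[hc hz]; split=> //.
      by move=> /(_ P erefl) e; rewrite e eqxx in hz.
    by apply/eqP => e; apply: hz => _ <-.
  move=> V [S hV] [c /hV[hc hz]].
  have [Q SQ hQ] : exists2 Q, S Q & peval c Q != 0.
    apply: contrapT => hn; apply: hz => Q SQ; apply/eqP; apply: contraT => hQ.
    by case: hn; exists Q.
  have [b hb ec] := (newtonP Hrd hf c).1 hc; rewrite ec in hQ.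
  have [a [ga aQ areg]] := generic_dense Hrd hf hM hmu' hal hb hQ.
  have na : newton l rts (toR w) (cmap rts a) by apply/(newtonP Hrd hf); exists a.
  exists (cmap rts a); split.
    by apply/hV; split=> // /(_ Q SQ) e; rewrite e eqxx in aQ.
  by split=> //; apply/(hP a ga).
- move=> a ha _ [/(newtonP Hrd hf)[b gb ec] hne] h hh hsig.
  have [|g hg eh] := generic_monodromy Hrd hf gb ha ec _ hM hmu' hal hh hsig.
    by move=> a' ga' ea'; apply/(hP a' ga'); rewrite ea' -ec.
  exists (invmx M); split; first exact: w_of_nuI hlam hmu hM hal.
  by exists g.
Qed.
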